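(* Let $k\ge 2$ be a fixed integer. Then, as $n\to\infty$, $$\mathbf E[\mathcal X_{n,1}(\mathcal X_{n,1}-1)]\sim\mathbf E[(\mathcal X_{n,1})^2]\sim\gamma_k\,n^{2-\frac2k},$$ where $$\gamma_k=\frac{\Gamma(2/k)\,(k!)^{2/k}}{k-1}+2\lambda_k,\qquad \lambda_k=\begin{cases}\dfrac{\pi\cot(\pi/k)\,\Gamma(2/k)\,(k!)^{2/k}}{2(k-2)(k-1)} & k>2,\\[2ex] \dfrac{\pi^2}{4} & k=2.\end{cases}$$ Therefore $$\mathrm{Var}(\mathcal X_{n,1})\sim(\gamma_k-\eta_{k,1}^2)\,n^{2-\frac2k},\qquad\text{where } \eta_{k,1}=\frac{(k!)^{1/k}}{k-1}\Gamma(1/k).$$ In particular, when $k=2$, $\mathrm{Var}(\mathcal X_{n,1})\sim\left(\frac{\pi^2}{2}+2-2\pi\right)n$.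
   Context: Let $(T_{i,j})_{i\ge1,j\ge1}$ be i.i.d. exponential random variables of mean $1$, and let $G_{r,j}=\sum_{i=1}^{r}T_{i,j}$. Consider a path with nodes $1,2,\dots,n$, where $1$ is the root and $n$ is the leaf. For $1\le r\le k$, node $j$ is an $r$-record if $G_{r,j}<\min\{G_{k,i}:1\le i<j\}$ (with $\min\emptyset=+\infty$); $I_{r,j}\in\{0,1\}$ is the indicator of this event. $\mathcal X_{n,1}=\sum_{j=1}^{n}I_{1,j}$ is the number of one-records. $\Gamma$ is the gamma function, and $a_n\sim b_n$ means $a_n/b_n\to1$ as $n\to\infty$. *)

(* Defs.v *)
From HB Require Import structures.
From mathcomp Require Import all_boot all_order all_algebra finmap.
From mathcomp Require Import all_classical all_reals all_analysis.

Set Implicit Arguments.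
Unset Strict Implicit.
Unset Printing Implicit Defensive.

Import Order.TTheory GRing.Theory Num.Theory.
Import numFieldNormedType.Exports.

Local Open Scope classical_set_scope.
Local Open Scope ring_scope.

(* Mutual independence of the subfamily indexed by D: the product rule holds
   for every finite set J of indices in D. *)
Definition mutually_independent (R : realType) (d : measure_display)
    (Omega : measurableType d) (P : probability Omega R)
    (I : choiceType) (D : set I) (X : I -> Omega -> R) : Prop :=
  forall (J : {fset I}) (A : I -> set R),
    [set` J] `<=` D -> (forall i, i \in J -> measurable (A i)) ->
    P (\bigcap_(i in [set` J]) (X i @^-1` A i)) =
    (\prod_(i <- J) P (X i @^-1` A i))%E.

Definition asymp_equiv (R : realType) (a b : nat -> R) : Prop :=
  a n / b n @[n --> \oo] --> (1 : R).

Definition Gamma (R : realType) (s : R) : R :=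
  \int[lebesgue_measure]_(x in `]0, +oo[) (x `^ (s - 1) * expR (- x)).

Definition cot (R : realType) (x : R) : R := cos x / sin x.

(* Below, T i j is meaningful only for i, j >= 1; the values at index 0 are
   never used. *)
Section Records.
Context (R : realType) (Omega : Type) (k : nat) (T : nat -> nat -> Omega -> R).

Definition G (r j : nat) (w : Omega) : R := \sum_(1 <= i < r.+1) T i j w.

(* The minimum is taken in \bar R, so that it is +oo for j = 1. *)
Definition is_record (r j : nat) (w : Omega) : bool :=
  ((G r j w)%:E < \big[mine/+oo]_(1 <= i < j) (G k i w)%:E)%E.

Definition num_records (r n : nat) (w : Omega) : R :=
  \sum_(1 <= j < n.+1) (is_record r j w)%:R.

End Records.

Section Constants.
Context (R : realType) (k : nat).

Definition lambda_ : R :=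
  if (2 < k)%N then
    pi * cot (pi / k%:R) * Gamma (2 / k%:R) * (k`!)%:R `^ (2 / k%:R)
      / (2 * (k%:R - 2) * (k%:R - 1))
  else pi ^+ 2 / 4.

Definition gamma_ : R :=
  Gamma (2 / k%:R) * (k`!)%:R `^ (2 / k%:R) / (k%:R - 1) + 2 * lambda_.

Definition eta1 : R :=
  (k`!)%:R `^ (k%:R^-1) / (k%:R - 1) * Gamma (k%:R^-1).

End Constants.

(* Main.v *)
From HB Require Import structures.
Require Import Defs.
From mathcomp Require Import all_boot all_order all_algebra finmap.
From mathcomp Require Import all_classical all_reals all_analysis measurable_realfun.
From mathcomp Require Import zify ring lra.
Import Order.TTheory GRing.Theory Num.Theory.
Import numFieldNormedType.Exports.
Local Open Scope classical_set_scope.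
Local Open Scope ring_scope.

(** Let S and Q be the tail functions of G_{k,1} and of G_{k,1} - T_{1,1} ([S_] and [Q_]). Given
    T_{1,i} = x and T_{1,j} = y with i < j, nodes i and j are both one-records exactly when the i-1
    columns before i exceed max(x,y), the rest of column i exceeds y - x, and the columns strictly
    between i and j exceed y. The columns are independent, so the joint probability is the double
    integral of S(max(x,y))^(i-1) Q(y-x) S(y)^(j-i-1) e^(-x-y) ([prob_record2]), and E[X(X-1)] is
    twice the sum of these probabilities over i < j.

    Fix j of order n, sum over i, and put x = n^(-1/k) u and y = n^(-1/k) v. With c = 1/k!, 1 - S(x)
    is equivalent to c x^k at 0, so S(n^(-1/k) v)^n tends to e^(-c v^k) and Q tends to 1. The sum
    over i is a geometric convolution, whose average tends to a divided difference of the
    exponential ([lim_kernel]). [convolution_bound] dominates everything by a product of two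
    integrable weights, so by dominated convergence the sum over i is equivalent to W n^(1-2/k),
    where W is [lim_integral] ([joint_integral_cvg]). Summing over j by Stolz-Cesaro gives
    2W/(2-2/k) n^(2-2/k) for E[X(X-1)]. The same argument in one variable gives E[X] of order
    n^(1-1/k), which is negligible, so E[X^2] has the same equivalent.

    To evaluate W, the divided difference is written as the average of an exponential over a
    segment. After the substitution v = u z the integral in u is a Gamma integral, and the double
    integral [moment] remains. For k > 2 it reduces to the integral of (1 - z^(k-2))/(1 - z^k) over
    (0,1), which partial fractions over the k-th roots of unity evaluate to (pi/k) cot(pi/k); for k
    = 2 the other order of integration leads to the primitive -atan^2.

    The normalised variance converges to gamma - eta^2 by subtraction. An equivalence further
    requires this constant to be nonzero: [lim_kernel] is bounded below by a kernel with integral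
    L^2 k/(k-1), where L is [lim_single], plus a positive gain on a square ([lim_integral_lower]),
    and this yields eta^2 < gamma. *)

Set Implicit Arguments.
Unset Strict Implicit.

(** * Independence of sigma-algebras generated by disjoint sets of indices *)

Section Independence.
Context (R : realType) (d : measure_display) (Omega : measurableType d)
  (P : probability Omega R) (I : choiceType) (X : I -> {RV P >-> R}).

(** The finite-dimensional events on coordinates in D. They form a pi-system generating the
    sigma-algebra of the family, which is what the uniqueness theorem for measures asks for. *)
Definition cylinders (D : set I) : set (set Omega) :=
  [set E | exists (J : {fset I}) (A : I -> set R),
     [/\ [set` J] `<=` D, forall i, measurable (A i) &
         E = \bigcap_(i in [set` J]) (X i @^-1` A i)]].

Lemma cylindersT D : cylinders D [set: Omega].
Proof.
exists fset0, (fun=> setT); split => //.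
by apply/seteqP; split => // w _ i; rewrite /= in_fset0.
Qed.

Lemma cylinders1 (D : set I) i A : D i -> measurable A ->
  cylinders D (X i @^-1` A).
Proof.
move=> Di mA; exists [fset i]%fset, (fun=> A); split => //.
  by move=> j /=; rewrite in_fset1 => /eqP ->.
apply/seteqP; split => w /=.
  by move=> wA j /=; rewrite in_fset1 => /eqP ->.
by apply => /=; rewrite in_fset1 eqxx.
Qed.

Lemma cylinders_measurable D : cylinders D `<=` measurable.
Proof.
move=> E [J [A [JD mA ->]]]; apply: fin_bigcap_measurable; first exact: finite_fset.
by move=> i _; rewrite -[X in measurable X]setTI; exact: measurable_funP.
Qed.

Lemma cylindersW D D' : D `<=` D' -> cylinders D `<=` cylinders D'.
Proof.
by move=> DD' E [J [A [JD mA ->]]]; exists J, A; split=> //; apply: subset_trans JD _.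
Qed.

Lemma cylinders_setI D : setI_closed (cylinders D).
Proof.
move=> _ _ [J [A [JD mA ->]]] [K [B [KD mB ->]]].
exists (J `|` K)%fset, (fun i => (if i \in J then A i else setT) `&`
                                 (if i \in K then B i else setT)).
split.
- by move=> i /=; rewrite in_fsetU => /orP[/JD|/KD].
- by move=> i; apply: measurableI; case: ifP.
apply/seteqP; split => w /=.
  move=> [wA wB] i /=; rewrite in_fsetU => iJK; split.
    by case: ifPn => // iJ; exact: wA.
  by case: ifPn => // iK; exact: wB.
move=> wAB; split => i /= iJK.
  by have := wAB i; rewrite /= in_fsetU iJK /= => /(_ isT) [].
by have := wAB i; rewrite /= in_fsetU iJK orbT /= => /(_ isT) [].
Qed.

Definition sigma_of (D : set I) : set (set Omega) := <<s cylinders D >>.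

Lemma sigma_of_measurable D : sigma_of D `<=` measurable.
Proof.
apply: smallest_sub; first exact: sigma_algebra_measurable.
exact: cylinders_measurable.
Qed.

Lemma sigma_ofW D D' : D `<=` D' -> sigma_of D `<=` sigma_of D'.
Proof.
move=> DD'; apply: sub_smallest2r; last exact: cylindersW.
exact: smallest_sigma_algebra.
Qed.

Variable (D0 : set I).
Hypothesis indep : mutually_independent P D0 (fun i => X i : Omega -> R).

(** The two index sets J and K are disjoint, so the two constraint families glue to one family C on
    their union; the product rule is applied to the union and the product is split again. *)
Lemma indep_cylinders (D1 D2 : set I) E F : D1 `<=` D0 -> D2 `<=` D0 ->
  D1 `&` D2 `<=` set0 -> cylinders D1 E -> cylinders D2 F ->
  P (E `&` F) = (P E * P F)%E.
Proof.
move=> D10 D20 dis [J [A [JD mA ->]]] [K [B [KD mB ->]]].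
have JK i : i \in J -> i \in K -> False.
  move=> /JD iD1 /KD iD2; exact: (dis i).
pose C i := if i \in J then A i else B i.
have -> : \bigcap_(i in [set` J]) (X i @^-1` A i) `&`
          \bigcap_(i in [set` K]) (X i @^-1` B i) =
          \bigcap_(i in [set` (J `|` K)%fset]) (X i @^-1` C i).
  apply/seteqP; split => w /=.
    move=> [wA wB] i /=; rewrite in_fsetU /C; case: ifPn => iJ /=.
      by move=> _; exact: wA.
    by move=> iK; exact: wB.
  move=> wC; split => i /= iJK.
    by have := wC i; rewrite /= in_fsetU iJK /C iJK; exact.
  have := wC i; rewrite /= in_fsetU iJK orbT /C ifF; first exact.
  by apply/negP => /JK; exact.
rewrite (indep (subset_trans JD D10)) // (indep (subset_trans KD D20)) //.
have JKD : [set` (J `|` K)%fset] `<=` D0.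
  by move=> i /=; rewrite in_fsetU => /orP[/JD/D10|/KD/D20].
rewrite (indep JKD); last by move=> i _; rewrite /C; case: ifP.
rewrite (perm_big (enum_fset J ++ enum_fset K)); last first.
  apply: uniq_perm; first exact: fset_uniq.
    rewrite cat_uniq !fset_uniq andbT /=; apply/hasPn => i iK.
    by apply/negP => iJ; exact: JK iJ iK.
  by move=> i; rewrite mem_cat in_fsetU.
rewrite big_cat/=; congr (_ * _)%E; apply: eq_big_seq => i iJ; rewrite /C.
  by rewrite iJ.
by rewrite ifF//; apply/negP => /JK; exact.
Qed.

(** For fixed E, the maps sending F to P(E and F) and to P(E) P(F) are finite measures. They agree
    on a pi-system containing the whole space, hence on what it generates. *)
Lemma indep_extend (G : set (set Omega)) (E : set Omega) :
  measurable E -> G `<=` measurable -> setI_closed G -> G setT ->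
  (forall F, G F -> P (E `&` F) = (P E * P F)%E) ->
  forall F, <<s G >> F -> P (E `&` F) = (P E * P F)%E.
Proof.
move=> mE Gm GI GT GE F sF.
have PEfin : P E \is a fin_num by exact: fin_num_measure.
have PE0 : 0 <= fine (P E) by exact: fine_ge0.
pose m1 := mrestr P mE.
pose m2 := mscale (NngNum PE0) P.
have : m1 F = m2 F.
  apply: (g_sigma_algebra_measure_unique G _ (fun=> setT)) => //.
  - by apply/seteqP; split => // w _; exists 0%N.
  - move=> A GA; change (P (A `&` E) = (fine (P E))%:E * P A)%E.
    by rewrite setIC GE// fineK.
  - move=> _; change (P (setT `&` E) < +oo)%E.
    by rewrite setTI (le_lt_trans (probability_le1 _ _))// ltry.
change (P (F `&` E) = (fine (P E))%:E * P F -> P (E `&` F) = P E * P F)%E.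
by rewrite setIC fineK.
Qed.

(** [indep_extend] is applied twice, enlarging one factor at a time from cylinders to the generated
    sigma-algebra. *)
Lemma indep_sigma (D1 D2 : set I) E F : D1 `<=` D0 -> D2 `<=` D0 ->
  D1 `&` D2 `<=` set0 -> sigma_of D1 E -> sigma_of D2 F ->
  P (E `&` F) = (P E * P F)%E.
Proof.
move=> D10 D20 dis sE sF.
apply: (@indep_extend (cylinders D2)) => //.
- exact: sigma_of_measurable sE.
- exact: cylinders_measurable.
- exact: cylinders_setI.
- exact: cylindersT.
move=> {F sF}F cF; rewrite setIC muleC.
apply: (@indep_extend (cylinders D1)) => //.
- exact: cylinders_measurable cF.
- exact: cylinders_measurable.
- exact: cylinders_setI.
- exact: cylindersT.
by move=> {E sE}E cE; rewrite setIC muleC; exact: (@indep_cylinders D1 D2).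
Qed.

End Independence.

(** * Integration against a measure given by a density *)

Import HBNNSimple.

Section Density.
Context (R : realType) (d : measure_display) (T : measurableType d)
  (mu nu : {measure set T -> \bar R}) (g : T -> R).
Hypothesis mg : measurable_fun setT g.
Hypothesis g0 : forall x, 0 <= g x.
Hypothesis nuE : forall A, measurable A -> nu A = (\int[mu]_(x in A) (g x)%:E)%E.


Let integral_density_nnsfun (f : {nnsfun T >-> R}) :
  (\int[nu]_x (f x)%:E = \int[mu]_x ((f x)%:E * (g x)%:E))%E.
Proof.
have mfr r : measurable (f @^-1` [set r]) by exact: measurable_funPTI.
under [LHS]eq_integral do rewrite fimfunE -fsumEFin//.
rewrite [LHS]ge0_integral_fsum//; last 2 first.
  - by move=> r; exact/measurable_EFinP/measurableT_comp.
  - by move=> n x _; rewrite EFinM nnfun_muleindic_ge0.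
under [RHS]eq_integral.
  move=> x xD; rewrite fimfunE -fsumEFin// muleC ge0_mule_fsumr; last first.
    by move=> r; rewrite EFinM nnfun_muleindic_ge0.
  over.
rewrite [RHS]ge0_integral_fsum//; last 2 first.
  - move=> r; apply: emeasurable_funM; first exact/measurable_EFinP.
    exact/measurable_EFinP/measurableT_comp.
  - move=> n x _; apply: mule_ge0; first by rewrite lee_fin.
    by rewrite EFinM nnfun_muleindic_ge0.
apply: eq_fsbigr => r /[!inE] -[t _ <-].
have ft0 : (0 <= (f t)%:E)%E by rewrite lee_fin.
under eq_integral do rewrite EFinM.
rewrite ge0_integralZl//; last exact/measurable_EFinP/measurable_indic.
rewrite integral_indic// setIT nuE//.
under [RHS]eq_integral do rewrite EFinM muleCA.
rewrite ge0_integralZl//; last 2 first.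
  - apply: emeasurable_funM; first exact/measurable_EFinP.
    exact/measurable_EFinP/measurable_indic.
  - by move=> x _; rewrite mule_ge0 ?lee_fin.
congr (_ * _)%E; rewrite integral_mkcond; apply: eq_integral => x _.
by rewrite epatch_indic.
Qed.

(** The hypothesis [nuE] is the case of indicators; it extends to simple functions by linearity and
    to nonnegative functions by monotone convergence. *)
Lemma ge0_integral_density (f : T -> \bar R) :
  measurable_fun setT f -> (forall x, 0 <= f x)%E ->
  (\int[nu]_x f x = \int[mu]_x (f x * (g x)%:E))%E.
Proof.
move=> mf f0.
pose f_ := nnsfun_approx measurableT mf.
transitivity (lim (\int[nu]_x (f_ n x)%:E @[n --> \oo])%E).
  rewrite -monotone_convergence//=.
  - apply: eq_integral => ? /[!inE] xD; apply/esym/cvg_lim => //=.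
    exact: cvg_nnsfun_approx.
  - by move=> n; exact/measurable_EFinP/measurable_funTS.
  - by move=> n ? _; rewrite lee_fin.
  - by move=> ? _ ? ? mn; rewrite lee_fin; exact/lefP/nd_nnsfun_approx.
transitivity (lim (\int[mu]_x ((f_ n x)%:E * (g x)%:E) @[n --> \oo])%E).
  by apply: congr_lim; apply/funext => n /=; exact: integral_density_nnsfun.
rewrite -monotone_convergence//=.
- apply: eq_integral => x /[!inE] xD; apply/cvg_lim => //.
  apply: cvgeZr => //; exact: cvg_nnsfun_approx.
- by move=> n; apply: emeasurable_funM; exact/measurable_EFinP.
- by move=> n ? _; rewrite mule_ge0// lee_fin.
- move=> x _ ? ? mn; apply: lee_wpmul2r; first by rewrite lee_fin.
  by rewrite lee_fin; exact/lefP/nd_nnsfun_approx.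
Qed.

End Density.

(** * Conditioning on one exponential variable *)

Section Conditioning.
Context (R : realType) (d : measure_display) (Omega : measurableType d)
  (P : probability Omega R) (I : choiceType) (X : I -> {RV P >-> R}).
Variable D0 : set I.
Hypothesis indep : mutually_independent P D0 (fun i => X i : Omega -> R).
Hypothesis expX : forall i, D0 i -> forall A : set R, measurable A ->
  distribution P (X i) A = exponential_prob 1 A.

Local Notation mu := (@lebesgue_measure R).
Local Notation sigmaT D := (g_sigma_algebraType (cylinders X D)).

(** The identity into Omega equipped with the coarser sigma-algebra of D acts as a single random
    element carrying all the variables of D. Conditioning on this element avoids listing
    coordinates. *)
Lemma measurable_id_sigma (D : set I) :
  measurable_fun [set: Omega] (fun w : Omega => w : sigmaT D).
Proof.
move=> _ B mB; rewrite setTI.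
exact: (@sigma_of_measurable _ _ _ _ _ X D B mB).
Qed.

Lemma measurable_X_sigma (D : set I) i : D i ->
  measurable_fun [set: sigmaT D] (X i : sigmaT D -> R).
Proof.
move=> Di _ B mB; rewrite setTI; apply: sub_sigma_algebra.
exact: cylinders1.
Qed.

Let idm (D : set I) : {mfun Omega >-> sigmaT D} :=
  HB.pack (fun w : Omega => w : sigmaT D)
    (isMeasurableFun.Build _ _ _ _ _ (measurable_id_sigma (D:=D))).

Local Notation RL := (measurableTypeR R).

Let measurable_XL i : measurable_fun [set: Omega] (X i : Omega -> RL).
Proof. by move=> mT B mB; exact: (@measurable_funPT _ _ _ _ (X i) mT B mB). Qed.

Let XL i : {mfun Omega >-> RL} :=
  HB.pack (X i : Omega -> RL)
    (isMeasurableFun.Build _ _ Omega RL _ (@measurable_XL i)).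

(** The exponential density lives on the closed half-line; the null point 0 is dropped so that later
    scalings and powers only meet positive arguments. *)
Let ge0_integral_exp i (f : RL -> \bar R) : D0 i ->
  measurable_fun setT f -> (forall x, 0 <= f x)%E ->
  (\int[distribution P (XL i)]_y f y =
   \int[mu]_(y in `]0%R, +oo[) (f y * (expR (- y))%:E))%E.
Proof.
move=> Di mf f0.
rewrite (@ge0_integral_density _ _ _ mu _ (exponential_pdf 1))//; last 3 first.
- exact: measurable_exponential_pdf.
- by move=> x; exact: exponential_pdf_ge0.
- by move=> A mA; apply: expX.
rewrite [RHS]integral_itv_obnd_cbnd; last first.
  apply: emeasurable_funM; first exact: measurable_funTS.
  apply/measurable_EFinP/measurable_funTS.
  by apply: measurableT_comp => //.
rewrite [RHS]integral_mkcond; apply: eq_integral => x _.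
rewrite /exponential_pdf !patchE; case: ifPn => //; last by rewrite mule0.
by rewrite mulN1r mul1r.
Qed.

(** By [indep_sigma] the joint law of the element carrying D and of X i is a product measure.
    Tonelli then integrates out X i, whose density is e^(-y). All record probabilities are computed
    by iterating this formula. *)
Lemma conditioning (D : set I) i (A : set (sigmaT D * RL)) :
  D `<=` D0 -> D0 i -> ~ D i -> measurable A ->
  (P [set w | A (w, X i w)] =
   \int[mu]_(y in `]0%R, +oo[) (P [set w | A (w, y)] * (expR (- y))%:E))%E.
Proof.
move=> DD0 D0i Di mA.
pose m1 := distribution P (idm D).
pose m2 := distribution P (XL i).
have mp : measurable_fun setT (fun w => (idm D w, XL i w)).
  by apply: measurable_fun_pair.
pose pairX : {mfun Omega >-> (sigmaT D * RL)%type} :=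
  HB.pack (fun w => (idm D w, XL i w)) (isMeasurableFun.Build _ _ _ _ _ mp).
have -> : P [set w | A (w, X i w)] = (m1 \x m2)%E A.
  rewrite (@product_measure_unique _ _ _ _ _ m1 m2 (distribution P pairX))//.
  move=> B C mB mC.
  rewrite /m1 /m2 /distribution /pushforward /=.
  apply: (indep_sigma indep DD0 (D2 := [set i])).
  - by move=> j ->.
  - by move=> j [] Dj ji; apply: Di; rewrite -ji.
  - exact: mB.
  - by apply: sub_sigma_algebra; exact: cylinders1.
have -> : (m1 \x m2)%E A = (\int[m2]_y m1 (ysection A y))%E.
  rewrite -[X in (_ \x _)%E X]setIT -integral_indic//.
  rewrite fubini_tonelli2//; last by apply/measurable_EFinP.
  apply: eq_integral => y _; rewrite /fubini_G/=.
  transitivity (\int[m1]_x (\1_(ysection A y) x)%:E)%E.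
    by apply: eq_integral => x _; rewrite /= !indicE mem_ysection.
  by rewrite integral_indic ?setIT//; exact: measurable_ysection.
rewrite ge0_integral_exp//; last exact: measurable_fun_ysection.
apply: eq_integral => y _; congr (_ * _)%E; rewrite /m1 /distribution /pushforward.
congr (P _); apply/seteqP; split => w /=; by rewrite /ysection /= inE.
Qed.

Lemma measurable_prob_section (D : set I) (A : set (sigmaT D * RL)) :
  measurable A ->
  measurable_fun setT (fun y : RL => P [set w | A (w, y)]).
Proof.
move=> mA; have := @measurable_fun_ysection _ _ _ _ _ (distribution P (idm D)) _ mA.
congr measurable_fun; apply/funext => y /=; rewrite /distribution /pushforward.
congr (P _); apply/seteqP; split => w /=; by rewrite /ysection /= inE.
Qed.

End Conditioning.

(** * Measurability of sums and comparisons *)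

Lemma measurable_sum_seq (R : realType) (d : measure_display)
    (T : measurableType d) (I : eqType) (s : seq I) (h : I -> T -> R) :
  (forall i, i \in s -> measurable_fun setT (h i)) ->
  measurable_fun setT (fun x => \sum_(i <- s) h i x).
Proof.
elim: s => [|i s IHs] mh.
  by rewrite (_ : (fun _ => _) = cst 0)//; apply/funext => x; rewrite big_nil.
under eq_fun do rewrite big_cons.
apply: measurable_funD; first by apply: mh; rewrite mem_head.
by apply: IHs => j js; apply: mh; rewrite inE js orbT.
Qed.

Lemma measurable_set_lt (R : realType) (d : measure_display)
    (T : measurableType d) (f g : T -> R) :
  measurable_fun setT f -> measurable_fun setT g ->
  measurable [set x | f x < g x].
Proof.
move=> mf mg; have := measurable_fun_ltr mf mg.
move=> /(_ measurableT [set true] I); rewrite setTI.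
by congr measurable; apply/seteqP; split => x.
Qed.

Lemma measurable_set_le (R : realType) (d : measure_display)
    (T : measurableType d) (f g : T -> R) :
  measurable_fun setT f -> measurable_fun setT g ->
  measurable [set x | f x <= g x].
Proof.
move=> mf mg; have := measurable_fun_ler mf mg.
move=> /(_ measurableT [set true] I); rewrite setTI.
by congr measurable; apply/seteqP; split => x.
Qed.

Lemma measurable_comp_fst d1 d2 d3 (T1 : measurableType d1)
    (T2 : measurableType d2) (T3 : measurableType d3) (f : T1 -> T3) :
  measurable_fun setT f -> measurable_fun setT (fun p : T1 * T2 => f p.1).
Proof. by move=> mf; apply: (measurableT_comp mf). Qed.

Lemma measurable_comp_snd d1 d2 d3 (T1 : measurableType d1)
    (T2 : measurableType d2) (T3 : measurableType d3) (f : T2 -> T3) :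
  measurable_fun setT f -> measurable_fun setT (fun p : T1 * T2 => f p.2).
Proof. by move=> mf; apply: (measurableT_comp mf). Qed.

(** The induction step for the volume x^r/r! of a simplex, used for the small-argument behaviour of
    sums of exponentials. *)
Lemma integral_subX (R : realType) (r : nat) (x : R) : 0 <= x ->
  (\int[lebesgue_measure]_(y in `[0%R, x]) ((x - y) ^+ r / r`!%:R)%:E =
   (x ^+ r.+1 / (r.+1)`!%:R)%:E)%E.
Proof.
rewrite le_eqVlt => /predU1P[<-|x0].
  by rewrite set_itv1 integral_set1 expr0n/= mul0r.
pose F (y : R) := - ((x - y) ^+ r.+1 / (r.+1)`!%:R).
have dF (y : R) : is_derive y 1 F ((x - y) ^+ r / r`!%:R).
  have -> : F = - ((r.+1)`!%:R^-1 *: (cst x - (id : R -> R)) ^+ r.+1).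
    by apply/funext => z; rewrite /F !fctE mulrC.
  apply: is_derive_eq; rewrite /GRing.scale/= sub0r factS natrM invfM.
  have r0 : r.+1%:R != 0 :> R by rewrite pnatr_eq0.
  have f0 : r`!%:R != 0 :> R by rewrite pnatr_eq0 -lt0n fact_gt0.
  by field; rewrite f0 nat1r r0.
have cF : continuous F.
  by move=> y; apply: differentiable_continuous; exact/derivable1_diffP.
rewrite (@continuous_FTC2 _ _ F)//.
- by rewrite /F subrr expr0n/= mul0r oppr0 addr0 add0e opprK.
- apply: continuous_subspaceT => y; apply: cvgM; last exact: cvg_cst.
  apply: (@continuous_comp _ _ _ (fun y : R => x - y) (fun z => z ^+ r)).
    by apply: cvgB; [exact: cvg_cst|exact: cvg_id].
  exact: exprn_continuous.
- split.
  + by move=> y _; exact: ex_derive.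
  + exact/cvg_at_right_filter/cF.
  + exact/cvg_at_left_filter/cF.
- by move=> y _; rewrite derive1E; exact: derive_val.
Qed.

(** * The distribution function of a sum of exponentials near 0 *)

Section Sums.
Context (R : realType) (d : measure_display) (Omega : measurableType d)
  (P : probability Omega R) (I : choiceType) (X : I -> {RV P >-> R}).
Variable D0 : set I.
Hypothesis indep : mutually_independent P D0 (fun i => X i : Omega -> R).
Hypothesis expX : forall i, D0 i -> forall A : set R, measurable A ->
  distribution P (X i) A = exponential_prob 1 A.

Local Notation mu := (@lebesgue_measure R).
Local Notation sigmaT D := (g_sigma_algebraType (cylinders X D)).

Definition sumX (s : seq I) (w : Omega) : R := \sum_(i <- s) X i w.

Lemma measurable_sumX (D : set I) s : [set` s] `<=` D ->
  measurable_fun [set: sigmaT D] (sumX s : sigmaT D -> R).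
Proof.
by move=> sD; apply: measurable_sum_seq => i /sD Di; exact: measurable_X_sigma.
Qed.

Lemma sumX_measurable s : measurable_fun [set: Omega] (sumX s).
Proof. by apply: measurable_sum_seq. Qed.

Definition sum_le s (x : R) := P [set w | sumX s w <= x].

(** The convolution recursion: condition on the first summand, which is independent of the others
    because the list has no repetition. *)
Lemma sum_le_cons i s x : uniq (i :: s) -> [set` i :: s] `<=` D0 ->
  (sum_le (i :: s) x =
   \int[mu]_(y in `]0%R, +oo[) (sum_le s (x - y) * (expR (- y))%:E))%E.
Proof.
move=> /=/andP[si us] sD.
have D0i : D0 i by apply: sD; rewrite /= mem_head.
have sD0 : [set` s] `<=` D0 by move=> j js; apply: sD; rewrite /= inE js orbT.
pose A : set (sigmaT [set` s] * measurableTypeR R) :=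
  [set p | sumX s p.1 <= x - p.2].
have mA : measurable A.
  apply: measurable_set_le.
    by apply: (measurableT_comp (measurable_sumX (@subset_refl _ _))).
  by apply: measurable_funB.
transitivity (P [set w | A (w, X i w)]).
  rewrite /sum_le; congr (P _); apply/seteqP; split => w /=;
  by rewrite /A/= /sumX big_cons lerBrDl.
by rewrite (conditioning indep expX sD0 D0i _ mA)//; exact/negP.
Qed.

(** The recursion [sum_le_cons] no longer mentions which variable was removed. This makes all
    columns of equal length identically distributed. *)
Lemma sum_le_size s s' x : uniq s -> uniq s' ->
  [set` s] `<=` D0 -> [set` s'] `<=` D0 -> size s = size s' ->
  sum_le s x = sum_le s' x.
Proof.
elim: s s' x => [|i s IHs] [|i' s'] x //= us us' sD sD' [ss'].
rewrite !sum_le_cons//; apply: eq_integral => y _; congr (_ * _)%E.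
have [[_ {}us] [_ {}us']] := (andP us, andP us').
apply: IHs => // j js; [apply: sD|apply: sD']; by rewrite /= inE js orbT.
Qed.

Lemma measurable_sum_le s : measurable_fun [set: R] (sum_le s).
Proof.
pose Y : {RV P >-> R} := HB.pack (sumX s)
  (isMeasurableFun.Build _ _ _ _ _ (sumX_measurable s)).
rewrite (_ : sum_le s = cdf Y); first exact: cdf_measurable.
by apply/funext => x; rewrite /cdf /distribution /pushforward set_itvNyc.
Qed.

Lemma sum_le_lt0 s x : uniq s -> [set` s] `<=` D0 -> x < 0 -> sum_le s x = 0%E.
Proof.
elim: s x => [|i s IHs] x us sD x0.
  rewrite /sum_le (_ : [set _ | _] = set0) ?measure0//.
  by apply/seteqP; split => w //=; rewrite /sumX big_nil leNgt x0.
rewrite sum_le_cons// integral0_eq// => y; rewrite /= in_itv/= andbT => y0.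
move: us => /andP[_ us].
rewrite IHs ?mul0e//; last by rewrite subr_lt0 (lt_trans x0).
by move=> j js; apply: sD; rewrite /= inE js orbT.
Qed.

(** Up to x, the product of the r exponential densities lies between e^(-x) and 1 on a simplex of
    volume x^r/r!. Proved by induction along the convolution recursion; these bounds replace an
    explicit Gamma law throughout. *)
Lemma sum_le_bounds s x : uniq s -> [set` s] `<=` D0 -> 0 <= x ->
  ((expR (- x) * (x ^+ size s / (size s)`!%:R))%:E <= sum_le s x <=
   (x ^+ size s / (size s)`!%:R)%:E)%E.
Proof.
elim: s x => [|i s IHs] x us sD x0.
  rewrite /sum_le (_ : [set _ | _] = setT); last first.
    by apply/seteqP; split => w //= _; rewrite /sumX big_nil.
  rewrite probability_setT/= expr0 fact0 divr1 mulr1 lexx andbT lee_fin.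
  by rewrite -expR0 ler_expR oppr_le0.
have {}IHs y : 0 <= y -> ((expR (- y) * (y ^+ size s / (size s)`!%:R))%:E <= 
    sum_le s y <= (y ^+ size s / (size s)`!%:R)%:E)%E.
  apply: IHs; first by case/andP: us.
  by move=> j js; apply: sD; rewrite /= inE js orbT.
have us' : uniq s by case/andP: us.
have sD' : [set` s] `<=` D0 by move=> j js; apply: sD; rewrite /= inE js orbT.
have mf : measurable_fun [set: R] (fun y => sum_le s (x - y) * (expR (- y))%:E)%E.
  apply: emeasurable_funM.
    apply: (measurableT_comp (measurable_sum_le s)).
    exact: measurable_funB.
  apply/measurable_EFinP; apply: measurableT_comp => //.
have mp : measurable_fun [set: R] (fun y => ((x - y) ^+ size s / (size s)`!%:R)).
  apply: measurable_funM => //; apply: measurable_funX.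
  exact: measurable_funB.
have f0 y : (0 <= sum_le s (x - y) * (expR (- y))%:E)%E.
  by rewrite mule_ge0// lee_fin expR_ge0.
(* For y > x the remaining sum would have to be negative, so the integral stops at x. *)
have -> : sum_le (i :: s) x =
    (\int[mu]_(y in `[0%R, x]) (sum_le s (x - y) * (expR (- y))%:E))%E.
  rewrite sum_le_cons// integral_itv_obnd_cbnd; last exact: measurable_funTS.
  rewrite integral_mkcond [RHS]integral_mkcond; apply: eq_integral => y _.
  rewrite !patchE !mem_setE/= !in_itv/= andbT.
  have [xy|xy] := leP y x; first by rewrite andbT.
  rewrite andbF; case: ifP => // _.
  by rewrite sum_le_lt0 ?mul0e// subr_lt0.
rewrite -integral_subX//; apply/andP; split.
  rewrite EFinM -integral_subX// -ge0_integralZl//=; last 2 first.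
  - exact/measurable_EFinP/measurable_funTS.
  - move=> y; rewrite in_itv/= => /andP[y0 yx].
    by rewrite lee_fin divr_ge0// exprn_ge0// subr_ge0.
  apply: ge0_le_integral => //.
  - move=> y; rewrite /= in_itv/= => /andP[y0 yx].
    by rewrite lee_fin mulr_ge0 ?expR_ge0// divr_ge0// exprn_ge0// subr_ge0.
  - by apply/measurable_EFinP/measurable_funTS/measurable_funM.
  - exact: measurable_funTS.
  - move=> y; rewrite /= in_itv/= => /andP[y0 yx].
    have /andP[+ _] := IHs (x - y) ltac:(by rewrite subr_ge0).
    move=> /(lee_wpmul2r _) => /(_ (expR (- y))%:E).
    rewrite lee_fin expR_ge0 => /(_ isT); apply: le_trans.
    rewrite -!EFinM lee_fin mulrAC -expRD (_ : - (x - y) + - y = - x); first by []; by ring.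
apply: ge0_le_integral => //.
- exact: measurable_funTS.
- exact/measurable_EFinP/measurable_funTS.
- move=> y; rewrite /= in_itv/= => /andP[y0 yx].
  have /andP[_] := IHs (x - y) ltac:(by rewrite subr_ge0).
  apply: le_trans; rewrite -[leRHS]mule1; apply: lee_pmul => //.
  by rewrite lee_fin -expR0 ler_expR oppr_le0.
Qed.

End Sums.

(** * Independence of several blocks of variables *)

Section Blocks.
Context (R : realType) (d : measure_display) (Omega : measurableType d)
  (P : probability Omega R) (I : choiceType) (X : I -> {RV P >-> R}).
Variable D0 : set I.
Hypothesis indep : mutually_independent P D0 (fun i => X i : Omega -> R).

(** One block is peeled off at a time with [indep_sigma]. The induction must also carry the fact
    that the intersection is measurable for the union of the remaining blocks. *)
Lemma indep_blocks (J : eqType) (b : I -> J) (D : set I) (s : seq J)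
    (E : J -> set Omega) :
  D `<=` D0 -> uniq s ->
  (forall l, l \in s -> sigma_of X (D `&` [set i | b i = l]) (E l)) ->
  P (\bigcap_(l in [set` s]) E l) = (\prod_(l <- s) P (E l))%E.
Proof.
move=> DD0 us sE.
suff [] : sigma_of X (D `&` [set i | b i \in s]) (\bigcap_(l in [set` s]) E l) /\
  P (\bigcap_(l in [set` s]) E l) = (\prod_(l <- s) P (E l))%E by [].
elim: s us sE => [_ _|l s IHs /= /andP[ls us] sE].
  rewrite set_nil bigcap_set0 big_nil probability_setT; split => //.
  by apply: sub_sigma_algebra; exact: cylindersT.
have [] := IHs us _.
  by move=> m ms; apply: sE; rewrite inE ms orbT.
have sEl := sE l (mem_head _ _).
have -> : \bigcap_(m in [set` l :: s]) E m = E l `&` \bigcap_(m in [set` s]) E m.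
  apply/seteqP; split => w /=.
    move=> wE; split; first by apply: wE; rewrite /= mem_head.
    by move=> m /= ms; apply: wE; rewrite /= inE ms orbT.
  move=> [wl ws] m /=; rewrite inE => /predU1P[->//|ms]; exact: ws.
move=> sEs PE; split.
  apply: (@measurableI _ (g_sigma_algebraType
      (cylinders X (D `&` [set i | b i \in l :: s])))).
    apply: (sigma_ofW (D := D `&` [set i | b i = l])) => //.
    by move=> i [Di /= ->]; split => //=; rewrite mem_head.
  apply: (sigma_ofW (D := D `&` [set i | b i \in s])) => //.
  by move=> i [Di /= bi]; split => //=; rewrite inE bi orbT.
rewrite big_cons -PE; apply: (indep_sigma indep _ _ _ sEl sEs).
- by move=> i [/DD0].
- by move=> i [/DD0].
- by move=> i /= [[_ ->]] [_]; exact/negP.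
Qed.

End Blocks.

(** * Integral formulas for the probabilities of one and of two records *)

Section RecordProbabilities.
Context (R : realType) (d : measure_display) (Omega : measurableType d)
  (P : probability Omega R) (T : nat -> nat -> {RV P >-> R}).
Let X (ij : nat * nat) : {RV P >-> R} := T ij.1 ij.2.
Let D0 : set (nat * nat) := [set ij : nat * nat | (1 <= ij.1)%N /\ (1 <= ij.2)%N].
Hypothesis indepT : mutually_independent P D0 (fun ij => T ij.1 ij.2 : Omega -> R).
Hypothesis expT : forall i j, (1 <= i)%N -> (1 <= j)%N ->
  forall A : set R, measurable A -> distribution P (T i j) A = exponential_prob 1 A.
Variable k : nat.
Hypothesis k_ge2 : (2 <= k)%N.

Local Notation mu := (@lebesgue_measure R).
Local Notation sigmaT D := (g_sigma_algebraType (cylinders X D)).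

Let expX : forall i, D0 i -> forall A : set R, measurable A ->
  distribution P (X i) A = exponential_prob 1 A.
Proof. by move=> [i j] [] /= i1 j1; exact: expT. Qed.

Definition column a r j : seq (nat * nat) := [seq (i, j) | i <- index_iota a r.+1].

Definition tail_prob s (x : R) : R := fine (P [set w | x < sumX X s w]).

(** [S_] is the tail of a full column sum (k exponentials), [Q_] that of a column without its first
    entry (k-1 exponentials). Column 1 stands for any column, by [tail_prob_col]. *)
Definition S_ x := tail_prob (column 1 k 1) x.
Definition Q_ x := tail_prob (column 2 k 1) x.

Lemma tail_probE s x : (tail_prob s x)%:E = P [set w | x < sumX X s w].
Proof.
rewrite fineK//; apply: fin_num_measure.
by apply: measurable_set_lt => //; exact: sumX_measurable.
Qed.

Lemma tail_prob1B s x : (tail_prob s x)%:E = (1 - sum_le X s x)%E.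
Proof.
rewrite tail_probE /sum_le -probability_setC; last first.
  by apply: measurable_set_le => //; exact: sumX_measurable.
by congr (P _); apply/seteqP; split => w /=; rewrite ltNge => /negP.
Qed.

Lemma sum_leE s x : sum_le X s x = (1 - tail_prob s x)%:E.
Proof.
have fs : sum_le X s x \is a fin_num.
  apply: fin_num_measure; apply: measurable_set_le => //.
  exact: sumX_measurable.
have := tail_prob1B s x; rewrite -(fineK fs) -EFinB => -[->].
by rewrite subKr.
Qed.

Lemma col_uniq a r j : uniq (column a r j).
Proof. by rewrite map_inj_uniq ?iota_uniq// => x y []. Qed.

Lemma mem_col a r j i l : ((i, l) \in column a r j) = (a <= i <= r)%N && (l == j).
Proof.
apply/mapP/andP => [[m]|[air /eqP ->]].
  by rewrite mem_index_iota => mr [-> ->].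
by exists i => //; rewrite mem_index_iota.
Qed.

Lemma col_D0 a r j : (0 < a)%N -> (0 < j)%N -> [set` column a r j] `<=` D0.
Proof.
move=> a0 j0 [i l] /=; rewrite mem_col => /andP[/andP[ai _] /eqP ->].
by split => //=; exact: leq_trans ai.
Qed.

Lemma size_col a r j : size (column a r j) = (r.+1 - a)%N.
Proof. by rewrite size_map size_iota. Qed.

Lemma tail_prob_col a r j x : (0 < a)%N -> (0 < j)%N ->
  tail_prob (column a r j) x = tail_prob (column a r 1) x.
Proof.
move=> a0 j0; apply: EFin_inj; rewrite !tail_prob1B; congr (1 - _)%E.
by apply: (sum_le_size indepT expX); rewrite ?col_uniq ?size_col//; exact: col_D0.
Qed.

Lemma G_sumX r j w : G T r j w = sumX X (column 1 r j) w.
Proof. by rewrite /G /sumX /column big_map. Qed.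

Lemma is_recordE j w : is_record k T 1 j w <->
  forall l, l \in index_iota 1 j -> T 1 j w < sumX X (column 1 k l) w.
Proof.
rewrite /is_record /G big_nat1.
elim: (index_iota 1 j) => [|l s IHs].
  by rewrite big_nil ltry; split.
rewrite big_cons lt_min lte_fin; split.
  move=> /andP[h1 /IHs h2] m; rewrite inE => /predU1P[->|/h2//].
  by rewrite -G_sumX.
move=> h; apply/andP; split.
  by have := h l (mem_head _ _); rewrite -G_sumX.
by apply/IHs => m ms; apply: h; rewrite inE ms orbT.
Qed.

Lemma sigma_sumX_gt (D : set (nat * nat)) s x : [set` s] `<=` D ->
  sigma_of X D [set w | x < sumX X s w].
Proof.
move=> sD; apply: (@measurable_set_lt _ _ (sigmaT D)) => //.
exact: measurable_sumX.
Qed.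

(** Distinct columns are independent blocks. The starting row a and the threshold t depend on the
    column, so that one statement also covers a column whose first entry has been conditioned on. *)
Lemma prob_columns_gt (D : set (nat * nat)) (s : seq nat) (a : nat -> nat)
    (t : nat -> R) :
  D `<=` D0 -> uniq s -> (forall l, l \in s -> [set` column (a l) k l] `<=` D) ->
  P [set w | forall l, l \in s -> t l < sumX X (column (a l) k l) w] =
  (\prod_(l <- s) tail_prob (column (a l) k l) (t l))%:E.
Proof.
move=> DD0 us sD; rewrite -prodEFin.
under [RHS]eq_bigr do rewrite tail_probE.
rewrite -(@indep_blocks _ _ _ _ _ X _ indepT _ (fun ij => ij.2) D s
  (fun l => [set w | t l < sumX X (column (a l) k l) w]) DD0 us).
  by congr (P _); apply/seteqP; split.
move=> l ls; apply: sigma_sumX_gt => -[i m] ilm; split; first exact: sD ilm.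
by move: ilm; rewrite /= mem_col => /andP[_ /eqP].
Qed.

Lemma measurable_sumX_fst (D : set (nat * nat)) s : [set` s] `<=` D ->
  measurable_fun setT (fun p : sigmaT D * measurableTypeR R => sumX X s p.1).
Proof.
move=> sD.
exact: (@measurable_comp_fst _ _ _ (sigmaT D) (measurableTypeR R) _ _
  (@measurable_sumX R d Omega P _ X D s sD)).
Qed.

Lemma measurable_X_fst (D : set (nat * nat)) i : D i ->
  measurable_fun setT (fun p : sigmaT D * measurableTypeR R => X i p.1).
Proof.
move=> Di.
exact: (@measurable_comp_fst _ _ _ (sigmaT D) (measurableTypeR R) _ _
  (@measurable_X_sigma R d Omega P _ X D i Di)).
Qed.

Lemma measurable_cond_gt (D : set (nat * nat)) (s : seq nat) (a : nat -> nat)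
    (t : nat -> R -> R) :
  (forall l, l \in s -> [set` column (a l) k l] `<=` D) ->
  (forall l, measurable_fun setT (t l)) ->
  measurable [set p : sigmaT D * measurableTypeR R |
     forall l, l \in s -> t l p.2 < sumX X (column (a l) k l) p.1].
Proof.
move=> sD mt.
apply: (@fin_bigcap_measurable _ _ _ [set` s] (fun l =>
  [set p : sigmaT D * measurableTypeR R | t l p.2 < sumX X (column (a l) k l) p.1])).
  exact: finite_seq.
move=> l ls; apply: measurable_set_lt.
  exact: (measurable_comp_snd (mt l)).
exact: measurable_sumX_fst (sD _ ls).
Qed.

Lemma measurable_tail_prob s : measurable_fun setT (tail_prob s).
Proof.
rewrite (_ : tail_prob s = fine \o (fun x => 1 - sum_le X s x)%E).
  apply: measurableT_comp => //; apply: emeasurable_funB => //.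
  exact: measurable_sum_le.
by apply/funext => x; rewrite /= -tail_prob1B.
Qed.

Lemma tail_prob_ge0 s x : 0 <= tail_prob s x.
Proof. exact: fine_ge0. Qed.

Lemma tail_prob_le1 s x : tail_prob s x <= 1.
Proof.
rewrite -lee_fin tail_probE; apply: probability_le1.
by apply: measurable_set_lt => //; exact: sumX_measurable.
Qed.

Lemma tail_prob_nonincreasing s x y : x <= y -> tail_prob s y <= tail_prob s x.
Proof.
move=> xy; rewrite -lee_fin !tail_probE; apply: le_measure.
- by rewrite inE; apply: measurable_set_lt => //; exact: sumX_measurable.
- by rewrite inE; apply: measurable_set_lt => //; exact: sumX_measurable.
- by move=> w /=; exact: le_lt_trans.
Qed.

Lemma tail_prob_lt0 a r x : (0 < a)%N -> x < 0 -> tail_prob (column a r 1) x = 1.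
Proof.
move=> a0 x0; apply: EFin_inj; rewrite tail_prob1B.
by rewrite (sum_le_lt0 indepT expX) ?sube0// ?col_uniq//; exact: col_D0.
Qed.

Lemma tail_prob_bounds a r x : (0 < a)%N -> 0 <= x ->
  expR (- x) * (x ^+ (r.+1 - a) / (r.+1 - a)`!%:R) <=
    1 - tail_prob (column a r 1) x <= x ^+ (r.+1 - a) / (r.+1 - a)`!%:R.
Proof.
move=> a0 x0; rewrite -!lee_fin -sum_leE -(size_col a r 1).
by apply: (sum_le_bounds indepT expX) => //; [exact: col_uniq|exact: col_D0].
Qed.

(** Conditionally on T_{1,j} = y, each of the j-1 earlier columns must exceed y. *)
Lemma prob_record j : (0 < j)%N ->
  (P [set w | is_record k T 1 j w] =
   \int[mu]_(y in `]0%R, +oo[) ((S_ y ^+ j.-1 * expR (- y))%:E))%E.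
Proof.
move=> j0.
pose D := D0 `\` [set (1%N, j)].
have DD0 : D `<=` D0 by move=> ? [].
have sD l : l \in index_iota 1 j -> [set` column 1 k l] `<=` D.
  rewrite mem_index_iota => /andP[l1 lj] [i m] /= ilm; split.
    exact: (@col_D0 1 k l).
  by move: ilm; rewrite mem_col => /andP[_ /eqP ->] [_ lj']; rewrite lj' ltnn in lj.
pose A : set (sigmaT D * measurableTypeR R) :=
  [set p | forall l, l \in index_iota 1 j -> p.2 < sumX X (column 1 k l) p.1].
have mA : measurable A.
  by apply: (@measurable_cond_gt D (index_iota 1 j) (fun=> 1%N) (fun=> id)).
transitivity (P [set w | A (w, X (1%N, j) w)]).
  by congr (P _); apply/seteqP; split => w /is_recordE.
rewrite (conditioning indepT expX DD0 _ _ mA)//; last first.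
  by move=> [_]; apply.
apply: eq_integral => y _.
rewrite /A/= (@prob_columns_gt D _ (fun=> 1%N) (fun=> y))//; last exact: iota_uniq.
rewrite -EFinM; congr (_ * _)%:E.
rewrite big_seq (eq_bigr (fun=> S_ y)).
  by rewrite -big_seq big_const_seq count_predT size_iota subn1 iter_mulr_1.
by move=> l; rewrite mem_index_iota => /andP[l1 _]; rewrite tail_prob_col.
Qed.

(** Two successive conditionings, first on T_{1,j} = y and then on T_{1,i} = x. What remains is one
    inequality for each column l < j, and these are independent. *)
Lemma prob_record2 i j : (0 < i)%N -> (i < j)%N ->
  (P [set w | is_record k T 1 i w /\ is_record k T 1 j w] =
   \int[mu]_(y in `]0%R, +oo[) \int[mu]_(x in `]0%R, +oo[)
      ((S_ (Num.max x y) ^+ i.-1 * Q_ (y - x) * S_ y ^+ (j - i).-1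
        * expR (- x) * expR (- y))%:E))%E.
Proof.
move=> i0 ij.
have j0 : (0 < j)%N by exact: leq_trans ij.
pose D := D0 `\` [set (1%N, j)].
have DD0 : D `<=` D0 by move=> ? [].
have sD l : l \in index_iota 1 j -> [set` column 1 k l] `<=` D.
  rewrite mem_index_iota => /andP[l1 lj] [i' m] /= ilm; split.
    exact: (@col_D0 1 k l).
  by move: ilm; rewrite mem_col => /andP[_ /eqP ->] [_ lj']; rewrite lj' ltnn in lj.
have iota_ij l : l \in index_iota 1 i -> l \in index_iota 1 j.
  by rewrite !mem_index_iota => /andP[-> /=] li; exact: ltn_trans ij.
pose B : set (sigmaT D * measurableTypeR R) :=
  [set p | forall l, l \in index_iota 1 i -> X (1%N, i) p.1 < sumX X (column 1 k l) p.1].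
pose C : set (sigmaT D * measurableTypeR R) :=
  [set p | forall l, l \in index_iota 1 j -> p.2 < sumX X (column 1 k l) p.1].
have Di : D (1%N, i).
  by split => //= -[] eij; rewrite eij ltnn in ij.
have mB : measurable B.
  apply: (@fin_bigcap_measurable _ _ _ [set` index_iota 1 i] (fun l =>
    [set p : sigmaT D * measurableTypeR R |
      X (1%N, i) p.1 < sumX X (column 1 k l) p.1])).
    exact: finite_seq.
  move=> l ls; apply: measurable_set_lt.
    exact: measurable_X_fst Di.
  exact: measurable_sumX_fst (sD _ (iota_ij _ ls)).
have mC : measurable C.
  by apply: (@measurable_cond_gt D (index_iota 1 j) (fun=> 1%N) (fun=> id)).
transitivity (P [set w | (B `&` C) (w, X (1%N, j) w)]).
  congr (P _); apply/seteqP; split => w /= [].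
    by move=> /is_recordE h1 /is_recordE h2; split.
  by move=> h1 h2; split; exact/is_recordE.
rewrite (conditioning indepT expX DD0 _ _ (measurableI _ _ mB mC))//; last first.
  by move=> [_]; apply.
apply: eq_integral => y _.
pose D' := D `\` [set (1%N, i)].
have D'D0 : D' `<=` D0 by move=> ? [] /DD0.
(* Columns before i must beat both x and y; column i has lost its first entry x, so the rest must
   beat y - x; later columns must beat y. *)
pose a l := if l == i then 2%N else 1%N.
pose t l x := if (l < i)%N then Num.max x y else if l == i then y - x else y.
have sD' l : l \in index_iota 1 j -> [set` column (a l) k l] `<=` D'.
  move=> lj [i' m] /= ilm; split.
    apply: (sD l lj); move: ilm; rewrite /= !mem_col /a => /andP[/andP[h ->] ->].
    by rewrite !andbT (leq_trans _ h)//; case: ifP.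
  move: ilm; rewrite mem_col /a => /andP[h /eqP ->] [i'1 li].
  by move: h; rewrite li eqxx i'1.
have mt l : measurable_fun setT (t l).
  rewrite /t; case: (l < i)%N; first by apply: measurable_maxr.
  by case: (l == i) => //; apply: measurable_funB.
pose A : set (sigmaT D' * measurableTypeR R) :=
  [set p | forall l, l \in index_iota 1 j -> t l p.2 < sumX X (column (a l) k l) p.1].
have mA : measurable A by exact: measurable_cond_gt.
have sum_col w : sumX X (column 1 k i) w = X (1%N, i) w + sumX X (column 2 k i) w.
  by rewrite /sumX /column !big_map big_ltn// ltnS (leq_trans _ k_ge2).
transitivity (P [set w | A (w, X (1%N, i) w)] * (expR (- y))%:E)%E.
  congr (P _ * _)%E; apply/seteqP; split => w /=.
    move=> [h1 h2] l lj; rewrite /t /a.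
    have := h2 l lj; rewrite /=; case: (ltngtP l i) => [li|il|->] //.
      have /h1 /= : l \in index_iota 1 i.
        by move: lj; rewrite !mem_index_iota li => /andP[->].
      by rewrite gt_max => -> ->.
    by rewrite sum_col ltrBlDl.
  move=> h; split => l /= lj; last first.
    have := h l lj; rewrite /t /a; case: (ltngtP l i) => [li|il|->] //.
      by rewrite gt_max => /andP[].
    by rewrite sum_col ltrBlDl.
  have := h l (iota_ij _ lj); rewrite /t /a.
  move: lj; rewrite mem_index_iota => /andP[_ li].
  by rewrite li (ltn_eqF li) gt_max => /andP[].
rewrite (conditioning indepT expX D'D0 _ _ mA)//; last first.
  by move=> [_]; apply.
rewrite -ge0_integralZr//; last 2 first.
- apply: emeasurable_funM.
    apply: measurable_funTS; exact: (measurable_prob_section mA).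
  by apply/measurable_EFinP/measurable_funTS; apply: measurableT_comp.
- by move=> x _; rewrite mule_ge0// lee_fin expR_ge0.
apply: eq_integral => x _.
rewrite /A/= (@prob_columns_gt D' _ a (t ^~ x))//; last exact: iota_uniq.
rewrite -!EFinM; congr (_ * _ * _)%:E.
rewrite (@big_cat_nat _ _ _ i)//=; last exact: ltnW.
rewrite [X in _ * X]big_ltn// mulrA; congr (_ * _ * _).
- rewrite big_nat (eq_bigr (fun=> S_ (Num.max x y))).
    by rewrite -big_nat big_const_nat subn1 iter_mulr_1.
  move=> l /andP[l1 li]; rewrite /a /t li (ltn_eqF li) tail_prob_col//.
- by rewrite /a /t ltnn eqxx tail_prob_col.
- rewrite big_nat (eq_bigr (fun=> S_ y)).
    by rewrite -big_nat big_const_nat subnS iter_mulr_1.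
  move=> l /andP[il lj]; rewrite /a /t ltnNge (ltnW il)/= (gtn_eqF il).
  by rewrite tail_prob_col// (leq_ltn_trans _ il).
Qed.

End RecordProbabilities.

(** * Linear change of variables for Lebesgue integrals *)

Section Scaling.
Context (R : realType).
Local Notation mu := (@lebesgue_measure R).
Local Notation RL := (measurableTypeR R).
Variable a : R.
Hypothesis a0 : 0 < a.

Let scale : RL -> RL := *%R a.

Let measurable_scale : measurable_fun [set: RL] scale.
Proof. by apply: measurable_funM. Qed.

Let scalem : {mfun RL >-> RL} :=
  HB.pack scale (isMeasurableFun.Build _ _ RL RL _ measurable_scale).

Let a0' : 0 <= a. Proof. exact: ltW. Qed.

Lemma lebesgue_measure_scale (A : set RL) : measurable A ->
  mu A = (a%:E * mu (scale @^-1` A))%E.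
Proof.
move=> mA.
rewrite (@lebesgue_measure_unique _ (mscale (NngNum a0') (pushforward mu scalem)))//.
move=> _ [[c e] _ <-].
change (mu `]c, e]%classic = (a%:E * mu (scale @^-1` `]c, e]))%E).
have -> : scale @^-1` `]c, e] = `]c / a, e / a]%classic.
  apply/seteqP; split => x /=; rewrite !in_itv/= /scale.
    by move=> /andP[h1 h2]; rewrite ltr_pdivrMr// ler_pdivlMr// mulrC h1 h2.
  by rewrite ltr_pdivrMr// ler_pdivlMr// mulrC.
rewrite !lebesgue_measure_itv/= !lte_fin ltr_pM2r ?invr_gt0//.
case: ifP => _; last by rewrite mule0.
by rewrite -!EFinD -EFinM; congr EFin; field; rewrite gt_eqF.
Qed.

(** Obtained from the behaviour of the measure itself under scaling, so that it applies to merely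
    measurable integrands such as those built from S and Q. *)
Lemma ge0_integral_scaleT (f : R -> \bar R) :
  measurable_fun setT f -> (forall x, 0 <= f x)%E ->
  (\int[mu]_x f x = a%:E * \int[mu]_x f (a * x)%R)%E.
Proof.
move=> mf f0.
rewrite (eq_measure_integral (mscale (NngNum a0') (pushforward mu scalem))); last first.
  by move=> A mA _; exact: lebesgue_measure_scale.
rewrite ge0_integral_mscale//; congr (_ * _)%E.
by rewrite ge0_integral_pushforward.
Qed.

Lemma ge0_integral_scale (D D' : set R) (f : R -> \bar R) :
  measurable D -> measurable D' -> (forall x, D (a * x) <-> D' x) ->
  measurable_fun setT f -> (forall x, 0 <= f x)%E ->
  (\int[mu]_(x in D) f x = a%:E * \int[mu]_(x in D') f (a * x)%R)%E.
Proof.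
move=> mD mD' DD' mf f0.
rewrite integral_mkcond ge0_integral_scaleT//; last 2 first.
- by apply/(measurable_restrictT f) => //; exact: measurable_funTS.
- by move=> x; exact: erestrict_ge0.
congr (_ * _)%E; rewrite [RHS]integral_mkcond; apply: eq_integral => x _.
rewrite !patchE; case: ifPn => [|]; case: ifPn => [|] //; rewrite ?notin_setE ?in_setE.
- by move=> h /DD'.
- by move=> /DD' h /(_ h).
Qed.

Lemma ge0_integral_scale0y (f : R -> \bar R) :
  measurable_fun setT f -> (forall x, 0 <= f x)%E ->
  (\int[mu]_(x in `]0%R, +oo[) f x = a%:E * \int[mu]_(x in `]0%R, +oo[) f (a * x)%R)%E.
Proof.
by apply: ge0_integral_scale => // x; rewrite /= !in_itv/= !andbT pmulr_rgt0.
Qed.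

Lemma ge0_integral_scale0a (f : R -> \bar R) :
  measurable_fun setT f -> (forall x, 0 <= f x)%E ->
  (\int[mu]_(x in `]0%R, a[) f x = a%:E * \int[mu]_(x in `]0%R, 1%R[) f (a * x)%R)%E.
Proof.
apply: ge0_integral_scale => // x; rewrite /= !in_itv/= pmulr_rgt0//.
by rewrite -{2}(mulr1 a) ltr_pM2l.
Qed.

End Scaling.

(** * Inequalities and limits for powers close to 1 *)

Section Powers.
Context (R : realType).
Implicit Types a b t : R.

Lemma bernoulli_inequality t n : -1 <= t -> 1 + n%:R * t <= (1 + t) ^+ n.
Proof.
move=> t1; elim: n => [|n IHn]; first by rewrite mul0r addr0 expr0.
rewrite exprS; apply: le_trans (_ : (1 + t) * (1 + n%:R * t) <= _); last first.
  by apply: ler_wpM2l => //; lra.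
rewrite -natr1; have : 0 <= n%:R * t ^+ 2 by rewrite mulr_ge0// sqr_ge0.
by rewrite expr2; nra.
Qed.

(** Bernoulli turns the linear factor into (1+t)^n, and (1+t)(1-t) is at most 1. This is the source
    of all integrable dominations below. *)
Lemma expr_mul_linear_le1 t n : 0 <= t <= 1 -> (1 + n%:R * t) * (1 - t) ^+ n <= 1.
Proof.
move=> /andP[t0 t1].
apply: le_trans (_ : (1 + t) ^+ n * (1 - t) ^+ n <= _).
  apply: ler_wpM2r; first by rewrite exprn_ge0// subr_ge0.
  by apply: bernoulli_inequality; lra.
by rewrite -exprMn exprn_ile1//; nra.
Qed.

(** Squeeze with e^(-u)(1-u^2) <= 1-u <= e^(-u). Raised to the power N, the correction (1-u^2)^N is
    at least 1 - (N u) u by Bernoulli, which tends to 1. *)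
Lemma one_minus_pow_cvg (N : nat -> nat) (u : nat -> R) (L : R) :
  (forall n, 0 <= u n <= 1) -> (N n)%:R * u n @[n --> \oo] --> L ->
  u n @[n --> \oo] --> (0 : R) ->
  (1 - u n) ^+ N n @[n --> \oo] --> expR (- L).
Proof.
move=> u01 NuL u0.
apply: (@squeeze_cvgr _ _ _ _
  (fun n => expR (- ((N n)%:R * u n)) * (1 - ((N n)%:R * u n) * u n))
  (fun n => expR (- ((N n)%:R * u n)))).
- apply: nearW => n; have /andP[un0 un1] := u01 n.
  have e0 : 0 < expR (- u n) by exact: expR_gt0.
  have ee : expR (u n) * expR (- u n) = 1 by rewrite expRxMexpNx_1.
  have h1 : 1 - u n <= expR (- u n) by apply: le_trans (expR_ge1Dx _).
  have h2 : expR (- u n) * (1 - u n ^+ 2) <= 1 - u n.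
    have : 1 + u n <= expR (u n) by exact: expR_ge1Dx.
    rewrite expr2; nra.
  rewrite -mulrN expRM_natl; apply/andP; split; last first.
    by apply: lerXn2r => //; rewrite nnegrE ?subr_ge0// ltW.
  apply: le_trans (_ : (expR (- u n) * (1 - u n ^+ 2)) ^+ N n <= _); last first.
    apply: lerXn2r => //; rewrite nnegrE.
      by apply: mulr_ge0; [exact: ltW|rewrite subr_ge0 exprn_ile1].
    by rewrite subr_ge0.
  rewrite exprMn; apply: ler_wpM2l; first by rewrite exprn_ge0 ?ltW.
  have := @bernoulli_inequality (- u n ^+ 2) (N n).
  rewrite mulrN expr2 mulrA; apply; nra.
- rewrite -[X in _ --> X]mulr1; apply: cvgM.
    by apply: continuous_cvg; [exact: continuous_expR|exact: cvgN].
  rewrite -[X in _ --> X]subr0; apply: cvgB; first exact: cvg_cst.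
  by rewrite -(mulr0 L); apply: cvgM.
- by apply: continuous_cvg; [exact: continuous_expR|exact: cvgN].
Qed.

Lemma geometric_sum2 a b N :
  (b - a) * \sum_(m < N.+1) a ^+ m * b ^+ (N - m) = b ^+ N.+1 - a ^+ N.+1.
Proof.
rewrite subrXX; congr (_ * _); apply: eq_bigr => i _.
by rewrite mulrC.
Qed.

Lemma half_power_bound t h N : 0 <= t <= 1 -> (N <= h.*2)%N ->
  (1 + N%:R * t) * (1 - t) ^+ h <= 2.
Proof.
move=> /andP[t0 t1] Nh.
have := @expr_mul_linear_le1 t h; rewrite t0 t1 => /(_ isT).
have : 0 <= (1 - t) ^+ h by rewrite exprn_ge0// subr_ge0.
have : (N%:R : R) <= 2 * h%:R by rewrite -natrM ler_nat mul2n.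
move: (_ ^+ h) => q Nh2 q0 hq.
have := ler_wpM2r (mulr_ge0 t0 q0) Nh2; nra.
Qed.

(** The sum is at most N+1, and t times the sum is at most 1; hence the bound 2N+1 <= 3N. *)
Lemma geometric_sum_bound t N : 0 <= t <= 1 -> (0 < N)%N ->
  (1 + N%:R * t) * \sum_(m < N.+1) (1 - t) ^+ m <= 3 * N%:R.
Proof.
move=> /andP[t0 t1] N0.
have h1 : \sum_(m < N.+1) (1 - t) ^+ m <= N%:R + 1.
  rewrite natr1 -[X in _ <= X%:R]card_ord -sumr_const; apply: ler_sum => i _.
  by rewrite exprn_ile1 ?subr_ge0// lerBlDr lerDl.
have h2 : t * \sum_(m < N.+1) (1 - t) ^+ m <= 1.
  have := subrX1 (1 - t) N.+1.
  have : 0 <= (1 - t) ^+ N.+1 by rewrite exprn_ge0// subr_ge0.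
  rewrite (_ : 1 - t - 1 = - t); last by ring.
  move: (_ ^+ _) (\sum_(_ < _) _) => q s; nra.
have : 1 <= N%:R :> R by rewrite ler1n.
move: h1 h2; move: (\sum_(_ < _) _) => s h1 h2 N1; nra.
Qed.

(** In each term one of the two exponents is at least h, half of N rounded up, so the convolution is
    at most a^h times the sum of the b^m plus b^h times the sum of the a^m. By [half_power_bound]
    and [geometric_sum_bound] each part contributes at most 2 times 3N. The left side separates a
    from b, hence a domination by a product of one-variable functions. *)
Lemma convolution_bound a b N : 0 <= a <= 1 -> 0 <= b <= 1 -> (0 < N)%N ->
  (1 + N%:R * (1 - a)) * (1 + N%:R * (1 - b)) *
    (\sum_(m < N.+1) a ^+ m * b ^+ (N - m)) <= 12 * N%:R.
Proof.
move=> /andP[a0 a1] /andP[b0 b1] N0.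
pose h := uphalf N.
have Nh : (N <= h.*2)%N by rewrite /h -{1}(odd_double_half N) uphalfE; lia.
have : \sum_(m < N.+1) a ^+ m * b ^+ (N - m) <=
  a ^+ h * (\sum_(m < N.+1) b ^+ m) + b ^+ h * (\sum_(m < N.+1) a ^+ m).
  rewrite [X in a ^+ h * X](reindex_inj rev_ord_inj)/= !mulr_sumr -big_split/=.
  apply: ler_sum => m _; rewrite subSS.
  have [hm|mh] := leqP h m.
    rewrite -[leLHS]addr0; apply: lerD; last by rewrite mulr_ge0// exprn_ge0.
    by apply: ler_wpM2r; rewrite ?exprn_ge0// ler_wiXn2l.
  rewrite -[leLHS]add0r; apply: lerD; first by rewrite mulr_ge0// exprn_ge0.
  rewrite mulrC; apply: ler_wpM2r; rewrite ?exprn_ge0// ler_wiXn2l//.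
  by move: Nh mh; have := ltn_ord m; lia.
have := @half_power_bound (1 - a) h N.
have := @half_power_bound (1 - b) h N.
have := @geometric_sum_bound (1 - a) N.
have := @geometric_sum_bound (1 - b) N.
rewrite !subKr !subr_ge0 !lerBlDr !lerDl a0 a1 b0 b1 Nh N0.
move=> /(_ isT isT) + /(_ isT isT) + /(_ isT isT) + /(_ isT isT).
have : 0 <= \sum_(m < N.+1) b ^+ m by apply: sumr_ge0 => i _; exact: exprn_ge0.
have : 0 <= \sum_(m < N.+1) a ^+ m by apply: sumr_ge0 => i _; exact: exprn_ge0.
have : 0 <= a ^+ h by exact: exprn_ge0.
have : 0 <= b ^+ h by exact: exprn_ge0.
have A1 : 1 <= 1 + N%:R * (1 - a) by rewrite lerDl mulr_ge0// subr_ge0.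
have B1 : 1 <= 1 + N%:R * (1 - b) by rewrite lerDl mulr_ge0// subr_ge0.
move: (1 + N%:R * (1 - a)) A1 (1 + N%:R * (1 - b)) B1 => A A1 B B1.
move: (b ^+ h) (a ^+ h) (\sum_(m < N.+1) a ^+ m) (\sum_(m < N.+1) b ^+ m)
  (\sum_(m < N.+1) a ^+ m * b ^+ (N - m)).
move=> bh ah sa sb s bh0 ah0 sa0 sb0 h1 h2 h3 h4 h5.
apply: le_trans (_ : (A * ah) * (B * sb) + (B * bh) * (A * sa) <= _).
  have AB0 : 0 <= A * B by nra.
  by apply: le_trans (ler_wpM2l AB0 h5) _; rewrite le_eqVlt; apply/orP; left; apply/eqP; ring.
have N0' : 0 <= N%:R :> R by [].
have : (A * ah) * (B * sb) <= 2 * (3 * N%:R) by apply: ler_pM => //; nra.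
have : (B * bh) * (A * sa) <= 2 * (3 * N%:R) by apply: ler_pM => //; nra.
nra.
Qed.

End Powers.

(** * Iterated integrals over rectangles *)

Section Iterated.
Context (R : realType).
Local Notation mu := (@lebesgue_measure R).
Local Notation RL := (measurableTypeR R).

Definition measurable2 (f : R -> R -> \bar R) :=
  measurable_fun [set: RL * RL] (fun p => f p.1 p.2).

Variables (f : R -> R -> \bar R).
Hypothesis mf : measurable2 f.
Hypothesis f0 : forall x y, (0 <= f x y)%E.

Lemma measurable2_section1 y : measurable_fun setT (f ^~ y).
Proof. exact: (measurable_fun_pair1 y mf). Qed.

Lemma measurable2_section2 x : measurable_fun setT (f x).
Proof. exact: (measurable_fun_pair2 x mf). Qed.

(** Extension by zero outside the rectangle reduces integrals over sets to Tonelli on the whole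
    plane. *)
Let g (D1 D2 : set R) (p : RL * RL) : \bar R :=
  (fun p : RL * RL => f p.1 p.2) \_ (D1 `*` D2) p.

Let g0 D1 D2 p : (0 <= g D1 D2 p)%E.
Proof. by apply: erestrict_ge0. Qed.

Let mg (D1 D2 : set RL) : measurable D1 -> measurable D2 ->
  measurable_fun setT (g D1 D2).
Proof.
move=> mD1 mD2; apply/(measurable_restrictT _ (measurableX mD1 mD2)).
exact: measurable_funTS.
Qed.

Let inner1 (D1 D2 : set R) y : D2 y ->
  (\int[mu]_x g D1 D2 (x, y) = \int[mu]_(x in D1) f x y)%E.
Proof.
move=> D2y; rewrite [RHS]integral_mkcond; apply: eq_integral => x _.
rewrite /g !patchE; congr (if _ then _ else _).
by apply/idP/idP; rewrite !inE //= => -[].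
Qed.

Let inner2 (D1 D2 : set R) x : D1 x ->
  (\int[mu]_y g D1 D2 (x, y) = \int[mu]_(y in D2) f x y)%E.
Proof.
move=> D1x; rewrite [RHS]integral_mkcond; apply: eq_integral => y _.
rewrite /g !patchE; congr (if _ then _ else _).
by apply/idP/idP; rewrite !inE //= => -[].
Qed.

Let outer1 (D1 D2 : set R) y : ~ D2 y -> (\int[mu]_x g D1 D2 (x, y) = 0)%E.
Proof.
move=> D2y; apply: integral0_eq => x _.
by rewrite /g patchE memNset// => -[].
Qed.

Let outer2 (D1 D2 : set R) x : ~ D1 x -> (\int[mu]_y g D1 D2 (x, y) = 0)%E.
Proof.
move=> D1x; apply: integral0_eq => y _.
by rewrite /g patchE memNset// => -[].
Qed.

Lemma measurable_inner1 (D : set R) : measurable D ->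
  measurable_fun setT (fun y : R => \int[mu]_(x in D) f x y)%E.
Proof.
move=> mD; rewrite (_ : (fun _ => _) = fubini_G mu (g D setT)).
  by apply: measurable_fun_fubini_tonelli_G => //; exact: mg.
by apply/funext => y; rewrite -(@inner1 D setT).
Qed.

Lemma measurable_inner2 (D : set R) : measurable D ->
  measurable_fun setT (fun x : R => \int[mu]_(y in D) f x y)%E.
Proof.
move=> mD; rewrite (_ : (fun _ => _) = fubini_F mu (g setT D)).
  by apply: measurable_fun_fubini_tonelli_F => //; exact: mg.
by apply/funext => x; rewrite -(@inner2 setT D).
Qed.

Lemma tonelli (D1 D2 : set R) : measurable D1 -> measurable D2 ->
  (\int[mu]_(y in D2) \int[mu]_(x in D1) f x y =
   \int[mu]_(x in D1) \int[mu]_(y in D2) f x y)%E.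
Proof.
move=> mD1 mD2; transitivity (\int[mu]_y \int[mu]_x g D1 D2 (x, y))%E.
  rewrite integral_mkcond; apply: eq_integral => y _; rewrite patchE.
  case: ifPn => [|]; rewrite ?inE ?notin_setE => yD; first by rewrite inner1.
  by rewrite outer1.
rewrite -(@fubini_tonelli _ _ _ _ _ mu mu (g D1 D2))//; last exact: mg.
rewrite [RHS]integral_mkcond; apply: eq_integral => x _; rewrite patchE.
case: ifPn => [|]; rewrite ?inE ?notin_setE => xD; first by rewrite inner2.
by rewrite outer2.
Qed.

End Iterated.

(** * Dominated convergence for double integrals *)

Section Dominated2.
Context (R : realType).
Local Notation mu := (@lebesgue_measure R).
Local Notation RL := (measurableTypeR R).
Local Notation Rpos := (`]0%R, +oo[%classic : set R).
Variables (f_ : nat -> R -> R -> R) (f : R -> R -> R) (w : R -> R).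
Hypothesis mf_ : forall n, measurable2 (fun x y => (f_ n x y)%:E).
Hypothesis mf : measurable2 (fun x y => (f x y)%:E).
Hypothesis f_0 : forall n x y, 0 <= f_ n x y.
Hypothesis f0 : forall x y, 0 <= f x y.
Hypothesis mw : measurable_fun setT w.
Hypothesis w0 : forall x, 0 <= w x.
Hypothesis iw : (\int[mu]_(x in Rpos) (w x)%:E < +oo)%E.
Hypothesis f_cvg : forall x y, 0 < x -> 0 < y -> f_ n x y @[n --> \oo] --> f x y.
Hypothesis f_dom : forall n x y, 0 < x -> 0 < y -> f_ n x y <= w x * w y.

Let W := fine (\int[mu]_(x in Rpos) (w x)%:E).

Let WE : (\int[mu]_(x in Rpos) (w x)%:E = W%:E)%E.
Proof.
by rewrite fineK// ge0_fin_numE// integral_ge0// => x _; rewrite lee_fin.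
Qed.

Let W0 : 0 <= W.
Proof. by apply: fine_ge0; apply: integral_ge0 => x _; rewrite lee_fin. Qed.

Let integrablew a : 0 <= a -> mu.-integrable Rpos (fun x => (w x * a)%:E).
Proof.
move=> a0; apply/integrableP; split.
  by apply/measurable_EFinP/measurable_funTS/measurable_funM.
under eq_integral do rewrite gee0_abs ?lee_fin ?mulr_ge0// EFinM.
rewrite ge0_integralZr//.
- by rewrite WE -EFinM ltry.
- exact/measurable_EFinP/measurable_funTS.
- by move=> x _; rewrite lee_fin.
Qed.

Let inner_cvg y : 0 < y ->
  (\int[mu]_(x in Rpos) (f_ n x y)%:E @[n --> \oo] -->
   \int[mu]_(x in Rpos) (f x y)%:E)%E.
Proof.
move=> y0.
have mfy n : measurable_fun (Rpos : set RL) (fun x : RL => (f_ n x y)%:E).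
  by apply: measurable_funTS; exact: (measurable2_section1 (mf_ n) y).
have mfy' : measurable_fun (Rpos : set RL) (fun x : RL => (f x y)%:E).
  by apply: measurable_funTS; exact: (measurable2_section1 mf y).
have cfy : {ae mu, forall x, Rpos x -> (f_ n x y)%:E @[n --> \oo] --> (f x y)%:E}.
  apply: aeW => x; rewrite /= in_itv/= andbT => x0.
  by apply: cvg_EFin; [exact: nearW|exact: f_cvg].
have dfy : {ae mu, forall x n, Rpos x -> (`|(f_ n x y)%:E| <= (w x * w y)%:E)%E}.
  apply: aeW => x n; rewrite /= in_itv/= andbT => x0.
  by rewrite lee_fin ger0_norm//; exact: f_dom.
have mpos : measurable (Rpos : set RL) by [].
by have [] := dominated_convergence mpos mfy mfy' cfy (integrablew (w0 y)) dfy.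
Qed.

Let inner_dom n y : 0 < y ->
  (\int[mu]_(x in Rpos) (f_ n x y)%:E <= (w y * W)%:E)%E.
Proof.
move=> y0; rewrite EFinM muleC -WE -ge0_integralZr//; last 3 first.
- exact/measurable_EFinP/measurable_funTS.
- by move=> x _; rewrite lee_fin.
- by rewrite lee_fin.
apply: ge0_le_integral => //.
- by move=> x _; rewrite lee_fin.
- by apply: measurable_funTS; exact: (measurable2_section1 (mf_ n) y).
- apply: emeasurable_funM => //; exact/measurable_EFinP/measurable_funTS.
- by move=> x; rewrite /= in_itv/= andbT => x0; rewrite -EFinM lee_fin f_dom.
Qed.

(** For fixed y the bound w x times w y is integrable in x, so the inner integrals converge; they
    are bounded by W times w y, W being the integral of w, so the outer ones converge too. *)
Lemma dominated_convergence2 :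
  (\int[mu]_(y in Rpos) \int[mu]_(x in Rpos) (f_ n x y)%:E @[n --> \oo] -->
   \int[mu]_(y in Rpos) \int[mu]_(x in Rpos) (f x y)%:E)%E /\
  (\int[mu]_(y in Rpos) \int[mu]_(x in Rpos) (f x y)%:E \is a fin_num)%E.
Proof.
have mfy n : measurable_fun (Rpos : set RL) (fun y : RL => \int[mu]_(x in Rpos) (f_ n x y)%:E)%E.
  apply: measurable_funTS; apply: (@measurable_inner1 _ _ (mf_ n)) => //.
  by move=> x y; rewrite lee_fin.
have mfy' : measurable_fun (Rpos : set RL) (fun y : RL => \int[mu]_(x in Rpos) (f x y)%:E)%E.
  apply: measurable_funTS; apply: (@measurable_inner1 _ _ mf) => //.
have cfy : {ae mu, forall y, Rpos y ->
    (\int[mu]_(x in Rpos) (f_ n x y)%:E @[n --> \oo] -->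
     \int[mu]_(x in Rpos) (f x y)%:E)%E}.
  by apply: aeW => y; rewrite /= in_itv/= andbT => y0; exact: inner_cvg.
have dfy : {ae mu, forall y n, Rpos y ->
    (`|\int[mu]_(x in Rpos) (f_ n x y)%:E| <= (w y * W)%:E)%E}.
  apply: aeW => y n; rewrite /= in_itv/= andbT => y0.
  rewrite gee0_abs; first exact: inner_dom.
  by apply: integral_ge0 => x _; rewrite lee_fin.
have mpos : measurable (Rpos : set RL) by [].
have [i1 _ i2] := dominated_convergence mpos mfy mfy' cfy (integrablew W0) dfy.
by split => //; exact: integrable_fin_num.
Qed.

End Dominated2.

(** The identity 1/x = x (x^2)^(-1) reduces the claim to measurability of real powers; at 0 both
    sides are 0. *)
Lemma measurable_invr (R : realType) : measurable_fun [set: R] (@GRing.inv R).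
Proof.
rewrite (_ : @GRing.inv R = fun x => x * (x ^+ 2) `^ (-1)).
  apply: measurable_funM => //; apply: (@measurableT_comp _ _ _ _ _ _ (fun y : R => y `^ (-1)) _
    (fun x : R => x ^+ 2)); first exact: measurable_powR.
  exact: measurable_funX.
apply/funext => x; rewrite powR_inv1 ?sqr_ge0//.
have [->|x0] := eqVneq x 0; first by rewrite mul0r invr0.
by rewrite expr2 invfM mulrA mulfV// mul1r.
Qed.

(** * The limit kernel, the dominating weight and the scale n^(-1/k) *)

Section Kernels.
Context (R : realType) (k : nat).
Hypothesis k_ge2 : (2 <= k)%N.
Local Notation mu := (@lebesgue_measure R).
Local Notation RL := (measurableTypeR R).
Local Notation Rpos := (`]0%R, +oo[%classic : set R).

Definition rate : R := (k`!%:R)^-1.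

Lemma rate_gt0 : 0 < rate.
Proof. by rewrite invr_gt0 ltr0n fact_gt0. Qed.

(** Minus the divided difference of e^(-t) between the values c max(u,v)^k and c v^k; for u <= v
    these coincide and the second branch is the confluent value. *)
Definition lim_kernel (u v : R) : R :=
  if v < u then (expR (- (rate * v ^+ k)) - expR (- (rate * u ^+ k))) /
                (rate * u ^+ k - rate * v ^+ k)
  else expR (- (rate * v ^+ k)).

Lemma lim_kernel_ge0 u v : 0 <= lim_kernel u v.
Proof.
rewrite /lim_kernel; case: ifP => _; last exact: expR_ge0.
move: (rate * u ^+ k) (rate * v ^+ k) => a b.
have [ab|ba] := leP a b.
  by rewrite mulr_le0// ?invr_le0 subr_le0// ler_expR lerN2.
by rewrite mulr_ge0// ?invr_ge0 subr_ge0 ?ler_expR ?lerN2 ltW.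
Qed.

Lemma measurable_lim_kernel :
  measurable_fun [set: RL * RL] (fun p => lim_kernel p.1 p.2).
Proof.
have m1 : measurable_fun [set: RL * RL] (fun p => p.1 : R) by exact: measurable_fst.
have m2 : measurable_fun [set: RL * RL] (fun p => p.2 : R) by exact: measurable_snd.
have mk (f : RL * RL -> R) : measurable_fun setT f ->
    measurable_fun setT (fun p => rate * f p ^+ k).
  by move=> mf; apply: measurable_funM => //; exact: measurable_funX.
have me (f : RL * RL -> R) : measurable_fun setT f ->
    measurable_fun setT (fun p => expR (- (rate * f p ^+ k))).
  by move=> mf; apply: measurableT_comp => //; apply: measurableT_comp => //; exact: mk.
apply: measurable_fun_ifT.
- exact: measurable_fun_ltr.
- apply: measurable_funM; first by apply: measurable_funB; exact: me.
  apply: (measurableT_comp (@measurable_invr R)).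
  by apply: measurable_funB; exact: mk.
- exact: me.
Qed.

(** A product of two weights has the constant 16, enough for the 12 of [convolution_bound]. The
    absolute value makes the weight nonnegative on the whole line. *)
Definition weight (u : R) : R := 4 / (1 + rate * `|u| ^+ k).

Lemma weightE u : 0 < u -> weight u = 4 / (1 + rate * u ^+ k).
Proof. by move=> u0; rewrite /weight gtr0_norm. Qed.

Let weight_den (u : R) : 0 < 1 + rate * `|u| ^+ k.
Proof. by rewrite ltr_pwDl// mulr_ge0// ltW// rate_gt0. Qed.

Lemma weight_ge0 u : 0 <= weight u.
Proof. by rewrite divr_ge0// ltW. Qed.

Lemma measurable_weight : measurable_fun setT weight.
Proof.
apply: continuous_measurable_fun => u; apply: cvgM; first exact: cvg_cst.
apply: cvgV; first by rewrite gt_eqF.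
apply: cvgD; first exact: cvg_cst.
apply: cvgM; first exact: cvg_cst.
apply: (@continuous_comp _ _ _ (fun u : R => `|u|) (fun x => x ^+ k)).
  exact: norm_continuous.
exact: exprn_continuous.
Qed.

(** Comparison with (8/c)/(1+u^2): for u >= 1 because k >= 2, and for u < 1 because c <= 1 makes the
    majorant at least 4. *)
Lemma integral_weight : (\int[mu]_(u in Rpos) (weight u)%:E < +oo)%E.
Proof.
apply: (@le_lt_trans _ _ (\int[mu]_(u in `[0%R, +oo[)
   ((8 / rate)%:E * (oneDsqr u)^-1%:E))%E); last first.
  rewrite ge0_integralZl//=.
  - by rewrite integral0y_oneDsqr -EFinM ltry.
  - apply/measurable_EFinP/measurable_funTS.
    by apply: continuous_measurable_fun; exact: continuous_oneDsqrV.
  - by rewrite lee_fin divr_ge0// ltW// rate_gt0.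
rewrite -integral_itv_obnd_cbnd; last first.
  apply: emeasurable_funM => //; apply/measurable_EFinP/measurable_funTS.
  by apply: continuous_measurable_fun; exact: continuous_oneDsqrV.
apply: ge0_le_integral => //.
- by move=> u _; rewrite lee_fin weight_ge0.
- by apply/measurable_EFinP/measurable_funTS; exact: measurable_weight.
- apply: emeasurable_funM => //; apply/measurable_EFinP/measurable_funTS.
  by apply: continuous_measurable_fun; exact: continuous_oneDsqrV.
move=> u; rewrite /= in_itv/= andbT => u0; rewrite -EFinM lee_fin /weight.
have c0 := rate_gt0; have c1 : rate <= 1.
  by rewrite invf_le1 ?ler1n ?ltr0n fact_gt0.
have o0 : 0 < oneDsqr u by rewrite (lt_le_trans _ (oneDsqr_ge1 u)).
rewrite ger0_norm ?(ltW u0)//.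
have d0 : 0 < 1 + rate * u ^+ k by rewrite ltr_pwDl// mulr_ge0 ?exprn_ge0// ltW.
rewrite ler_pdivrMr// mulrAC ler_pdivlMr// mulrAC ler_pdivlMr// /oneDsqr.
have [u1|u1] := leP 1 u.
  have : u ^+ 2 <= u ^+ k by rewrite ler_weXn2l.
  have : 1 <= u ^+ 2 by rewrite exprn_ege1.
  move: (u ^+ 2) (u ^+ k) => p q p1 pq; nra.
have : 0 <= u ^+ k by rewrite exprn_ge0// ltW.
have : u ^+ 2 <= 1 by rewrite exprn_ile1// ltW.
move: (u ^+ 2) (u ^+ k) => p q p1 q0; nra.
Qed.

(** The window in which one-records occur: n+1 columns have a total deficit (n+1) c (sc u)^k = c
    u^k. *)
Definition sc (n : nat) : R := n.+1%:R `^ (- k%:R^-1).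

Lemma sc_gt0 n : 0 < sc n.
Proof. by rewrite powR_gt0// ltr0Sn. Qed.

Let k0 : k%:R != 0 :> R.
Proof. by rewrite pnatr_eq0 -lt0n (leq_trans _ k_ge2). Qed.

Lemma sc_expk n : n.+1%:R * sc n ^+ k = 1.
Proof.
rewrite -powR_mulrn ?powR_ge0// -powRrM mulNr mulVf// powR_inv1//.
by rewrite divff// pnatr_eq0.
Qed.

Lemma natmul_sc n u : n.+1%:R * (sc n * u) ^+ k = u ^+ k.
Proof. by rewrite exprMn mulrA sc_expk mul1r. Qed.

Lemma cvg_sc : sc n @[n --> \oo] --> (0 : R).
Proof.
rewrite (_ : sc = (fun x : R => x `^ (k%:R^-1)) \o (fun n => n.+1%:R^-1)); last first.
  apply/funext => n /=; rewrite -[in RHS]powR_inv1// -powRrM; congr (_ `^ _).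
  by rewrite mulN1r.
have h : (fun n => n.+1%:R^-1 : R) @ \oo --> (0 : R)^'+.
  move=> A; rewrite /at_right /= => /nbhs_ballP[e /= e0 eA].
  have := @cvg_harmonic R; move/cvgrPdist_lt => /(_ e e0) h.
  by apply: filterS h => n hn; apply: eA => //=; rewrite invr_gt0.
have ki : 0 < (k%:R : R)^-1 by rewrite invr_gt0 ltr0n (leq_trans _ k_ge2).
exact: (cvg_comp _ _ h (powR_cvg0 ki)).
Qed.

End Kernels.

(** * Asymptotics of the single and double integrals by rescaling *)

Section Laplace.
Context (R : realType) (k : nat).
Hypothesis k_ge2 : (2 <= k)%N.
Local Notation mu := (@lebesgue_measure R).
Local Notation RL := (measurableTypeR R).
Local Notation Rpos := (`]0%R, +oo[%classic : set R).
Local Notation c := (rate R k).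
Local Notation sc := (sc R k).
Local Notation weight := (@weight R k).
Local Notation lim_kernel := (@lim_kernel R k).

Variables S Q : R -> R.
Hypothesis mS : measurable_fun setT S.
Hypothesis mQ : measurable_fun setT Q.
Hypothesis S0 : forall x, 0 <= S x.
Hypothesis S1 : forall x, S x <= 1.
Hypothesis Sni : forall x y, x <= y -> S y <= S x.
Hypothesis Sb : forall x, 0 <= x ->
  expR (- x) * (x ^+ k / k`!%:R) <= 1 - S x <= x ^+ k / k`!%:R.
Hypothesis Q0 : forall x, 0 <= Q x.
Hypothesis Q1 : forall x, Q x <= 1.
Hypothesis Qneg : forall x, x < 0 -> Q x = 1.
Hypothesis Qb : forall x, 0 <= x -> 1 - Q x <= x ^+ k.-1 / (k.-1)`!%:R.

Let sc0 n : 0 < sc n. Proof. exact: sc_gt0. Qed.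
Let cvg_sc : sc n @[n --> \oo] --> (0 : R). Proof. exact: cvg_sc. Qed.
Let c0 : 0 < c. Proof. exact: rate_gt0. Qed.

Let cvg_scM u : sc n * u @[n --> \oo] --> (0 : R).
Proof. by rewrite -(mul0r u); apply: cvgM => //; exact: cvg_cst. Qed.

Let cvg_exp u : expR (- (sc n * u)) @[n --> \oo] --> (1 : R).
Proof.
rewrite -expR0 -oppr0; apply: continuous_cvg; first exact: continuous_expR.
exact: cvgN.
Qed.

(** Both bounds in [Sb] scale exactly, and they differ only by the factor e^(-sc v), which tends to
    1. *)
Let cvg_deficit v : 0 <= v ->
  n.+1%:R * (1 - S (sc n * v)) @[n --> \oo] --> c * v ^+ k.
Proof.
move=> v0; apply: (@squeeze_cvgr _ _ _ _
  (fun n => expR (- (sc n * v)) * (c * v ^+ k)) (fun=> c * v ^+ k)).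
- apply: nearW => n.
  have /andP[h1 h2] := Sb (mulr_ge0 (ltW (sc0 n)) v0).
  have e : n.+1%:R * ((sc n * v) ^+ k / k`!%:R) = c * v ^+ k.
    by rewrite mulrA natmul_sc// mulrC.
  rewrite -e mulrCA; apply/andP; split; exact: ler_wpM2l.
- rewrite -[X in _ --> X]mul1r; apply: cvgM; last exact: cvg_cst.
  exact: cvg_exp.
- exact: cvg_cst.
Qed.

Let cvg_S v : 0 <= v -> 1 - S (sc n * v) @[n --> \oo] --> (0 : R).
Proof.
move=> v0; rewrite (_ : (fun n => _) = fun n =>
    n.+1%:R^-1 * (n.+1%:R * (1 - S (sc n * v)))).
  rewrite -(mul0r (c * v ^+ k)); apply: cvgM; last exact: cvg_deficit.
  exact: cvg_harmonic.
by apply/funext => n; rewrite mulrA mulVf ?mul1r// pnatr_eq0.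
Qed.

Let cvg_Spow v : 0 <= v ->
  S (sc n * v) ^+ n.+1 @[n --> \oo] --> expR (- (c * v ^+ k)).
Proof.
move=> v0; have := @one_minus_pow_cvg R succn (fun n => 1 - S (sc n * v)).
move=> /(_ (c * v ^+ k)); under [X in (_ -> _ -> _ -> X @ _ --> _) -> _]eq_fun do rewrite subKr.
apply.
- by move=> n; rewrite subr_ge0 S1 gerBl S0.
- exact: cvg_deficit.
- exact: cvg_S.
Qed.

(** The exponent n+2 occurs because a convolution of total degree n+1 telescopes to a difference of
    (n+2)-nd powers. *)
Let cvg_SpowS v : 0 <= v ->
  S (sc n * v) ^+ n.+2 @[n --> \oo] --> expR (- (c * v ^+ k)).
Proof.
move=> v0; rewrite (_ : (fun n => _) = fun n =>
    (1 - (1 - S (sc n * v))) * S (sc n * v) ^+ n.+1); last first.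
  by apply/funext => n; rewrite subKr exprS.
rewrite -[X in _ --> X]mul1r; apply: cvgM; last exact: cvg_Spow.
rewrite -[X in _ --> X]subr0; apply: cvgB; first exact: cvg_cst.
exact: cvg_S.
Qed.

Let cvg_Q u : Q (sc n * u) @[n --> \oo] --> (1 : R).
Proof.
have [u0|u0] := ltP u 0.
  rewrite (_ : (fun _ => _) = fun=> 1); first exact: cvg_cst.
  by apply/funext => n; rewrite Qneg// pmulr_rlt0.
apply: (@squeeze_cvgr _ _ _ _
  (fun n => 1 - (sc n * u) ^+ k.-1 / (k.-1)`!%:R) (fun=> 1)).
- apply: nearW => n; rewrite Q1 andbT lerBlDr -lerBlDl.
  by apply: Qb; rewrite mulr_ge0// ltW.
- rewrite -[X in _ --> X]subr0; apply: cvgB; first exact: cvg_cst.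
  rewrite -[X in _ --> X](mul0r ((k.-1)`!%:R^-1)); apply: cvgM; last exact: cvg_cst.
  rewrite -[X in _ --> X](_ : 0 ^+ k.-1 = 0); last first.
    by rewrite expr0n; case: (k) k_ge2 => [|[]].
  apply: (@continuous_cvg _ _ _ _ _ (fun n => sc n * u) (fun x : R => x ^+ k.-1) 0);
    last exact: cvg_scM.
  exact: exprn_continuous.
- exact: cvg_cst.
Qed.

(** The integrand of [prob_record2] for j = n+2, summed over i from 1 to n+1 with m = i-1. *)
Definition joint_kernel (n : nat) (x y : R) : R :=
  Q (y - x) * (\sum_(m < n.+1) S (Num.max x y) ^+ m * S y ^+ (n - m))
    * expR (- x) * expR (- y).

Definition scaled_kernel (n : nat) (u v : R) : R :=
  n.+1%:R^-1 * joint_kernel n.+1 (sc n * u) (sc n * v).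

Lemma joint_kernel_ge0 n x y : 0 <= joint_kernel n x y.
Proof.
rewrite /joint_kernel !mulr_ge0 ?expR_ge0//.
by apply: sumr_ge0 => m _; rewrite mulr_ge0 ?exprn_ge0.
Qed.

Lemma scaled_kernel_ge0 n u v : 0 <= scaled_kernel n u v.
Proof. by rewrite mulr_ge0// joint_kernel_ge0. Qed.

Let maxr_sc n u v : Num.max (sc n * u) (sc n * v) = sc n * Num.max u v.
Proof. by rewrite maxr_pMr// ltW. Qed.

(** Everything outside the convolution tends to 1. For u <= v the convolution is n+2 copies of S(sc
    v)^(n+1); for v < u it is the quotient of the difference of (n+2)-nd powers by the difference of
    the bases. *)
Lemma scaled_kernel_cvg u v : 0 < u -> 0 < v ->
  scaled_kernel n u v @[n --> \oo] --> lim_kernel u v.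
Proof.
move=> u0 v0.
suff : n.+1%:R^-1 *
    (\sum_(m < n.+2) S (sc n * Num.max u v) ^+ m * S (sc n * v) ^+ (n.+1 - m))
    @[n --> \oo] --> lim_kernel u v.
  move=> h; rewrite -[X in _ --> X]mul1r -[X in _ --> X]mulr1 -[X in _ --> X]mulr1.
  under eq_fun do rewrite /scaled_kernel /joint_kernel -mulrBr maxr_sc mulrA
    mulrA (mulrCA _^-1).
  apply: cvgM; last exact: cvg_exp.
  apply: cvgM; last exact: cvg_exp.
  by apply: cvgM => //; exact: cvg_Q.
rewrite /lim_kernel; have [vu|uv] := ltP v u; last first.
  have -> : (fun n => n.+1%:R^-1 * \sum_(m < n.+2)
        S (sc n * v) ^+ m * S (sc n * v) ^+ (n.+1 - m)) =
      (fun n => n.+1%:R^-1 * S (sc n * v) ^+ n.+1 + S (sc n * v) ^+ n.+1).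
    apply/funext => n.
    under eq_bigr do rewrite -exprD subnKC ?leq_ord//.
    rewrite sumr_const card_ord -[_ *+ n.+2]mulr_natl mulrA -[n.+2%:R]natr1 mulrDr.
    by rewrite mulVf ?pnatr_eq0// mulr1 mulrDl mul1r addrC.
  rewrite -[X in _ --> X]add0r; apply: cvgD; last exact: cvg_Spow (ltW v0).
  rewrite -(mul0r (expR (- (c * v ^+ k)))).
  apply: cvgM; [exact: cvg_harmonic|exact: cvg_Spow (ltW v0)].
(* The rescaled difference of bases. Its limit is nonzero, so it may be divided by eventually,
   though not necessarily for every n. *)
pose d n := n.+1%:R * (S (sc n * v) - S (sc n * u)).
have cd : d n @[n --> \oo] --> c * u ^+ k - c * v ^+ k.
  rewrite (_ : d = fun n => n.+1%:R * (1 - S (sc n * u)) -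
     n.+1%:R * (1 - S (sc n * v))).
    by apply: cvgB; apply: cvg_deficit; exact: ltW.
  by apply/funext => n; rewrite /d; ring.
have L0 : c * u ^+ k - c * v ^+ k != 0.
  rewrite gt_eqF// subr_gt0 ltr_pM2l// ltrXn2r ?ltW// -lt0n.
  exact: leq_trans k_ge2.
have cq : (S (sc n * v) ^+ n.+2 - S (sc n * u) ^+ n.+2) / d n @[n --> \oo] -->
   (expR (- (c * v ^+ k)) - expR (- (c * u ^+ k))) / (c * u ^+ k - c * v ^+ k).
  apply: cvgM; last exact: cvgV.
  by apply: cvgB; apply: cvg_SpowS; exact: ltW.
apply: cvg_trans cq; apply: near_eq_cvg; near=> n.
have dn0 : d n != 0 by near: n; exact: cvgr_neq0 L0.
apply: (canLR (mulfK dn0)).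
rewrite -geometric_sum2 /d.
have n0 : n.+1%:R != 0 :> R by rewrite pnatr_eq0.
by field; rewrite nat1r n0.
Unshelve. all: by end_near. Qed.

(** Bounding Q by 1 and S(max(x,y)) by S(x) gives a convolution in which the variables separate,
    ready for [convolution_bound]. *)
Lemma scaled_kernel_dom n u v : 0 < u -> 0 < v ->
  scaled_kernel n u v <= weight u * weight v.
Proof.
move=> u0 v0; pose x := sc n * u; pose y := sc n * v.
have x0 : 0 <= x by rewrite mulr_ge0// ltW.
have y0 : 0 <= y by rewrite mulr_ge0// ltW.
have N0 : 0 < n.+1%:R :> R by rewrite ltr0n.
(* The lower bound on the deficit 1 - S loses a factor e^(-x); the factors e^(-x) and e^(-y) already
   present in the kernel absorb this loss. *)
have decay t : 0 < t ->
    expR (- (sc n * t)) * (1 + c * t ^+ k) <= 1 + n.+1%:R * (1 - S (sc n * t)).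
  move=> t0; rewrite mulrDr mulr1; apply: lerD.
    by rewrite -expR0 ler_expR oppr_le0 mulr_ge0// ltW.
  have /andP[h _] := Sb (mulr_ge0 (ltW (sc0 n)) (ltW t0)).
  have := ler_wpM2l (ltW N0) h; apply: le_trans.
  by rewrite mulrCA mulrA -(natmul_sc k_ge2 n t) [in leRHS]mulrA mulrA;
     rewrite le_eqVlt; apply/orP; left; apply/eqP; rewrite /rate; ring.
have wE t : 0 < t -> weight t = 4 / (1 + c * t ^+ k).
  exact: weightE.
have den t : 0 < t -> 0 < 1 + c * t ^+ k.
  by move=> t0; rewrite ltr_pwDl// mulr_ge0 ?exprn_ge0// ltW.
rewrite !wE// mulrACA -invfM ler_pdivlMr ?mulr_gt0 ?den//.
rewrite /scaled_kernel /joint_kernel -/x -/y.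
have := @convolution_bound _ (S x) (S y) n.+1.
rewrite !S0 !S1 => /(_ isT isT isT).
have : \sum_(m < n.+2) S (Num.max x y) ^+ m * S y ^+ (n.+1 - m) <=
       \sum_(m < n.+2) S x ^+ m * S y ^+ (n.+1 - m).
  apply: ler_sum => m _; apply: ler_wpM2r; first exact: exprn_ge0.
  by apply: lerXn2r; rewrite ?nnegrE// Sni// le_max lexx.
have : 0 <= \sum_(m < n.+2) S (Num.max x y) ^+ m * S y ^+ (n.+1 - m).
  by apply: sumr_ge0 => m _; rewrite mulr_ge0 ?exprn_ge0.
move: (\sum_(m < n.+2) S (Num.max x y) ^+ m * _).
move: (\sum_(m < n.+2) S x ^+ m * _) => s' s s0 ss' hs'.
have := decay _ u0; have := decay _ v0; rewrite -/x -/y.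
have := den _ u0; have := den _ v0.
have ex0 : 0 < expR (- x) by exact: expR_gt0.
have ey0 : 0 < expR (- y) by exact: expR_gt0.
move: hs'; set A := 1 + n.+1%:R * (1 - S x); set B := 1 + n.+1%:R * (1 - S y).
move: (1 + c * u ^+ k) (1 + c * v ^+ k) => U V hs' V0 U0 yB xA.
have h1 : (expR (- x) * U) * (expR (- y) * V) <= A * B.
  by apply: ler_pM => //; rewrite mulr_ge0 ?ltW.
have h2 : Q (y - x) * s <= s'.
  apply: le_trans ss'; rewrite -[leRHS]mul1r; exact: ler_wpM2r.
have h3 : (expR (- x) * U) * (expR (- y) * V) * (Q (y - x) * s) <= 12 * n.+1%:R.
  apply: le_trans hs'; apply: ler_pM => //.
    by rewrite !mulr_ge0// ltW.
  by rewrite mulr_ge0.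
rewrite -[leLHS]mulrA ler_pdivrMl//.
apply: le_trans (_ : 12 * n.+1%:R <= _); last by nra.
by apply: le_trans h3; rewrite le_eqVlt; apply/orP; left; apply/eqP; ring.
Qed.

Lemma measurable_joint_kernel n :
  measurable_fun [set: RL * RL] (fun p => joint_kernel n p.1 p.2).
Proof.
have m1 : measurable_fun [set: RL * RL] (fun p => p.1 : R) by exact: measurable_fst.
have m2 : measurable_fun [set: RL * RL] (fun p => p.2 : R) by exact: measurable_snd.
have me (f : RL * RL -> R) : measurable_fun setT f ->
    measurable_fun setT (fun p => expR (- f p)).
  by move=> mf; apply: measurableT_comp => //; exact: measurableT_comp.
apply: measurable_funM; last exact: me.
apply: measurable_funM; last exact: me.
apply: measurable_funM.
  by apply: (measurableT_comp mQ); exact: measurable_funB.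
apply: measurable_sum => m; apply: measurable_funM; apply: measurable_funX.
  by apply: (measurableT_comp mS); exact: measurable_maxr.
exact: (measurableT_comp mS).
Qed.

Lemma measurable_scaled_kernel n :
  measurable_fun [set: RL * RL] (fun p => scaled_kernel n p.1 p.2).
Proof.
apply: measurable_funM => //.
apply: (measurableT_comp (measurable_joint_kernel n.+1)
  (g := fun p : RL * RL => (sc n * p.1, sc n * p.2))).
by apply: measurable_fun_pair; apply: measurable_funM.
Qed.

Definition joint_integral n : \bar R :=
  (\int[mu]_(y in Rpos) \int[mu]_(x in Rpos) (joint_kernel n x y)%:E)%E.

Definition lim_integral : \bar R :=
  (\int[mu]_(v in Rpos) \int[mu]_(u in Rpos) (lim_kernel u v)%:E)%E.

(** Each of the two changes of variable gives a factor sc; the factor n+1 undoes the averaging in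
    [scaled_kernel]. *)
Lemma joint_integral_scaled n :
  (joint_integral n.+1 = (n.+1%:R * sc n ^+ 2)%:E *
   \int[mu]_(v in Rpos) \int[mu]_(u in Rpos) (scaled_kernel n u v)%:E)%E.
Proof.
have mj : measurable2 (fun x y => (joint_kernel n.+1 x y)%:E).
  by apply/measurable_EFinP; exact: measurable_joint_kernel.
have mj0 x y : (0 <= (joint_kernel n.+1 x y)%:E)%E.
  by rewrite lee_fin joint_kernel_ge0.
have msk : measurable2 (fun x y => (scaled_kernel n x y)%:E).
  by apply/measurable_EFinP; exact: measurable_scaled_kernel.
have ms0 x y : (0 <= (scaled_kernel n x y)%:E)%E.
  by rewrite lee_fin scaled_kernel_ge0.
rewrite /joint_integral (ge0_integral_scale0y (sc0 n)); last 2 first.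
- exact: (measurable_inner1 mj mj0).
- by move=> y; apply: integral_ge0.
transitivity ((sc n)%:E * \int[mu]_(v in Rpos) ((sc n * n.+1%:R)%:E *
    \int[mu]_(u in Rpos) (scaled_kernel n u v)%:E))%E.
  congr (_ * _)%E; apply: eq_integral => v _.
  rewrite (ge0_integral_scale0y (sc0 n) (measurable2_section1 mj (sc n * v))
    (fun u => mj0 u (sc n * v))) EFinM -muleA.
  congr (_ * _)%E; rewrite -ge0_integralZl//.
    apply: eq_integral => u _; rewrite -EFinM; congr EFin.
    by rewrite /scaled_kernel mulrA mulfV ?mul1r// pnatr_eq0.
  by apply: measurable_funTS; exact: (measurable2_section1 msk v).
rewrite ge0_integralZl//; last 3 first.
- apply: measurable_funTS; exact: (measurable_inner1 msk ms0).
- by move=> v _; apply: integral_ge0.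
- by rewrite lee_fin mulr_ge0// ltW.
by rewrite muleA -EFinM; congr (_%:E * _)%E; rewrite expr2; ring.
Qed.

Lemma joint_integral_cvg :
  fine (joint_integral n.+1) / (n.+1%:R * sc n ^+ 2) @[n --> \oo] -->
    fine lim_integral /\ lim_integral \is a fin_num.
Proof.
have mk n : measurable2 (fun x y => (scaled_kernel n x y)%:E).
  by apply/measurable_EFinP; exact: measurable_scaled_kernel.
have ml : measurable2 (fun x y => (lim_kernel x y)%:E).
  by apply/measurable_EFinP; exact: measurable_lim_kernel.
have [h1 h2] := @dominated_convergence2 R scaled_kernel lim_kernel weight mk ml
  scaled_kernel_ge0 (lim_kernel_ge0 k) (measurable_weight k) (weight_ge0 k)
  (integral_weight R k_ge2) scaled_kernel_cvg scaled_kernel_dom.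
split; last exact: h2.
rewrite (_ : (fun n => _) = fun n => fine
   (\int[mu]_(v in Rpos) \int[mu]_(u in Rpos) (scaled_kernel n u v)%:E)%E).
  by apply: fine_cvg; rewrite fineK.
apply/funext => n; rewrite joint_integral_scaled.
have a0 : 0 < n.+1%:R * sc n ^+ 2 by rewrite mulr_gt0 ?exprn_gt0.
(* The factor cancels under [fine] even for an infinite integral, since [fine] sends infinities to
   0; finiteness need not be shown for each n. *)
case: (\int[mu]_(v in Rpos) _)%E => [r||] /=.
- by rewrite mulrAC mulfV ?mul1r// gt_eqF.
- by rewrite gt0_muley ?lte_fin//= mul0r.
- by rewrite gt0_muleNy ?lte_fin//= mul0r.
Qed.

Definition single_integral n : \bar R :=
  (\int[mu]_(y in Rpos) (S y ^+ n * expR (- y))%:E)%E.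

Definition lim_single : \bar R :=
  (\int[mu]_(v in Rpos) (expR (- (c * v ^+ k)))%:E)%E.

Let single_kernel n v := S (sc n * v) ^+ n.+1 * expR (- (sc n * v)).

Let measurable_single n : measurable_fun setT (fun y => S y ^+ n * expR (- y)).
Proof.
apply: measurable_funM; first exact: measurable_funX.
by apply: measurableT_comp => //.
Qed.

Let single_kernel_ge0 n v : 0 <= single_kernel n v.
Proof. by rewrite mulr_ge0 ?expR_ge0// exprn_ge0. Qed.

Let single_kernel_dom n v : 0 < v -> single_kernel n v <= weight v.
Proof.
move=> v0; pose y := sc n * v.
have y0 : 0 <= y by rewrite mulr_ge0// ltW.
have N0 : 0 < n.+1%:R :> R by rewrite ltr0n.
have /andP[h _] := Sb y0.
have D0 : 0 < 1 + c * v ^+ k by rewrite ltr_pwDl// mulr_ge0 ?exprn_ge0// ltW.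
rewrite weightE// ler_pdivlMr// /single_kernel -/y.
have := @expr_mul_linear_le1 _ (1 - S y) n.+1.
rewrite subr_ge0 S1 gerBl S0 subKr => /(_ isT).
have e1 : expR (- y) <= 1 by rewrite -expR0 ler_expR oppr_le0.
have : expR (- y) * (c * v ^+ k) <= n.+1%:R * (1 - S y).
  apply: le_trans (ler_wpM2l (ltW N0) h); rewrite le_eqVlt.
  by apply/orP; left; apply/eqP; rewrite -(natmul_sc k_ge2 n v) /rate /y; ring.
have : 0 <= S y ^+ n.+1 by exact: exprn_ge0.
move: (S y ^+ n.+1) (n.+1%:R * (1 - S y)) (c * v ^+ k) => s t u s0 ut st.
have : expR (- y) * (1 + u) <= 1 + t by rewrite mulrDr mulr1; exact: lerD.
move=> /(ler_wpM2l s0); nra.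
Qed.

(** The one-variable analogue, for the first moment: same rescaling, with a single weight as
    dominating function. *)
Lemma single_integral_cvg :
  fine (single_integral n.+1) / sc n @[n --> \oo] --> fine lim_single /\
  lim_single \is a fin_num.
Proof.
have mf n : measurable_fun (Rpos : set RL) (fun v : RL => (single_kernel n v)%:E).
  apply/measurable_EFinP/measurable_funTS.
  apply: (@measurableT_comp _ _ _ _ _ _ (fun y => S y ^+ n.+1 * expR (- y)) _
    (fun v : R => sc n * v)); first exact: measurable_single.
  exact: measurable_funM.
have ml : measurable_fun (Rpos : set RL) (fun v : RL => (expR (- (c * v ^+ k)))%:E).
  apply/measurable_EFinP/measurable_funTS.
  apply: (measurableT_comp (@measurable_expR R)).
  by apply: measurableT_comp => //; apply: measurable_funM => //; exact: measurable_funX.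
have mc : {ae mu, forall v, Rpos v ->
    (single_kernel n v)%:E @[n --> \oo] --> (expR (- (c * v ^+ k)))%:E}.
  apply: aeW => v; rewrite /= in_itv/= andbT => v0.
  apply: cvg_EFin; first exact: nearW.
  rewrite -[X in _ --> X]mulr1; apply: cvgM; last exact: cvg_exp.
  exact: cvg_Spow (ltW v0).
have md : {ae mu, forall v n, Rpos v ->
    (`|(single_kernel n v)%:E| <= (weight v)%:E)%E}.
  apply: aeW => v n; rewrite /= in_itv/= andbT => v0.
  by rewrite lee_fin ger0_norm//; exact: single_kernel_dom.
have mpos : measurable (Rpos : set RL) by [].
have iw : mu.-integrable (Rpos : set RL) (EFin \o weight).
  apply/integrableP; split.
    by apply/measurable_EFinP/measurable_funTS; exact: measurable_weight.
  under eq_integral do rewrite /= ger0_norm ?weight_ge0//.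
  exact: integral_weight.
have [i1 _ i2] := dominated_convergence mpos mf ml mc iw md.
have fl : lim_single \is a fin_num by exact: integrable_fin_num.
split => //.
rewrite (_ : (fun n => _) = fun n => fine (\int[mu]_(v in Rpos) (single_kernel n v)%:E)%E).
  by apply: fine_cvg; rewrite fineK.
apply/funext => n; rewrite /single_integral (ge0_integral_scale0y (sc0 n)); last 2 first.
- exact/measurable_EFinP.
- by move=> y; rewrite lee_fin mulr_ge0 ?expR_ge0// exprn_ge0.
rewrite -/(single_kernel n _).
case: (\int[mu]_(v in Rpos) _)%E => [r||] /=.
- by rewrite mulrAC mulfV ?mul1r// gt_eqF.
- by rewrite gt0_muley ?lte_fin//= mul0r.
- by rewrite gt0_muleNy ?lte_fin//= mul0r.
Qed.

End Laplace.

(** * Stolz-Cesaro summation against powers of n *)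

Section Stolz.
Context (R : realType).

(** From some N on, the increments of u - l b are at most e/2 times those of b. They add up, and b
    tending to infinity absorbs the initial discrepancy at N. *)
Lemma stolz_cesaro (u b : nat -> R) (l : R) :
  (forall n, 0 <= b n) -> (forall n, b n < b n.+1) ->
  b n @[n --> \oo] --> +oo ->
  (u n.+1 - u n) / (b n.+1 - b n) @[n --> \oo] --> l ->
  u n / b n @[n --> \oo] --> l.
Proof.
move=> b0 bS boo ubl; apply/cvgrPdist_le => e e0.
have e20 : 0 < e / 2 by rewrite divr_gt0.
have [N _ hN] := (@cvgrPdist_le _ _ _ _ _ _ _).1 ubl _ e20.
have incr n : `|u (N + n)%N - u N - l * (b (N + n)%N - b N)| <= e / 2 * (b (N + n)%N - b N).
  elim: n => [|n IHn]; first by rewrite addn0 !subrr mulr0 subr0 normr0 mulr0.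
  have d0 : 0 < b (N + n).+1 - b (N + n)%N by rewrite subr_gt0.
  have /= hNn := hN (N + n)%N (leq_addr _ _).
  have h : `|l * (b (N + n).+1 - b (N + n)%N) - (u (N + n).+1 - u (N + n)%N)| <=
      e / 2 * (b (N + n).+1 - b (N + n)%N).
    rewrite -[X in _ - X](divfK (lt0r_neq0 d0)) -mulrBl normrM (gtr0_norm d0).
    by rewrite ler_pM2r.
  rewrite addnS.
  rewrite (_ : _ - _ - _ = (u (N + n)%N - u N - l * (b (N + n)%N - b N)) -
    (l * (b (N + n).+1 - b (N + n)%N) - (u (N + n).+1 - u (N + n)%N))); last by ring.
  apply: le_trans (ler_normB _ _) _.
  apply: le_trans (lerD IHn h) _.
  by rewrite le_eqVlt; apply/orP; left; apply/eqP; ring.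
(* Chosen so that b n >= K makes the initial discrepancy at most (e/2) b n; the added 1 also makes b
   n positive. *)
pose K := `|u N - l * b N| / (e / 2) + 1.
have [M _ hM] := (@cvgryPge _ _ _ _ _).1 boo K.
exists (maxn M N) => // n; rewrite /= geq_max => /andP[Mn Nn].
have Kb : K <= b n by exact: hM.
have bn0 : 0 < b n.
  apply: lt_le_trans Kb; rewrite /K ltr_wpDl// divr_ge0// ltW//.
have := incr (n - N)%N; rewrite subnKC// => h.
rewrite -(ler_pM2r bn0) -[X in _ * X <= _](gtr0_norm bn0) -normrM mulrBl.
rewrite divfK ?gt_eqF//.
rewrite (_ : l * b n - u n = - ((u n - u N - l * (b n - b N)) + (u N - l * b N))); last by ring.
rewrite normrN; apply: le_trans (ler_normD _ _) _.
have h2 : `|u N - l * b N| <= e / 2 * b n.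
  rewrite -ler_pdivrMl// mulrC; apply: le_trans Kb.
  by rewrite /K lerDl.
apply: le_trans (lerD h h2) _.
have := b0 N; nra.
Qed.

(** After dividing by (n+1)^a this is the difference quotient of x^a at 1 with increment
    -1/(n+1). *)
Lemma powR_increment_cvg (a : R) : 0 < a ->
  (n.+1%:R `^ a - n%:R `^ a) / n.+1%:R `^ (a - 1) @[n --> \oo] --> a.
Proof.
move=> a0.
pose h n : R := - n.+1%:R^-1.
have hE n : (n.+1%:R `^ a - n%:R `^ a) / n.+1%:R `^ (a - 1) =
    (h n)^-1 * ((h n + 1) `^ a - 1 `^ a).
  have n0 : n.+1%:R != 0 :> R by rewrite pnatr_eq0.
  have nE : n%:R = n.+1%:R * (h n + 1) :> R.
    by rewrite /h mulrDr mulrN mulfV// mulr1 -natr1; ring.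
  have h10 : 0 <= h n + 1.
    by rewrite /h addrC subr_ge0 invf_le1 ?ler1n.
  rewrite nE powRM// powR1 -{1}(mulr1 (n.+1%:R `^ a)) -mulrBr.
  rewrite powRB ?n0 ?implybT// powRr1// invfM invrK /h.
  rewrite invrN invrK.
  have p0 : n.+1%:R `^ a != 0 :> R by rewrite gt_eqF// powR_gt0// ltr0n.
  rewrite mulrAC mulrA mulfV// mul1r; ring.
rewrite (_ : (fun n => _) = fun n => (h n)^-1 * ((h n + 1) `^ a - 1 `^ a)); last first.
  by apply/funext => n; exact: hE.
have h0 : h n @[n --> \oo] --> 0^'.
  move=> A /nbhs_ballP[e /= e0 eA].
  have := @cvg_harmonic R; move/cvgrPdist_lt => /(_ e e0) hh.
  apply: filterS hh => n hn; apply: eA => //=; last by rewrite oppr_eq0 invr_eq0 pnatr_eq0.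
  by rewrite /ball/= sub0r normrN /h in hn *; rewrite sub0r normrN normrN.
have [dp dpE] := @is_derive1_powR R a 1 ltr01.
rewrite powR1 mulr1 in dpE.
rewrite -[X in _ --> X]dpE; apply: cvg_trans (cvg_comp _ _ h0 dp).
apply: near_eq_cvg; apply: nearW => n /=.
by rewrite /shift/= /GRing.scale/= mulr1.
Qed.

Lemma cvg_natn_powR (a : R) : 0 < a -> n%:R `^ a @[n --> \oo] --> +oo.
Proof.
move=> a0; apply/cvgryPge => A.
exists (Num.truncn (`|A| `^ a^-1)).+1 => // n /= hn.
apply: le_trans (ler_norm A) _.
have -> : `|A| = (`|A| `^ a^-1) `^ a.
  by rewrite -powRrM mulVf ?lt0r_neq0// powRr1.
apply: ge0_ler_powR; rewrite ?nnegrE ?powR_ge0// ?ltW//.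
apply: lt_le_trans (truncnS_gt _) _.
by rewrite ler_nat.
Qed.

Lemma sum_powR_asymp (f : nat -> R) (a L : R) : 0 < a ->
  f n.+1 / n.+1%:R `^ (a - 1) @[n --> \oo] --> L ->
  (\sum_(1 <= j < n.+1) f j) / n%:R `^ a @[n --> \oo] --> L / a.
Proof.
move=> a0 fL; apply: stolz_cesaro.
- by move=> n; exact: powR_ge0.
- by move=> n; rewrite gt0_ltr_powR// ?nnegrE// ltr_nat.
- exact: cvg_natn_powR.
have h := cvgM fL (cvgV (lt0r_neq0 a0) (powR_increment_cvg a0)).
rewrite (_ : (fun n => _) = fun n => f n.+1 / n.+1%:R `^ (a - 1) *
  ((n.+1%:R `^ a - n%:R `^ a) / n.+1%:R `^ (a - 1))^-1); first exact: h.
apply/funext => n; rewrite big_nat_recr//= addrAC subrr add0r.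
have p0 : n.+1%:R `^ (a - 1) != 0 :> R by rewrite gt_eqF// powR_gt0// ltr0n.
have q0 : n.+1%:R `^ a - n%:R `^ a != 0.
  by rewrite subr_eq0 gt_eqF// gt0_ltr_powR// ?nnegrE// ltr_nat.
by rewrite invf_div mulrA divfK.
Qed.

End Stolz.

(** * Improper integrals by exhaustion with compact intervals *)

Section Exhaustion.
Context (R : realType).
Local Notation mu := (@lebesgue_measure R).

Lemma ge0_integral_exhaust (f : R -> R) (D : set R) (a b : nat -> R) :
  (forall n, a n.+1 <= a n) -> (forall n, b n <= b n.+1) ->
  D = \bigcup_n `[a n, b n]%classic ->
  measurable_fun D f -> (forall x, D x -> 0 <= f x) ->
  (\int[mu]_(x in `[a n, b n]) (f x)%:E @[n --> \oo] --> \int[mu]_(x in D) (f x)%:E)%E.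
Proof.
move=> aS bS -> mf f0; apply: ge0_nondecreasing_set_cvg_integral.
- apply/nondecreasing_seqP => n; apply/subsetPset => x /=; rewrite !in_itv/=.
  by move=> /andP[h1 h2]; rewrite (le_trans (aS n) h1) (le_trans h2 (bS n)).
- by move=> n.
- move=> n; apply/measurable_EFinP; apply: measurable_funS mf.
    exact: bigcup_measurable.
  by move=> x xn; exists n.
- by move=> n x xn; rewrite lee_fin; apply: f0; exists n.
Qed.

(** A form of the fundamental theorem that allows f to blow up at the endpoints: since f is
    nonnegative, monotone convergence passes from compact subintervals to the open one. *)
Lemma ge0_FTC_oo (f F : R -> R) (a b l r : R) : a < b ->
  (forall x : R, a < x < b -> {for x, continuous f}) ->
  (forall x : R, a < x < b -> 0 <= f x) ->
  (forall x : R, a < x < b -> is_derive x (1 : R) F (f x)) ->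
  F x @[x --> a^'+] --> l -> F x @[x --> b^'-] --> r ->
  (\int[mu]_(x in `]a, b[) (f x)%:E = (r - l)%:E)%E.
Proof.
move=> ab cf f0 dF Fl Fr.
(* Starting at a third of the length keeps a + e n < b - e n for every n. *)
pose e n : R := (b - a) / n.+3%:R.
have ba0 : 0 < b - a by rewrite subr_gt0.
have e0 n : 0 < e n by rewrite divr_gt0// ltr0n.
have eS n : e n.+1 <= e n.
  by rewrite /e ler_pM2l// lef_pV2 ?posrE ?ltr0n// ler_nat.
have e3 n : e n <= (b - a) / 3.
  by rewrite /e ler_pM2l// lef_pV2 ?posrE ?ltr0n// ler_nat.
have ecvg : e n @[n --> \oo] --> (0 : R).
  rewrite -(mulr0 (b - a)); apply: cvgM; first exact: cvg_cst.
  have := @cvg_harmonic R; rewrite -(cvg_shiftn 2) => h.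
  by apply: cvg_trans h; apply: near_eq_cvg; apply: nearW => n; rewrite /= addn2.
have abn n : a + e n < b - e n by have := e3 n; lra.
have inab n x : a + e n <= x <= b - e n -> a < x < b by have := e0 n; lra.
have D : `]a, b[%classic = \bigcup_n `[a + e n, b - e n]%classic.
  apply/seteqP; split => x /=; rewrite in_itv/=.
    move=> /andP[ax xb].
    have m0 : 0 < Num.min (x - a) (b - x) by rewrite lt_min !subr_gt0 ax.
    have [N _ hN] := (@cvgrPdist_lt _ _ _ _ _ _ _).1 ecvg _ m0.
    exists N => //=; rewrite in_itv/=.
    have := hN N (leqnn _); rewrite /= sub0r normrN gtr0_norm// lt_min.
    by move=> /andP[h1 h2]; lra.
  by move=> [n _] /=; rewrite in_itv/=; exact: inab.
have mf : measurable_fun `]a, b[%classic f.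
  apply: open_continuous_measurable_fun => //.
  by move=> x; rewrite inE/= in_itv/=; exact: cf.
have h := @ge0_integral_exhaust f `]a, b[%classic (fun n => a + e n) (fun n => b - e n).
have {}h : (\int[mu]_(x in `[(a + e n)%R, (b - e n)%R]) (f x)%:E @[n --> \oo] -->
    \int[mu]_(x in `]a, b[) (f x)%:E)%E.
  apply: h => //.
  - by move=> n; rewrite lerD2l.
  - by move=> n; rewrite lerD2l lerN2.
have Fc x : a < x < b -> {for x, continuous F}.
  move=> xab; apply: differentiable_continuous; apply/derivable1_diffP.
  by have [] := dF x xab.
have hF n : (\int[mu]_(x in `[(a + e n)%R, (b - e n)%R]) (f x)%:E =
    (F (b - e n))%:E - (F (a + e n))%:E)%E.
  apply: continuous_FTC2; first exact: abn.
  - apply: continuous_in_subspaceT => x; rewrite inE/= in_itv/= => /inab; exact: cf.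
  - split.
    + move=> x xn; have [] // := dF x _; apply: (inab n).
      by move: xn; rewrite !in_itv/= => /andP[/ltW -> /ltW ->].
    + by apply: cvg_at_right_filter; apply/Fc/(inab n); rewrite lexx ltW.
    + by apply: cvg_at_left_filter; apply/Fc/(inab n); rewrite lexx ltW.
  - move=> x xn; rewrite derive1E; have xab : a < x < b.
      by apply: (inab n); move: xn; rewrite !in_itv/= => /andP[/ltW -> /ltW ->].
    by have [] := dF x xab.
apply: (cvg_unique _ h) => //.
rewrite (_ : (fun n => _) = fun n => (F (b - e n) - F (a + e n))%:E); last first.
  by apply/funext => n; rewrite hF EFinB.
apply: cvg_EFin; first exact: nearW.
apply: cvgB.
  have eb : b - e n @[n --> \oo] --> b^'-.
    move=> A /nbhs_ballP[d /= d0 dA].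
    have [N _ hN] := (@cvgrPdist_lt _ _ _ _ _ _ _).1 ecvg _ d0.
    exists N => // n /= Nn; apply: dA.
      by have := hN n Nn; rewrite /ball/= sub0r normrN opprB addrC subrK.
    by rewrite ltrBlDr ltrDl.
  exact: (cvg_comp _ _ eb Fr).
have ea : a + e n @[n --> \oo] --> a^'+.
  move=> A /nbhs_ballP[d /= d0 dA].
  have [N _ hN] := (@cvgrPdist_lt _ _ _ _ _ _ _).1 ecvg _ d0.
  exists N => // n /= Nn; apply: dA.
    by have := hN n Nn; rewrite /ball/= sub0r normrN opprD addrA subrr sub0r normrN.
  by rewrite ltrDl.
exact: (cvg_comp _ _ ea Fl).
Qed.

End Exhaustion.

(** * Power substitution in Gamma integrals *)

Section GammaSubst.
Context (R : realType).
Local Notation mu := (@lebesgue_measure R).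
Local Notation Rpos := (`]0%R, +oo[%classic : set R).

Lemma continuous_powR_gt0 (a x : R) : 0 < x -> {for x, continuous (@powR R ^~ a)}.
Proof.
move=> x0; apply: differentiable_continuous; apply/derivable1_diffP.
by have [] := is_derive1_powR a x0.
Qed.

Lemma measurable_gamma_fun (a : R) :
  measurable_fun setT (fun x : R => x `^ a * expR (- x)).
Proof.
apply: measurable_funM; first exact: measurable_powR.
by apply: measurableT_comp => //.
Qed.

Variables (p k : nat).
Hypotheses (p0 : (0 < p)%N) (k0 : (0 < k)%N).

Let F (v : R) := v ^+ k.
Let G (x : R) := x `^ (p%:R / k%:R - 1) * expR (- x).
Let H (v : R) := v ^+ p.-1 * expR (- (v ^+ k)).

Let dF (x : R) : is_derive x (1 : R) F (k%:R * x ^+ k.-1).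
Proof.
rewrite (_ : F = (id : R -> R) ^+ k); last by apply/funext => y; rewrite /F !fctE.
by apply: is_derive_eq; rewrite /GRing.scale/= mulr1.
Qed.

Let dFE : derive1 F = fun x => k%:R * x ^+ k.-1.
Proof. by apply/funext => x; rewrite derive1E; have [_ ->] := dF x. Qed.

Let cF : continuous F. Proof. exact: exprn_continuous. Qed.

Let cdF : continuous (derive1 F : R -> R).
Proof.
rewrite dFE => x; apply: cvgM; first exact: cvg_cst.
exact: exprn_continuous.
Qed.

Let GF x : 0 < x -> G (F x) * derive1 F x = k%:R * H x.
Proof.
move=> x0; rewrite dFE /G /F /H.
have k0' : k%:R != 0 :> R by rewrite pnatr_eq0 -lt0n.
have -> : (x ^+ k) `^ (p%:R / k%:R - 1) = x `^ (p%:R - k%:R).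
  by rewrite -powR_mulrn ?ltW// -powRrM mulrBr mulr1 mulrCA mulfV// mulr1.
have -> : x ^+ p.-1 = x `^ (p%:R - k%:R) * x ^+ k.-1.
  rewrite -!powR_mulrn ?ltW// -powRD; last by rewrite (gt_eqF x0) implybT.
  have hp : p%:R = p.-1%:R + 1 :> R by rewrite natr1 prednK.
  have hk : k%:R = k.-1%:R + 1 :> R by rewrite natr1 prednK.
  by congr (_ `^ _); rewrite hp hk; ring.
by ring.
Qed.

Let mH : measurable_fun setT H.
Proof.
apply: measurable_funM; first exact: measurable_funX.
apply: measurableT_comp => //; apply: measurableT_comp => //.
Qed.

(** The substitution x = v^k is made on the compact intervals [1/(n+2), n+2], where it is smooth,
    and passed to the limit by monotone convergence on both sides. *)
Lemma gamma_substitution :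
  (\int[mu]_(x in Rpos) (x `^ (p%:R / k%:R - 1) * expR (- x))%:E =
   k%:R%:E * \int[mu]_(v in Rpos) (v ^+ p.-1 * expR (- (v ^+ k)))%:E)%E.
Proof.
pose a n : R := n.+2%:R^-1; pose b n : R := n.+2%:R.
have a0 n : 0 < a n by rewrite invr_gt0 ltr0n.
have b0 n : 0 < b n by rewrite ltr0n.
have aS n : a n.+1 <= a n by rewrite lef_pV2 ?posrE ?ltr0n// ler_nat.
have bS n : b n <= b n.+1 by rewrite ler_nat.
have ab n : a n < b n.
  by apply: (@lt_trans _ _ 1); rewrite ?invf_lt1 ?ltr1n// ltr0n.
have D : Rpos = \bigcup_n `[a n, b n]%classic.
  apply/seteqP; split => x /=; rewrite in_itv/= andbT; last first.
    by move=> [n _] /=; rewrite in_itv/= => /andP[+ _]; exact: lt_le_trans.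
  move=> x0; exists (Num.truncn x + Num.truncn x^-1)%N => //=; rewrite in_itv/=.
  apply/andP; split.
    rewrite -[leRHS]invrK lef_pV2 ?posrE ?invr_gt0//.
    apply: le_trans (ltW (truncnS_gt _)) _; rewrite ler_nat ltnS.
    by apply: leqW; exact: leq_addl.
  apply: le_trans (ltW (truncnS_gt _)) _; rewrite ler_nat ltnS.
  by apply: leqW; exact: leq_addr.
have incrF x y : 0 < x -> x < y -> F x < F y.
  by move=> x0 xy; rewrite /F ltrXn2r ?ltW -?lt0n// (lt_trans x0).
have leF x y : 0 < x -> x <= y -> F x <= F y.
  by move=> x0; rewrite le_eqVlt => /predU1P[->//|/(incrF _ _ x0)/ltW].
have D' : Rpos = \bigcup_n `[F (a n), F (b n)]%classic.
  apply/seteqP; split => x /=; rewrite in_itv/= andbT; last first.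
    move=> [n _] /=; rewrite in_itv/= => /andP[+ _]; apply: lt_le_trans.
    exact: exprn_gt0.
  move=> x0.
  have : Rpos (x `^ k%:R^-1) by rewrite /= in_itv/= andbT powR_gt0.
  rewrite D => -[n _] /=; rewrite in_itv/= => /andP[h1 h2].
  exists n => //=; rewrite in_itv/=.
  have <- : F (x `^ k%:R^-1) = x.
    rewrite /F -powR_mulrn ?powR_ge0// -powRrM mulVf ?powRr1 ?ltW//.
    by rewrite pnatr_eq0 -lt0n.
  by rewrite !leF// powR_gt0.
have h1 := @ge0_integral_exhaust R G Rpos (fun n => F (a n)) (fun n => F (b n)).
have {}h1 : (\int[mu]_(x in `[F (a n), F (b n)]) (G x)%:E @[n --> \oo] -->
    \int[mu]_(x in Rpos) (G x)%:E)%E.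
  apply: h1 => //.
  - by move=> n; rewrite leF.
  - by move=> n; rewrite leF.
  - apply: measurable_funTS; exact: measurable_gamma_fun.
  - by move=> x _; rewrite mulr_ge0 ?powR_ge0 ?expR_ge0.
have h2 := @ge0_integral_exhaust R (fun v => k%:R * H v) Rpos a b.
have {}h2 : (\int[mu]_(x in `[a n, b n]) (k%:R * H x)%:E @[n --> \oo] -->
    \int[mu]_(x in Rpos) (k%:R * H x)%:E)%E.
  apply: h2 => //.
  - exact/measurable_funTS/measurable_funM.
  - move=> x; rewrite /= in_itv/= andbT => x0.
    by rewrite !mulr_ge0 ?expR_ge0// exprn_ge0// ltW.
transitivity (\int[mu]_(x in Rpos) (k%:R * H x)%:E)%E; last first.
  rewrite -ge0_integralZl//.
  - exact/measurable_EFinP/measurable_funTS.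
  - move=> x; rewrite /= in_itv/= andbT => x0.
    by rewrite lee_fin mulr_ge0 ?expR_ge0// exprn_ge0// ltW.
apply: (cvg_unique _ h1) => //.
rewrite (_ : (fun n => _) = fun n => \int[mu]_(x in `[a n, b n]) (k%:R * H x)%:E)%E //.
apply/funext => n.
rewrite integration_by_substitution_increasing.
- apply: eq_integral => x; rewrite inE/= in_itv/= => /andP[ax _].
  by congr EFin; apply: GF; exact: lt_le_trans ax.
- exact: ltW.
- move=> x y; rewrite !in_itv/= => /andP[ax _] _; apply: incrF.
  exact: lt_le_trans ax.
- by move=> x _; exact: cdF.
- by apply/cvg_ex; exists ((derive1 F) (a n)); apply: cvg_at_right_filter; exact: cdF.
- by apply/cvg_ex; exists (derive1 F (b n)); apply: cvg_at_left_filter; exact: cdF.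
- split.
  + by move=> x _; have [] := dF x.
  + by apply: cvg_at_right_filter; exact: cF.
  + by apply: cvg_at_left_filter; exact: cF.
- apply: continuous_in_subspaceT => x; rewrite inE/= in_itv/= => /andP[ax _].
  have x0 : 0 < x by apply: lt_le_trans ax; exact: exprn_gt0.
  apply: cvgM; first exact: continuous_powR_gt0.
  apply: continuous_comp; [exact: oppr_continuous|exact: continuous_expR].
Qed.

Lemma gamma_integral (t : R) : 0 < t ->
  (\int[mu]_(v in Rpos) (v ^+ p.-1 * expR (- (t * v ^+ k)))%:E =
   (t `^ (- (p%:R / k%:R)) / k%:R)%:E *
     \int[mu]_(x in Rpos) (x `^ (p%:R / k%:R - 1) * expR (- x))%:E)%E.
Proof.
move=> t0; rewrite gamma_substitution muleA -EFinM.
have k0' : k%:R != 0 :> R by rewrite pnatr_eq0 -lt0n.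
rewrite mulfVK//.
pose a := t `^ (- k%:R^-1).
have a0 : 0 < a by rewrite powR_gt0.
have ak : t * a ^+ k = 1.
  rewrite /a -powR_mulrn ?powR_ge0// -powRrM mulNr mulVf// powR_inv1 ?ltW//.
  by rewrite mulfV// gt_eqF.
have ap : t `^ (- (p%:R / k%:R)) = a * a ^+ p.-1.
  rewrite -exprS prednK// /a -powR_mulrn ?powR_ge0// -powRrM.
  by congr (_ `^ _); rewrite mulNr mulrC.
pose f (v : R) := (v ^+ p.-1 * expR (- (t * v ^+ k)))%:E.
(* The absolute value gives a globally nonnegative integrand, as the scaling lemma asks. *)
have mf : measurable_fun setT (fun v : R => `|v| ^+ p.-1 * expR (- (t * v ^+ k))).
  apply: measurable_funM; first by apply: measurable_funX.
  apply: measurableT_comp => //; apply: measurableT_comp => //.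
  by apply: measurable_funM => //; exact: measurable_funX.
transitivity (\int[mu]_(v in Rpos) (`|v| ^+ p.-1 * expR (- (t * v ^+ k)))%:E)%E.
  apply: eq_integral => v; rewrite inE/= in_itv/= andbT => v0.
  by rewrite gtr0_norm.
rewrite (ge0_integral_scale0y a0); last 2 first.
- exact/measurable_EFinP.
- by move=> v; rewrite lee_fin mulr_ge0 ?expR_ge0// exprn_ge0.
rewrite ap EFinM -muleA; congr (_ * _)%E.
rewrite -ge0_integralZl//; last 3 first.
- exact/measurable_EFinP/measurable_funTS.
- move=> v; rewrite /= in_itv/= andbT => v0.
  by rewrite lee_fin mulr_ge0 ?expR_ge0// exprn_ge0// ltW.
- by rewrite lee_fin exprn_ge0// ltW.
apply: eq_integral => v; rewrite inE/= in_itv/= andbT => v0.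
rewrite -EFinM; congr EFin; rewrite gtr0_norm ?mulr_gt0// !exprMn !mulrA.
by rewrite ak mul1r.
Qed.

End GammaSubst.

Lemma measurable_integral_param (R : realType) d (T : measurableType d)
    (f : T -> R -> \bar R) (D : set (measurableTypeR R)) :
  measurable D ->
  measurable_fun [set: T * measurableTypeR R] (fun p => f p.1 p.2) ->
  (forall t s, (0 <= f t s)%E) ->
  measurable_fun setT (fun t => \int[lebesgue_measure]_(s in D) f t s)%E.
Proof.
move=> mD mf f0.
pose g (p : T * measurableTypeR R) : \bar R := (fun p => f p.1 p.2) \_ (setT `*` D) p.
have mg : measurable_fun setT g.
  apply/(measurable_restrictT _ (measurableX measurableT mD)).
  exact: measurable_funTS.
have g0 p : (0 <= g p)%E by apply: erestrict_ge0.
rewrite (_ : (fun _ => _) = fubini_F lebesgue_measure g).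
  exact: measurable_fun_fubini_tonelli_F.
apply/funext => t; rewrite /fubini_F [LHS]integral_mkcond; apply: eq_integral => s _.
rewrite /g !patchE; congr (if _ then _ else _).
by apply/idP/idP; rewrite !inE //= => -[].
Qed.

(** * Reduction of the limit integral to a Gamma value and [moment] *)

Section LimitIntegral.
Context (R : realType) (k : nat).
Hypothesis k_ge2 : (2 <= k)%N.
Local Notation mu := (@lebesgue_measure R).
Local Notation RL := (measurableTypeR R).
Local Notation Rpos := (`]0%R, +oo[%classic : set R).
Local Notation I01 := (`]0%R, 1%R[%classic : set R).
Local Notation c := (rate R k).

Let c0 : 0 < c. Proof. exact: rate_gt0. Qed.
Let k0 : (0 < k)%N. Proof. exact: leq_trans k_ge2. Qed.

(** The Gamma integral before taking [fine]; working in the extended reals postpones questions of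
    finiteness. *)
Definition gammae (s : R) : \bar R :=
  (\int[mu]_(x in Rpos) (x `^ (s - 1) * expR (- x))%:E)%E.

Lemma gammae_ge0 s : (0 <= gammae s)%E.
Proof. by apply: integral_ge0 => x _; rewrite lee_fin mulr_ge0 ?powR_ge0 ?expR_ge0. Qed.

Lemma lim_singleE : lim_single R k = ((c `^ (- k%:R^-1) / k%:R)%:E * gammae k%:R^-1)%E.
Proof.
have := @gamma_integral R 1 k isT k0 c c0; rewrite mul1r => <-.
by apply: eq_integral => v _; rewrite expr0 mul1r.
Qed.

(** The Hermite-Genocchi formula: a divided difference is the average of the derivative over the
    segment joining the two points. *)
Lemma integral_expR_segment (p q : R) : 0 <= p -> 0 <= q ->
  (\int[mu]_(s in I01) (expR (- (s * p + (1 - s) * q)))%:E =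
   (if p == q then expR (- q) else (expR (- q) - expR (- p)) / (p - q))%:E)%E.
Proof.
move=> p0 q0; case: eqVneq => [->|pq].
  under eq_integral => s _.
    rewrite (_ : s * q + (1 - s) * q = q); last by ring.
    over.
  rewrite integral_cst//= lebesgue_measure_itv/= lte_fin ltr01.
  by rewrite oppr0 addr0 mule1.
have pq0 : p - q != 0 by rewrite subr_eq0.
pose f (s : R) := expR (- (s * p + (1 - s) * q)).
pose F (s : R) := - (p - q)^-1 * f s.
have dl (s : R) : is_derive s (1 : R) (fun s => - (s * p + (1 - s) * q)) (- (p - q)).
  rewrite (_ : (fun _ => _) = - ((p - q) *: (id : R -> R) + cst q)).
    by apply: is_derive_eq; rewrite /GRing.scale/= addr0 mulr1.
  by apply/funext => t; rewrite !fctE /GRing.scale/=; ring.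
have df (s : R) : is_derive s (1 : R) f (expR (- (s * p + (1 - s) * q)) * - (p - q)).
  by apply: is_derive1_comp.
have dF (s : R) : is_derive s (1 : R) F (f s).
  rewrite (_ : F = - (p - q)^-1 *: f); last by apply/funext.
  by apply: is_derive_eq; rewrite /GRing.scale/= /f; field.
have cf : continuous f.
  by move=> s; apply: differentiable_continuous; apply/derivable1_diffP; have [] := df s.
have cF : continuous F.
  by move=> s; apply: differentiable_continuous; apply/derivable1_diffP; have [] := dF s.
rewrite (@ge0_FTC_oo _ f F 0 1 (F 0) (F 1))//.
- by rewrite /F /f subrr mul0r mul1r addr0 mul0r subr0 mul1r add0r; congr EFin; field.
- by move=> s _; exact: cf.
- by move=> s _; exact: expR_ge0.
- by apply: cvg_at_right_filter; exact: cF.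
- by apply: cvg_at_left_filter; exact: cF.
Qed.

Lemma lim_kernelE (u v : R) : 0 < u -> 0 < v ->
  ((lim_kernel k u v)%:E = \int[mu]_(s in I01)
    (expR (- (s * (c * Num.max u v ^+ k) + (1 - s) * (c * v ^+ k))))%:E)%E.
Proof.
move=> u0 v0; rewrite integral_expR_segment; last 2 first.
- by apply: mulr_ge0; [exact: ltW|rewrite exprn_ge0// le_max ltW].
- by apply: mulr_ge0; [exact: ltW|rewrite exprn_ge0// ltW].
rewrite /lim_kernel; have [vu|uv] := ltP v u; last by rewrite eqxx.
rewrite gt_eqF// ltr_pM2l// ltrXn2r ?ltW// -lt0n//.
Qed.

Let theta (z s : R) : R := s + (1 - s) * z ^+ k.

(** What remains of the region v < u: with v = u z the exponent is -c u^k [theta] z s, and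
    integrating u times its exponential over u > 0 produces the power -2/k of [theta]. *)
Definition moment : \bar R :=
  (\int[mu]_(z in I01) \int[mu]_(s in I01) (theta z s `^ (- (2 / k%:R)))%:E)%E.

Let theta_gt0 z s : 0 < z < 1 -> 0 < s < 1 -> 0 < theta z s.
Proof.
move=> /andP[z0 z1] /andP[s0 s1]; rewrite /theta ltr_pwDl// mulr_ge0 ?subr_ge0 ?ltW//.
exact: exprn_gt0.
Qed.

(* the part u <= v of the limit integral *)
Let lower_part : (\int[mu]_(v in Rpos) \int[mu]_(u in `]0%R, v]) (lim_kernel k u v)%:E =
  (c `^ (- (2 / k%:R)) / k%:R)%:E * gammae (2 / k%:R))%E.
Proof.
rewrite /gammae -(@gamma_integral R 2 k isT k0 c c0).
apply: eq_integral => v; rewrite inE/= in_itv/= andbT => v0.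
transitivity (\int[mu]_(u in `]0%R, v]) (expR (- (c * v ^+ k)))%:E)%E.
  apply: eq_integral => u; rewrite inE/= in_itv/= => /andP[u0 uv].
  by rewrite /lim_kernel ltNge uv.
rewrite integral_cst//= lebesgue_measure_itv/= lte_fin v0 oppr0 addr0.
by rewrite -EFinM expr1 mulrC.
Qed.

(** The absolute values change nothing for u > 0 and z, s in (0,1); they make f nonnegative
    everywhere, as Tonelli requires. *)
Let f (u z s : R) : \bar R :=
  (`|u| * expR (- (c * `|theta z s| * `|u| ^+ k)))%:E.

Let mtheta : measurable_fun [set: RL * RL] (fun p => theta p.1 p.2).
Proof.
apply: measurable_funD => //; apply: measurable_funM.
  by apply: measurable_funB.
by apply: measurable_funX.
Qed.

Let mf : measurable_fun [set: (RL * RL) * RL] (fun p => f p.1.1 p.1.2 p.2).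
Proof.
have m1 : measurable_fun [set: (RL * RL) * RL] (fun p => p.1.1 : R).
  by apply: (measurableT_comp measurable_fst).
have m2 : measurable_fun [set: (RL * RL) * RL] (fun p => p.1.2 : R).
  by apply: (measurableT_comp measurable_snd).
have m3 : measurable_fun [set: (RL * RL) * RL] (fun p => p.2 : R) by exact: measurable_snd.
have mt : measurable_fun [set: (RL * RL) * RL] (fun p => theta p.1.2 p.2).
  apply: measurable_funD => //; apply: measurable_funM.
    by apply: measurable_funB.
  by apply: measurable_funX.
have mn (g : (RL * RL) * RL -> R) : measurable_fun setT g ->
    measurable_fun setT (fun p => `|g p|).
  by move=> mg; exact: measurableT_comp.
apply/measurable_EFinP; apply: measurable_funM; first exact: mn.
apply: (measurableT_comp (@measurable_expR R)).
apply: (measurableT_comp (@oppr_measurable R setT)).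
apply: measurable_funM; last by apply: measurable_funX; exact: mn.
by apply: measurable_funM => //; exact: mn.
Qed.

Let f0 u z s : (0 <= f u z s)%E.
Proof. by rewrite lee_fin mulr_ge0 ?expR_ge0. Qed.

Let h (u v : R) : \bar R := if v < u then 0%E else (lim_kernel k u v)%:E.
Let g (u v : R) : \bar R := if v < u then (lim_kernel k u v)%:E else 0%E.

Let mL : measurable2 (fun u v : R => (lim_kernel k u v)%:E).
Proof. by apply/measurable_EFinP; exact: measurable_lim_kernel. Qed.

Let mlt : measurable_fun [set: RL * RL] (fun p => p.2 < p.1).
Proof. by apply: measurable_fun_ltr; [exact: measurable_snd|exact: measurable_fst]. Qed.

Let mh : measurable2 h.
Proof. by apply: measurable_fun_ifT. Qed.

Let mg : measurable2 g.
Proof. by apply: measurable_fun_ifT. Qed.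

Let h0 u v : (0 <= h u v)%E.
Proof. by rewrite /h; case: ifP => // _; rewrite lee_fin lim_kernel_ge0. Qed.

Let g0 u v : (0 <= g u v)%E.
Proof. by rewrite /g; case: ifP => // _; rewrite lee_fin lim_kernel_ge0. Qed.

Let lower_part_h : (\int[mu]_(v in Rpos) \int[mu]_(u in Rpos) h u v =
  (c `^ (- (2 / k%:R)) / k%:R)%:E * gammae (2 / k%:R))%E.
Proof.
rewrite -lower_part; apply: eq_integral => v _.
rewrite integral_mkcond [RHS]integral_mkcond; apply: eq_integral => u _.
rewrite !patchE !mem_setE !in_itv/= andbT /h.
by case: (ltP 0 u) => _; case: (ltP v u).
Qed.

Let mtheta_pow : measurable2 (fun z s => (theta z s `^ (- (2 / k%:R)))%:E).
Proof.
apply/measurable_EFinP.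
apply: (@measurableT_comp _ _ _ _ _ _ (fun x : R => x `^ (- (2 / k%:R))) _
  (fun p : RL * RL => theta p.1 p.2)); [exact: measurable_powR|exact: mtheta].
Qed.

Let theta_pow_ge0 z s : (0 <= (theta z s `^ (- (2 / k%:R)))%:E)%E.
Proof. by rewrite lee_fin powR_ge0. Qed.

Let upper_inner u : 0 < u ->
  (\int[mu]_(v in Rpos) g u v = \int[mu]_(z in I01) \int[mu]_(s in I01) f u z s)%E.
Proof.
move=> u0; transitivity (\int[mu]_(v in `]0%R, u[) (lim_kernel k u v)%:E)%E.
  rewrite integral_mkcond [RHS]integral_mkcond; apply: eq_integral => v _.
  rewrite !patchE !mem_setE !in_itv/= andbT /g.
  by case: (ltP 0 v) => _; case: (ltP v u).
rewrite (ge0_integral_scale0a u0 (measurable2_section2 mL u)); last first.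
  by move=> v; rewrite lee_fin lim_kernel_ge0.
rewrite -ge0_integralZl//; last 3 first.
- apply: measurable_funTS.
  apply: (@measurableT_comp _ _ _ _ _ _ (fun v => (lim_kernel k u v)%:E) _
    (fun z : R => u * z)); first exact: (measurable2_section2 mL u).
  exact: measurable_funM.
- by move=> z _; rewrite lee_fin lim_kernel_ge0.
- by rewrite lee_fin ltW.
apply: eq_integral => z; rewrite inE/= in_itv/= => /andP[z0 z1].
rewrite lim_kernelE ?mulr_gt0// -ge0_integralZl//; last 2 first.
- apply/measurable_EFinP/measurable_funTS.
  apply: (measurableT_comp (@measurable_expR R)).
  apply: (measurableT_comp (@oppr_measurable R setT)).
  apply: measurable_funD; apply: measurable_funM => //.
  exact: measurable_funB.
- by rewrite lee_fin ltW.
apply: eq_integral => s; rewrite inE/= in_itv/= => s01.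
rewrite -EFinM /f !gtr0_norm//; last by apply: theta_gt0 => //; rewrite z0.
congr (_ * expR _)%:E; rewrite /theta (max_idPl _); last by nra.
by rewrite exprMn; ring.
Qed.

(** Tonelli brings u outside to allow the substitution v = u z, then brings u innermost, past z and
    s, where it is a Gamma integral. *)
Let upper_part : (\int[mu]_(v in Rpos) \int[mu]_(u in Rpos) g u v =
  (c `^ (- (2 / k%:R)) / k%:R)%:E * gammae (2 / k%:R) * moment)%E.
Proof.
rewrite (tonelli mg g0)//.
transitivity (\int[mu]_(u in Rpos) \int[mu]_(z in I01) \int[mu]_(s in I01) f u z s)%E.
  by apply: eq_integral => u; rewrite inE/= in_itv/= andbT; exact: upper_inner.
pose fz u z : \bar R := (\int[mu]_(s in I01) f u z s)%E.
have mfz : measurable2 fz.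
  apply: (@measurable_integral_param _ _ (RL * RL)%type (fun p => f p.1 p.2)) => //.
have fz0 u z : (0 <= fz u z)%E by apply: integral_ge0.
rewrite -[LHS](tonelli mfz fz0)//.
have mfus z : measurable2 (fun u s => f u z s).
  apply: (@measurableT_comp _ _ _ _ _ _ (fun p : (RL * RL) * RL => f p.1.1 p.1.2 p.2) _
    (fun p : RL * RL => ((p.1, z), p.2))) => //.
  apply: measurable_fun_pair; last exact: measurable_snd.
  by apply: measurable_fun_pair => //; exact: measurable_fst.
transitivity (\int[mu]_(z in I01) (((c `^ (- (2 / k%:R)) / k%:R)%:E * gammae (2 / k%:R)) *
   \int[mu]_(s in I01) (theta z s `^ (- (2 / k%:R)))%:E))%E; last first.
  rewrite ge0_integralZl//.
  - by apply: measurable_funTS; exact: (measurable_inner2 mtheta_pow).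
  - by move=> z _; apply: integral_ge0 => s _; rewrite lee_fin powR_ge0.
  - by rewrite mule_ge0 ?gammae_ge0// lee_fin divr_ge0// powR_ge0.
apply: eq_integral => z; rewrite inE/= in_itv/= => z01.
rewrite /fz -(tonelli (mfus z))// -ge0_integralZl//; last 2 first.
- by apply: measurable_funTS; exact: (measurable2_section2 mtheta_pow z).
- by rewrite mule_ge0 ?gammae_ge0// lee_fin divr_ge0// powR_ge0.
apply: eq_integral => s; rewrite inE/= in_itv/= => s01.
have t0 := theta_gt0 z01 s01.
transitivity (\int[mu]_(u in Rpos) (u ^+ 1 * expR (- (c * theta z s * u ^+ k)))%:E)%E.
  apply: eq_integral => u; rewrite inE/= in_itv/= andbT => u0.
  by rewrite /f !gtr0_norm// expr1.
rewrite (@gamma_integral R 2 k isT k0) ?mulr_gt0// -/(gammae _).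
rewrite powRM ?ltW// muleAC -EFinM; congr (_%:E * _)%E; by rewrite mulrAC.
Qed.

Lemma lim_integralE : (lim_integral R k =
  (c `^ (- (2 / k%:R)) / k%:R)%:E * gammae (2 / k%:R) * (1 + moment))%E.
Proof.
have m0 : (0 <= moment)%E.
  by apply: integral_ge0 => z _; apply: integral_ge0 => s _; rewrite lee_fin powR_ge0.
rewrite ge0_muleDr// mule1 -upper_part -lower_part_h.
rewrite -ge0_integralD//; last 4 first.
- by move=> v _; apply: integral_ge0.
- by apply: measurable_funTS; exact: (measurable_inner1 mh).
- by move=> v _; apply: integral_ge0.
- by apply: measurable_funTS; exact: (measurable_inner1 mg).
apply: eq_integral => v; rewrite inE/= in_itv/= andbT => v0.
rewrite -ge0_integralD//; last 2 first.
- by apply: measurable_funTS; exact: (measurable2_section1 mh v).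
- by apply: measurable_funTS; exact: (measurable2_section1 mg v).
apply: eq_integral => u _; rewrite /h /g.
by case: ifP; rewrite ?add0e ?adde0.
Qed.

End LimitIntegral.

(** * Partial fractions over roots of unity and the cotangent integral *)

Section TrigSums.
Context (R : realType).
Implicit Types x z : R.

Lemma sin_recurrence n x :
  sin (n.+2%:R * x) = 2 * cos x * sin (n.+1%:R * x) - sin (n%:R * x).
Proof.
have -> : n.+2%:R * x = n.+1%:R * x + x by rewrite -[n.+2%:R]natr1; ring.
have -> : n%:R * x = n.+1%:R * x - x by rewrite -[n.+1%:R]natr1; ring.
by rewrite sinD sinB; ring.
Qed.

(** The truncated generating function of sin((n+1)x): its denominator is the characteristic
    polynomial of the recurrence satisfied by the sines, so only boundary terms survive. *)
Lemma sine_generating_sum N x z :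
  (1 - 2 * z * cos x + z ^+ 2) * \sum_(n < N) z ^+ n * sin (n.+1%:R * x) =
  sin x - z ^+ N * sin (N.+1%:R * x) + z ^+ N.+1 * sin (N%:R * x).
Proof.
elim: N => [|N IHN]; first by rewrite big_ord0 !mul1r mul0r sin0; ring.
by rewrite big_ord_recr/= mulrDr IHN sin_recurrence !exprS; ring.
Qed.

Lemma cos_sum_telescope n x :
  2 * sin (x / 2) * \sum_(j < n) cos (j%:R * x) =
  sin (n%:R * x - x / 2) + sin (x / 2).
Proof.
elim: n => [|n IHn].
  by rewrite big_ord0 mulr0 mul0r sub0r sinN addrC subrr.
rewrite big_ord_recr/= mulrDr IHn.
have -> : n.+1%:R * x - x / 2 = n%:R * x + x / 2 by rewrite -natr1; field.
by rewrite (sinD (n%:R * x) (x / 2)) (sinB _ (x / 2)); ring.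
Qed.

Lemma sin_sum_telescope n x :
  2 * sin (x / 2) * \sum_(j < n) sin (j%:R * x) =
  cos (x / 2) - cos (n%:R * x - x / 2).
Proof.
elim: n => [|n IHn].
  by rewrite big_ord0 mulr0 mul0r sub0r cosN subrr.
rewrite big_ord_recr/= mulrDr IHn.
have -> : n.+1%:R * x - x / 2 = n%:R * x + x / 2 by rewrite -natr1; field.
by rewrite (cosD (n%:R * x) (x / 2)) (cosB _ (x / 2)); ring.
Qed.

Lemma weighted_sin_sum n x :
  4 * sin (x / 2) ^+ 2 * \sum_(j < n) j%:R * sin (j%:R * x) =
  sin (n%:R * x) - 2 * sin (x / 2) * n%:R * cos (n%:R * x - x / 2).
Proof.
elim: n => [|n IHn].
  by rewrite big_ord0 !mul0r sin0; ring.
rewrite big_ord_recr/= mulrDr IHn.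
have -> : n.+1%:R * x - x / 2 = n%:R * x + x / 2 by rewrite -natr1; field.
have -> : n.+1%:R * x = n%:R * x + x / 2 + x / 2 by rewrite -natr1; field.
rewrite (sinD (n%:R * x + x / 2)) (cosB _ (x / 2)) (cosD _ (x / 2)).
rewrite (sinD _ (x / 2)) -natr1.
have := cos2sin2 (x / 2).
move: (sin (n%:R * x)) (cos (n%:R * x)) (sin (x / 2)) (cos (x / 2)) => S C s c h.
transitivity (S * (1 - s ^+ 2) + S * s ^+ 2 - 2 * s * n%:R * (C * c + S * s) +
  4 * s ^+ 2 * (n%:R * S)); first by ring.
transitivity (S * c ^+ 2 - S * s ^+ 2 + 2 * C * s * c -
  2 * s * (n%:R + 1) * (C * c - S * s)); last by ring.
by rewrite h; ring.
Qed.

Lemma cosDn2pi x m : cos (x + m%:R * (2 * pi)) = cos x.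
Proof. by rewrite mulr_natl [2 * pi]mulr_natl (periodicn (@cosD2pi R)). Qed.

Lemma sinDn2pi x m : sin (x + m%:R * (2 * pi)) = sin x.
Proof. by rewrite mulr_natl [2 * pi]mulr_natl (periodicn (@sinD2pi R)). Qed.

Lemma sinn2pi m : sin (m%:R * (2 * pi)) = 0 :> R.
Proof. by rewrite -[X in sin X]add0r sinDn2pi sin0. Qed.

Section RootsOfUnity.
Variable k : nat.
Hypothesis k2 : (2 < k)%N.

Definition angle (j : nat) : R := j%:R * (2 * pi / k%:R).

Let k0 : k%:R != 0 :> R.
Proof. by rewrite pnatr_eq0; lia. Qed.

Let mulk_angle j : k%:R * angle j = j%:R * (2 * pi).
Proof. by rewrite /angle; field. Qed.

Lemma cos_angle_sum m : (0 < m < k)%N -> \sum_(j < k) cos (m%:R * angle j) = 0.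
Proof.
move=> /andP[m0 mk]; pose x := angle m.
have e j : m%:R * angle j = j%:R * x by rewrite /x /angle mulrCA.
under eq_bigr do rewrite e.
have h := cos_sum_telescope k x.
have s0 : sin (x / 2) != 0.
  rewrite gt_eqF// sin_gt0_pi//; have pi0 := @pi_gt0 R.
  have -> : x / 2 = (m%:R / k%:R) * pi by rewrite /x /angle; field.
  rewrite pmulr_lgt0// divr_gt0 ?ltr0n//= ?(ltn_trans m0)//.
  by rewrite gtr_pMl// ltr_pdivrMr ?ltr0n ?(ltn_trans m0)// mul1r ltr_nat.
have : 2 * sin (x / 2) * \sum_(j < k) cos (j%:R * x) = 0.
  by rewrite h mulk_angle (addrC _ (- _)) sinDn2pi sinN addNr.
by move/eqP; rewrite !mulf_eq0 pnatr_eq0 (negbTE s0) => /eqP.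
Qed.

Let phi : R := 2 * pi / k%:R.

Let phi2 : phi / 2 = pi / k%:R.
Proof. by rewrite /phi; field. Qed.

Let sin_phi2 : sin (phi / 2) != 0.
Proof.
have kp : 0 < k%:R :> R by rewrite ltr0n; lia.
rewrite gt_eqF// sin_gt0_pi//; have pi0 := @pi_gt0 R; rewrite phi2.
rewrite divr_gt0//= ltr_pdivrMr// -[ltLHS]mulr1 ltr_pM2l//.
by rewrite (ltr_nat _ 1); lia.
Qed.

Let kphi : k%:R * phi = 1%:R * (2 * pi).
Proof. by rewrite /phi; field. Qed.

Lemma weighted_sin_angle_sum :
  \sum_(j < k) j%:R * sin (angle j) = - (k%:R / 2) * cot (pi / k%:R).
Proof.
have h := weighted_sin_sum k phi.
rewrite /angle -/phi.
apply: (mulfI (x := 4 * sin (phi / 2) ^+ 2)).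
  by rewrite mulf_neq0 ?pnatr_eq0// expf_neq0.
rewrite h kphi sinn2pi addrC.
rewrite (_ : cos (1%:R * (2 * pi) - phi / 2) = cos (phi / 2)); last first.
  by rewrite addrC cosDn2pi cosN.
rewrite /cot -phi2; move: (sin (phi / 2)) (cos (phi / 2)) sin_phi2 => s c s0.
by field.
Qed.

Lemma sin_angle_sum : \sum_(j < k) sin (angle j) = 0.
Proof.
have h := sin_sum_telescope k phi.
apply: (mulfI (x := 2 * sin (phi / 2))); first by rewrite mulf_neq0 ?pnatr_eq0.
rewrite mulr0 h kphi (_ : cos (1%:R * (2 * pi) - phi / 2) = cos (phi / 2)) ?subrr//.
by rewrite addrC cosDn2pi cosN.
Qed.

(** Power sums of the k-th roots of unity: k when k divides m, and 0 otherwise. *)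
Let C m := \sum_(j < k) cos (m%:R * angle j).

Let C0 : C 0 = k%:R.
Proof.
rewrite /C; under eq_bigr do rewrite mul0r cos0.
by rewrite sumr_const card_ord.
Qed.

Let CDk m : C (m + k) = C m.
Proof.
apply: eq_bigr => j _.
by rewrite natrD mulrDl mulk_angle cosDn2pi.
Qed.

Let C_sum0 z : \sum_(n < k) z ^+ n * C n = k%:R.
Proof.
have kp : (0 < k)%N by lia.
rewrite (bigD1 (Ordinal kp))//= C0 expr0 mul1r big1 ?addr0// => n n0.
rewrite /C cos_angle_sum ?mulr0// ltn_ord andbT lt0n.
by apply: contra n0 => /eqP n0; apply/eqP/val_inj.
Qed.

Let C_sum2 z : \sum_(n < k) z ^+ n * C n.+2 = z ^+ (k - 2) * k%:R.
Proof.
have kp : (k - 2 < k)%N by lia.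
rewrite (bigD1 (Ordinal kp))//= (_ : (k - 2).+2 = 0 + k)%N; last by lia.
rewrite CDk C0 big1 ?addr0// => n nk2.
have nk : n != (k - 2)%N :> nat by apply: contra nk2 => /eqP h; apply/eqP/val_inj.
have := ltn_ord n => nlt.
have [nk1|nk1] := eqVneq (n : nat) k.-1.
  rewrite (_ : n.+2 = 1 + k)%N; last by lia.
  by rewrite CDk /C cos_angle_sum ?mulr0//; lia.
by rewrite /C cos_angle_sum ?mulr0//; move: nk nk1; lia.
Qed.

Definition poisson_den z x : R := 1 - 2 * z * cos x + z ^+ 2.

Lemma poisson_den_gt0 z x : 0 < z < 1 -> 0 < poisson_den z x.
Proof.
move=> /andP[z0 z1]; have := cos_le1 x; rewrite /poisson_den; nra.
Qed.

(** At multiples of 2 pi/k the generating sum of length k has right side (1 - z^k) sin x.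
    Multiplying by sin x turns products into differences of cosines, and summing over the roots of
    unity keeps only the terms n = 0 and n = k-2. *)
Lemma geometric_quotient z : 0 < z < 1 ->
  (1 - z ^+ (k - 2)) / (1 - z ^+ k) =
  2 / k%:R * \sum_(j < k) sin (angle j) ^+ 2 / poisson_den z (angle j).
Proof.
move=> z01; have /andP[z0 z1] := z01.
have zk : 1 - z ^+ k != 0.
  by rewrite subr_eq0 eq_sym lt_eqF// exprn_ilt1 ?ltW//; lia.
apply: (mulIf zk); rewrite divfK// -[RHS]mulrA mulr_suml.
have -> : \sum_(j < k) sin (angle j) ^+ 2 / poisson_den z (angle j) * (1 - z ^+ k) =
    \sum_(j < k) \sum_(n < k) z ^+ n * (cos (n%:R * angle j) - cos (n.+2%:R * angle j)) / 2.
  apply: eq_bigr => j _.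
  have d0 := poisson_den_gt0 (angle j) z01.
  have := sine_generating_sum k (angle j) z.
  have e : k.+1%:R * angle j = angle j + j%:R * (2 * pi).
    by rewrite -natr1 mulrDl mul1r mulk_angle addrC.
  rewrite -/(poisson_den _ _) mulk_angle sinn2pi mulr0 addr0 e sinDn2pi => h.
  have -> : sin (angle j) ^+ 2 / poisson_den z (angle j) * (1 - z ^+ k) =
      sin (angle j) * \sum_(n < k) z ^+ n * sin (n.+1%:R * angle j).
    apply: (mulfI (lt0r_neq0 d0)); rewrite [RHS]mulrCA h.
    move: (poisson_den z (angle j)) (sin (angle j)) (z ^+ k) d0 => D S Z D0.
    by field; rewrite gt_eqF.
  rewrite mulr_sumr; apply: eq_bigr => n _.
  have -> : n%:R * angle j = n.+1%:R * angle j - angle j.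
    by rewrite -[n.+1%:R]natr1; ring.
  have -> : n.+2%:R * angle j = n.+1%:R * angle j + angle j.
    by rewrite -[n.+2%:R]natr1; ring.
  by rewrite cosB cosD; field.
rewrite exchange_big/=.
have -> : \sum_(n < k) \sum_(j < k)
    z ^+ n * (cos (n%:R * angle j) - cos (n.+2%:R * angle j)) / 2 =
    (\sum_(n < k) z ^+ n * C n - \sum_(n < k) z ^+ n * C n.+2) / 2.
  rewrite -sumrB mulr_suml; apply: eq_bigr => n _.
  by rewrite -mulrBr /C -sumrB mulr_sumr mulr_suml.
by rewrite C_sum0 C_sum2; field.
Qed.

(** A primitive in z of sin(x)^2 / [poisson_den] z x. The outer factor sin x makes it vanish when
    sin x = 0, in agreement with the integrand. *)
Let antider z x : R := sin x * atan ((z - cos x) / sin x).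

Let is_derive_antider x z :
  is_derive z (1 : R) (antider ^~ x) (sin x ^+ 2 / poisson_den z x).
Proof.
have [s0|s0] := eqVneq (sin x) 0.
  rewrite s0 expr0n/= mul0r (_ : antider ^~ x = cst 0); first exact: is_derive_cst.
  by apply/funext => y; rewrite /antider s0 mul0r.
have dl : is_derive z (1 : R) (fun z => (z - cos x) / sin x) (sin x)^-1.
  rewrite (_ : (fun _ => _) = (sin x)^-1 *: ((id : R -> R) - cst (cos x))).
    by apply: is_derive_eq; rewrite /GRing.scale/= subr0 mulr1.
  by apply/funext => y; rewrite !fctE mulrC.
have da : is_derive z (1 : R) (fun z => atan ((z - cos x) / sin x))
    ((1 + ((z - cos x) / sin x) ^+ 2)^-1 * (sin x)^-1).
  by apply: is_derive1_comp.
rewrite (_ : antider ^~ x = sin x *: (fun z => atan ((z - cos x) / sin x))); last first.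
  by apply/funext.
apply: is_derive_eq; rewrite /GRing.scale/=.
have e : poisson_den z x = sin x ^+ 2 + (z - cos x) ^+ 2.
  by rewrite /poisson_den sin2cos2; ring.
have p0 : 0 < sin x ^+ 2 + (z - cos x) ^+ 2.
  by rewrite ltr_pwDl ?sqr_ge0// exprn_even_gt0.
rewrite e; field; rewrite s0/= gt_eqF//.
Qed.

(** The two arctangents have arguments tan(x/2) and tan(pi/2 - x), and x/2 + (pi/2 - x) = (pi -
    x)/2. *)
Let antider_increment x : 0 <= x < 2 * pi ->
  antider 1 x - antider 0 x = sin x * (pi - x) / 2.
Proof.
move=> /andP[x0 x2]; have pi0 := @pi_gt0 R.
have [s0|s0] := eqVneq (sin x) 0; first by rewrite /antider s0; ring.
have xn0 : x != 0 by apply: contra s0 => /eqP ->; rewrite sin0.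
have xnpi : x != pi by apply: contra s0 => /eqP ->; rewrite sinpi.
have {xn0}x0 : 0 < x by rewrite lt_neqAle eq_sym xn0.
have xE : x / 2 *+ 2 = x by rewrite mulr2n; field.
have sx : sin x = 2 * sin (x / 2) * cos (x / 2).
  by have := sin_mulr2n (x / 2); rewrite xE mulr2n => ->; ring.
have cx : 1 - cos x = 2 * sin (x / 2) ^+ 2.
  by have := cos_mulr2n (x / 2); rewrite xE cos2sin2 mulr2n => ->; ring.
have sh0 : sin (x / 2) != 0 by apply: contra s0; rewrite sx => /eqP ->; rewrite mulr0 mul0r.
have ch0 : cos (x / 2) != 0 by apply: contra s0; rewrite sx => /eqP ->; rewrite mulr0.
have t1 : (1 - cos x) / sin x = tan (x / 2).
  by rewrite cx sx /tan; field; rewrite ?sh0 ?ch0.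
have t0 : cos x / sin x = tan (pi / 2 - x).
  by rewrite /tan sinB cosB sin_pihalf cos_pihalf !mul1r !mul0r subr0 add0r.
rewrite /antider sub0r mulNr atanN mulrN opprK -mulrDr -mulrA; congr (_ * _).
rewrite t1 t0.
have [xpi|xpi] := ltP x pi.
  rewrite !tanK; first by field.
  - by rewrite in_itv/=; apply/andP; split; lra.
  - by rewrite in_itv/=; apply/andP; split; lra.
(* For x > pi both angles leave the principal range; they are shifted by -pi and +pi, so their sum
   is unchanged. *)
have {xnpi}xpi : pi < x by rewrite lt_neqAle eq_sym xnpi.
have -> : tan (x / 2) = tan (x / 2 - pi) by rewrite -[RHS]tanDpi subrK.
rewrite -(tanDpi (pi / 2 - x)) !tanK; first by field.
- by rewrite in_itv/=; apply/andP; split; lra.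
- by rewrite in_itv/=; apply/andP; split; lra.
Qed.

(** Integrating term by term leaves sums of sin(x_j)(pi - x_j) over the angles x_j; the sines sum to
    0 and the weighted sum gives the cotangent. *)
Lemma integral_geometric_quotient :
  (\int[@lebesgue_measure R]_(z in `]0%R, 1%R[)
     ((1 - z ^+ (k - 2)) / (1 - z ^+ k))%:E =
   (pi / k%:R * cot (pi / k%:R))%:E)%E.
Proof.
pose f (z : R) := 2 / k%:R * \sum_(j < k) sin (angle j) ^+ 2 / poisson_den z (angle j).
pose F (z : R) := 2 / k%:R * \sum_(j < k) antider z (angle j).
have dF z : is_derive z (1 : R) F (f z).
  rewrite (_ : F = (2 / k%:R) *: (\sum_(j < k) (antider ^~ (angle j)))).
    by apply: is_deriveZ; apply: is_derive_sum.
  by apply/funext => y; rewrite /F fctE fct_sumE.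
have cF : continuous F.
  by move=> s; apply: differentiable_continuous; apply/derivable1_diffP; have [] := dF s.
pose g (z : R) := (1 - z ^+ (k - 2)) / (1 - z ^+ k).
have fg z : 0 < z < 1 -> f z = g z by move=> z01; rewrite /g geometric_quotient.
have cg z : 0 < z < 1 -> {for z, continuous g}.
  move=> /andP[z0 z1]; apply: cvgM.
    by apply: cvgB; [exact: cvg_cst|exact: exprn_continuous].
  apply: cvgV; last by apply: cvgB; [exact: cvg_cst|exact: exprn_continuous].
  by rewrite subr_eq0 eq_sym lt_eqF// exprn_ilt1 ?ltW//; lia.
transitivity ((F 1 - F 0)%:E).
  apply: (@ge0_FTC_oo _ g F 0 1 (F 0) (F 1)) => //.
  - move=> z z01; rewrite -fg// /f mulr_ge0//; apply: sumr_ge0 => j _.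
    by rewrite divr_ge0 ?sqr_ge0// ltW// poisson_den_gt0.
  - by move=> z z01; rewrite -fg//; exact: dF.
  - by apply: cvg_at_right_filter; exact: cF.
  - by apply: cvg_at_left_filter; exact: cF.
congr (_%:E); rewrite /F -mulrBr -sumrB.
have pi0 := @pi_gt0 R.
have kp : 0 < k%:R :> R by rewrite ltr0n; lia.
under eq_bigr => j _.
  rewrite antider_increment; last first.
    rewrite /angle mulr_ge0//= ?divr_ge0 ?mulr_ge0 ?ltW//.
    rewrite mulrA ltr_pdivrMr// mulrC ltr_pM2l ?mulr_gt0//.
    by rewrite ltr_nat.
  rewrite (_ : _ / 2 = pi / 2 * sin (angle j) - pi / k%:R * (j%:R * sin (angle j))); last first.
    by rewrite /angle; field.
  over.
rewrite sumrB -!mulr_sumr weighted_sin_angle_sum.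
rewrite sin_angle_sum; by field.
Qed.

End RootsOfUnity.
End TrigSums.

(** * The value of [moment] for k > 2 and for k = 2 *)

Section Moment.
Context (R : realType).
Local Notation mu := (@lebesgue_measure R).
Local Notation RL := (measurableTypeR R).
Local Notation I01 := (`]0%R, 1%R[%classic : set R).

Lemma is_derive_affine (q s : R) :
  is_derive s (1 : R) (fun s => s + (1 - s) * q) (1 - q).
Proof.
rewrite (_ : (fun _ => _) = (1 - q) *: (id : R -> R) + cst q).
  by apply: is_derive_eq; rewrite /GRing.scale/= addr0 mulr1.
by apply/funext => t; rewrite !fctE /GRing.scale/=; ring.
Qed.

Lemma integral_affine_powR (q a : R) : 0 < q < 1 -> a < 1 ->
  (\int[mu]_(s in I01) ((s + (1 - s) * q) `^ (- a))%:E =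
   ((1 - q `^ (1 - a)) / ((1 - a) * (1 - q)))%:E)%E.
Proof.
move=> /andP[q0 q1] a1.
have c0 : (1 - a) * (1 - q) != 0 by rewrite mulf_neq0// subr_eq0 eq_sym lt_eqF.
pose t (s : R) := s + (1 - s) * q.
have t0 (s : R) : 0 <= s <= 1 -> 0 < t s by rewrite /t => /andP[s0 s1]; nra.
pose F (s : R) := ((1 - a) * (1 - q))^-1 * t s `^ (1 - a).
have dF (s : R) : 0 <= s <= 1 -> is_derive s (1 : R) F (t s `^ (- a)).
  move=> s01; have := t0 s s01 => ts.
  have dt : is_derive s (1 : R) (fun s => t s `^ (1 - a))
      ((1 - a) * t s `^ (1 - a - 1) * (1 - q)).
    apply: (@is_derive1_comp _ (fun x : R => x `^ (1 - a)) t).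
      exact: is_derive1_powR.
    exact: is_derive_affine.
  rewrite (_ : F = ((1 - a) * (1 - q))^-1 *: (fun s => t s `^ (1 - a))); last first.
    by apply/funext.
  apply: is_derive_eq; rewrite /GRing.scale/=.
  rewrite (_ : 1 - a - 1 = - a); last by ring.
  by rewrite mulrAC mulrA mulVf// mul1r.
have cF (s : R) : 0 <= s <= 1 -> {for s, continuous F}.
  move=> s01; apply: differentiable_continuous; apply/derivable1_diffP.
  by have [] := dF s s01.
have sub (s : R) : 0 < s < 1 -> 0 <= s <= 1 by move=> /andP[/ltW -> /ltW ->].
transitivity ((F 1 - F 0)%:E).
  apply: (@ge0_FTC_oo _ (fun s => t s `^ (- a)) F 0 1 (F 0) (F 1)); first exact: ltr01.
  - move=> s /sub/t0 ts.
    apply: (@continuous_comp _ _ _ t (fun x => x `^ (- a))).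
      apply: differentiable_continuous; apply/derivable1_diffP.
      by have [] := is_derive_affine q s.
    exact: continuous_powR_gt0.
  - by move=> s _; exact: powR_ge0.
  - move=> s s01. exact: (dF _ (sub _ s01)).
  - by apply: cvg_at_right_filter; apply: cF; rewrite lexx ler01.
  - by apply: cvg_at_left_filter; apply: cF; rewrite lexx ler01.
congr (_%:E); rewrite /F /t subrr mul0r addr0 powR1 subr0 add0r mul1r mulr1.
by rewrite -{1}[_^-1]mulr1 -mulrBr mulrC.
Qed.

(** Here 2/k < 1, so the inner integral in s is elementary. Since (z^k)^(1-2/k) = z^(k-2), it equals
    k/(k-2) times the quotient integrated above. *)
Lemma moment_gt2 (k : nat) : (2 < k)%N ->
  moment R k = (pi * cot (pi / k%:R) / (k%:R - 2))%:E.
Proof.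
move=> k2; have k0 : k%:R != 0 :> R by rewrite pnatr_eq0; lia.
have k20 : 0 < k%:R - 2 :> R by rewrite subr_gt0 ltr_nat.
have kp : 0 < k%:R :> R by rewrite ltr0n; lia.
transitivity (\int[mu]_(z in I01) ((k%:R / (k%:R - 2))%:E *
    ((1 - z ^+ (k - 2)) / (1 - z ^+ k))%:E))%E.
  apply: eq_integral => z; rewrite inE/= in_itv/= => /andP[z0 z1].
  have q0 : 0 < z ^+ k by exact: exprn_gt0.
  have q1 : z ^+ k < 1 by rewrite exprn_ilt1 ?ltW//; lia.
  rewrite integral_affine_powR ?q0//; last by rewrite ltr_pdivrMr// mul1r ltr_nat.
  rewrite -EFinM; congr (_%:E).
  have -> : (z ^+ k) `^ (1 - 2 / k%:R) = z ^+ (k - 2).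
    have z0' : 0 <= z by exact: ltW.
    rewrite -[z ^+ k](powR_mulrn k z0').
    rewrite -[RHS](powR_mulrn (k - 2) z0').
    rewrite -powRrM.
    rewrite natrB; last exact: ltnW.
    by congr (_ `^ _); field.
  have q10 : 1 - z ^+ k != 0 by rewrite subr_eq0 eq_sym lt_eqF.
  by field; rewrite k0 q10 (lt0r_neq0 k20).
rewrite ge0_integralZl//.
- rewrite integral_geometric_quotient// -EFinM; congr (_%:E).
  by field; rewrite k0 (lt0r_neq0 k20).
- apply/measurable_EFinP/measurable_funTS/measurable_funM.
    by apply: measurable_funB => //; exact: measurable_funX.
  apply: (measurableT_comp (@measurable_invr R)).
  by apply: measurable_funB => //; exact: measurable_funX.
- move=> z; rewrite /= in_itv/= => /andP[z0 z1]; rewrite lee_fin divr_ge0//.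
    by rewrite subr_ge0 exprn_ile1// ltW.
  by rewrite subr_ge0 exprn_ile1// ltW.
- by rewrite lee_fin divr_ge0// ltW.
Qed.

Let r (s : R) := Num.sqrt (s^-1 - 1).

Let r_gt0 (s : R) : 0 < s < 1 -> 0 < r s.
Proof. by move=> /andP[s0 s1]; rewrite sqrtr_gt0 subr_gt0 invf_gt1. Qed.

Let r_sqr (s : R) : 0 < s < 1 -> r s ^+ 2 = s^-1 - 1.
Proof.
move=> /andP[s0 s1]; rewrite sqr_sqrtr// subr_ge0 invf_ge1// ltW//.
Qed.

Lemma integral_inverse_quadratic s : 0 < s < 1 ->
  (\int[mu]_(z in I01) ((s + (1 - s) * z ^+ 2)^-1)%:E =
   (atan (r s) / (s * r s))%:E)%E.
Proof.
move=> s01; have /andP[s0 s1] := s01.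
have rs := r_gt0 s01; have rs2 := r_sqr s01.
pose F (z : R) := (s * r s)^-1 * atan (r s * z).
have dF (z : R) : is_derive z (1 : R) F ((s + (1 - s) * z ^+ 2)^-1).
  have da : is_derive z (1 : R) (fun z => atan (r s * z))
      ((1 + (r s * z) ^+ 2)^-1 * r s).
    apply: (@is_derive1_comp _ atan (fun z => r s * z)).
    rewrite (_ : (fun _ => _) = r s *: (id : R -> R)); last by apply/funext.
    by apply: is_derive_eq; rewrite /GRing.scale/= mulr1.
  rewrite (_ : F = (s * r s)^-1 *: (fun z => atan (r s * z))); last by apply/funext.
  apply: is_derive_eq; rewrite /GRing.scale/= exprMn rs2.
  have -> : s + (1 - s) * z ^+ 2 = s * (1 + (s^-1 - 1) * z ^+ 2).
    by field; rewrite gt_eqF.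
  have d0 : 0 < 1 + (s^-1 - 1) * z ^+ 2.
    by rewrite ltr_pwDl// -rs2 -exprMn sqr_ge0.
  move: (1 + _) d0 (r s) rs => d d0 r' rs.
  by field; rewrite !gt_eqF.
have cF : continuous F.
  by move=> z; apply: differentiable_continuous; apply/derivable1_diffP; have [] := dF z.
have d0 (z : R) : 0 < z < 1 -> 0 < s + (1 - s) * z ^+ 2.
  by move=> _; rewrite ltr_pwDl// mulr_ge0 ?sqr_ge0// subr_ge0 ltW.
transitivity ((F 1 - F 0)%:E).
  apply: (@ge0_FTC_oo _ (fun z => (s + (1 - s) * z ^+ 2)^-1) F 0 1 (F 0) (F 1)); first exact: ltr01.
  - move=> z z01; apply: cvgV; first by rewrite gt_eqF// d0.
    apply: cvgD; first exact: cvg_cst.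
    by apply: cvgM; [exact: cvg_cst|exact: exprn_continuous].
  - by move=> z z01; rewrite invr_ge0 ltW// d0.
  - by apply: cvg_at_right_filter; exact: cF.
  - by apply: cvg_at_left_filter; exact: cF.
by rewrite /F mulr1 mulr0 atan0 mulr0 subr0 mulrC.
Qed.

Let dr (s : R) : 0 < s < 1 -> is_derive s (1 : R) r (- (2 * s ^+ 2 * r s)^-1).
Proof.
move=> s01; have /andP[s0 s1] := s01.
have di : is_derive s (1 : R) (fun s : R => s^-1 - 1) (- s ^- 2).
  have d1 : is_derive s (1 : R) (@GRing.inv R) (- s ^- 2).
    have sn0 : (id : R -> R) s != 0 by rewrite gt_eqF.
    have did : derivable (id : R -> R) s 1 by exact: derivable_id.
    split; first exact: (derivableV sn0 did).
    by rewrite (deriveV sn0 did) derive_id /GRing.scale/= mulr1.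
  rewrite (_ : (fun _ => _) = (@GRing.inv R) - cst 1); last by apply/funext.
  by apply: is_derive_eq; rewrite subr0.
have d2 := @is_derive1_comp _ (@Num.sqrt R) (fun s : R => s^-1 - 1) s.
have p0 : 0 < s^-1 - 1 by rewrite subr_gt0 invf_gt1.
have := d2 _ _ (is_derive1_sqrt p0) di.
rewrite -/(r s) (_ : (_ * _) = (- (2 * s ^+ 2 * r s)^-1))//.
have rs := r_gt0 s01.
by field; rewrite !gt_eqF.
Qed.

(** The power is now -1 and integrating in s first would give a logarithm. Integrating in z first
    gives atan(r)/(s r), the derivative of -atan(r)^2, where atan(r) falls from pi/2 at s = 0 to 0
    at s = 1. *)
Lemma moment_2 : moment R 2 = ((pi ^+ 2) / 4)%:E.
Proof.
pose f (s : R) := atan (r s) / (s * r s).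
transitivity (\int[mu]_(s in I01) (f s)%:E)%E.
  transitivity (\int[mu]_(z in I01) \int[mu]_(s in I01)
      ((s + (1 - s) * z ^+ 2) `^ (- (2 / 2)))%:E)%E; first by [].
  have m2 : measurable2 (fun s z : R => ((s + (1 - s) * z ^+ 2) `^ (- (2 / 2)))%:E).
    apply/measurable_EFinP.
    apply: (@measurableT_comp _ _ _ _ _ _ (fun x : R => x `^ (- (2 / 2))) _
      (fun p : RL * RL => p.1 + (1 - p.1) * p.2 ^+ 2)); first exact: measurable_powR.
    apply: measurable_funD => //; apply: measurable_funM.
      by apply: measurable_funB.
    by apply: measurable_funX.
  rewrite (tonelli m2)//; last by move=> x y; rewrite lee_fin powR_ge0.
  apply: eq_integral => s; rewrite inE/= in_itv/= => s01.
  rewrite -integral_inverse_quadratic//; apply: eq_integral => z _.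
  rewrite divff// powR_inv1//; have /andP[s0 s1] := s01.
  by apply: addr_ge0; [exact: ltW|rewrite mulr_ge0 ?sqr_ge0// subr_ge0 ltW].
pose F (s : R) := - (atan (r s)) ^+ 2.
have dF (s : R) : 0 < s < 1 -> is_derive s (1 : R) F (f s).
  move=> s01; have /andP[s0 s1] := s01.
  have da := @is_derive1_comp _ atan r s _ _ (@is_derive1_atan R (r s)) (dr s01).
  rewrite (_ : F = - (fun s => atan (r s)) ^+ 2); last first.
    by apply/funext => x; rewrite /F !fctE.
  apply: is_derive_eq; rewrite /GRing.scale/= r_sqr// addrC subrK invrK /f.
  have rs := r_gt0 s01.
  by field; rewrite !gt_eqF.
transitivity ((0 - (- (pi / 2 : R) ^+ 2))%:E); last by congr (_%:E); field.
have cr (s : R) : 0 < s < 1 -> {for s, continuous r}.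
  move=> s01; apply: differentiable_continuous; apply/derivable1_diffP.
  by have [] := dr s01.
apply: (@ge0_FTC_oo _ f F 0 1); first exact: ltr01.
- move=> s s01; apply: cvgM.
    apply: (@continuous_comp _ _ _ r atan); first exact: cr.
    exact: continuous_atan.
  apply: cvgV; first by rewrite mulf_neq0// gt_eqF ?r_gt0//; case/andP: s01.
  by apply: cvgM; [exact: cvg_id|exact: cr].
- move=> s s01; rewrite /f divr_ge0//; last first.
    by rewrite mulr_ge0 ?sqrtr_ge0// ltW//; case/andP: s01.
  by rewrite -(@atan0 R) le_atan// sqrtr_ge0.
- apply: cvgN; rewrite expr2; under eq_fun do rewrite expr2.
  have ry : r s @[s --> 0^'+] --> +oo.
    apply/cvgryPge => A; near=> s.
    apply: le_trans (ler_norm A) _; rewrite -sqrtr_sqr ler_wsqrtr//.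
    have s0 : 0 < s by near: s; exact: nbhs_right_gt.
    have sA : s < (1 + A ^+ 2)^-1.
      by near: s; apply: nbhs_right_lt; rewrite invr_gt0 ltr_pwDl ?sqr_ge0.
    rewrite lerBrDl -[leLHS]invrK lef_pV2 ?posrE ?invr_gt0 ?ltr_pwDl ?sqr_ge0//.
    exact: ltW.
  have ay : atan (r s) @[s --> 0^'+] --> (pi / 2 : R).
    exact: (cvg_comp _ _ ry (@cvgy_atan R)).
  exact: cvgM.
- rewrite (_ : 0 = F 1); last by rewrite /F /r invr1 subrr sqrtr0 atan0 expr0n/= oppr0.
  apply: cvg_at_left_filter; apply: cvgN.
  apply: (@continuous_comp _ _ _ (fun s => atan (r s)) (fun x => x ^+ 2)); last first.
    exact: exprn_continuous.
  apply: (@continuous_comp _ _ _ r atan); last exact: continuous_atan.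
  apply: (@continuous_comp _ _ _ (fun s : R => s^-1 - 1) (@Num.sqrt R)); last first.
    exact: sqrt_continuous.
  apply: cvgB; last exact: cvg_cst.
  by apply: inv_continuous; rewrite oner_eq0.
Unshelve. all: by end_near. Qed.

End Moment.

(** * A strict lower bound for the limit integral, so that the variance constant is nonzero *)

Section StrictBound.
Context (R : realType) (k : nat).
Hypothesis k_ge2 : (2 <= k)%N.
Local Notation mu := (@lebesgue_measure R).
Local Notation RL := (measurableTypeR R).
Local Notation Rpos := (`]0%R, +oo[%classic : set R).
Local Notation I01 := (`]0%R, 1%R[%classic : set R).
Local Notation I12 := (`]1%R, 2%R[%classic : set R).
Local Notation c := (rate R k).

Let c0 : 0 < c. Proof. exact: rate_gt0. Qed.
Let k0 : (0 < k)%N. Proof. exact: leq_trans k_ge2. Qed.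
Let kp : 0 < k%:R :> R. Proof. by rewrite ltr0n. Qed.
Let ki1 : (k%:R : R)^-1 < 1.
Proof. by rewrite invf_lt1// ltr1n. Qed.

Lemma integral_powR01 (a : R) : 0 <= a < 1 ->
  (\int[mu]_(s in I01) (s `^ (- a))%:E = ((1 - a)^-1)%:E)%E.
Proof.
move=> /andP[a0 a1]; have a10 : 0 < 1 - a by rewrite subr_gt0.
pose F (s : R) := (1 - a)^-1 * s `^ (1 - a).
have dF (s : R) : 0 < s -> is_derive s (1 : R) F (s `^ (- a)).
  move=> s0; rewrite (_ : F = (1 - a)^-1 *: (@powR R ^~ (1 - a))); last by apply/funext.
  have dp := is_derive1_powR (1 - a) s0.
  apply: is_derive_eq; rewrite /GRing.scale/= mulrA mulVf ?gt_eqF// mul1r.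
  by congr (_ `^ _); ring.
transitivity (((1 - a)^-1 - 0)%:E); last by rewrite subr0.
apply: (@ge0_FTC_oo _ (fun s => s `^ (- a)) F 0 1); first exact: ltr01.
- by move=> s /andP[s0 _]; exact: continuous_powR_gt0.
- by move=> s _; exact: powR_ge0.
- by move=> s /andP[s0 _]; exact: dF.
- rewrite -[X in _ --> X](mulr0 (1 - a)^-1); apply: cvgM; first exact: cvg_cst.
  exact: powR_cvg0.
- apply: cvg_at_left_filter.
  rewrite (_ : (1 - a)^-1 = F 1); last by rewrite /F powR1 mulr1.
  apply: differentiable_continuous; apply/derivable1_diffP.
  by have [] := dF 1 ltr01.
Qed.

Definition damping (s u : R) : R := expR (- (c * `|s| * `|u| ^+ k)).

Lemma damping_ge0 s u : 0 <= damping s u. Proof. exact: expR_ge0. Qed.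
#[local] Hint Resolve damping_ge0 : core.

Lemma measurable_damping : measurable2 (fun u s : R => (damping s u)%:E).
Proof.
apply/measurable_EFinP; apply: (measurableT_comp (@measurable_expR R)).
apply: (measurableT_comp (@oppr_measurable R setT)).
have m1 : measurable_fun [set: RL * RL] (fun p => `|p.1| : R).
  by apply: measurableT_comp => //; exact: measurable_fst.
have m2 : measurable_fun [set: RL * RL] (fun p => `|p.2| : R).
  by apply: measurableT_comp => //; exact: measurable_snd.
by apply: measurable_funM; [exact: measurable_funM|exact: measurable_funX].
Qed.

Definition damping1 (v : R) : R := expR (- (c * `|v| ^+ k)).

Lemma measurable_damping1 : measurable_fun setT (fun v : R => (damping1 v)%:E).
Proof.
apply/measurable_EFinP; apply: (measurableT_comp (@measurable_expR R)).
apply: (measurableT_comp (@oppr_measurable R setT)).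
have m1 : measurable_fun setT (fun v : RL => `|v| : R) by exact: measurableT_comp.
by apply: measurable_funM; [exact: measurable_cst|exact: measurable_funX].
Qed.
#[local] Hint Resolve measurable_damping1 : core.

Definition mean_damping (u : R) : \bar R := (\int[mu]_(s in I01) (damping s u)%:E)%E.

Lemma mean_damping_ge0 u : (0 <= mean_damping u)%E.
Proof. by apply: integral_ge0 => s _; rewrite lee_fin. Qed.
#[local] Hint Resolve mean_damping_ge0 : core.

Lemma measurable_mean_damping : measurable_fun setT mean_damping.
Proof. by apply: (measurable_inner2 measurable_damping) => // x y; rewrite lee_fin. Qed.
#[local] Hint Resolve measurable_mean_damping : core.

Lemma lim_single_ge0 : (0 <= lim_single R k)%E.
Proof. by apply: integral_ge0 => s _; rewrite lee_fin expR_ge0. Qed.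
#[local] Hint Resolve lim_single_ge0 : core.

Lemma integral_damping1 : (\int[mu]_(v in Rpos) (damping1 v)%:E = lim_single R k)%E.
Proof.
apply: eq_integral => v; rewrite inE/= in_itv/= andbT => v0.
by rewrite /damping1 gtr0_norm.
Qed.

Lemma integral_damping s : 0 < s ->
  (\int[mu]_(u in Rpos) (damping s u)%:E = (s `^ (- k%:R^-1))%:E * lim_single R k)%E.
Proof.
move=> s0; rewrite (lim_singleE R k_ge2) muleA -EFinM.
have := @gamma_integral R 1 k isT k0 (c * s) (mulr_gt0 c0 s0).
rewrite mul1r powRM ?ltW// => h.
transitivity (\int[mu]_(v in Rpos) (v ^+ 1.-1 * expR (- (c * s * v ^+ k)))%:E)%E.
  apply: eq_integral => v; rewrite inE/= in_itv/= andbT => v0.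
  by rewrite /damping expr0 mul1r !gtr0_norm.
rewrite h; congr (_%:E * _)%E; ring.
Qed.

Lemma integral_mean_damping : (\int[mu]_(u in Rpos) mean_damping u =
  (k%:R / (k%:R - 1))%:E * lim_single R k)%E.
Proof.
rewrite -(tonelli measurable_damping)//.
transitivity (\int[mu]_(s in I01) ((s `^ (- k%:R^-1))%:E * lim_single R k))%E.
  apply: eq_integral => s; rewrite inE/= in_itv/= => /andP[s0 _].
  exact: integral_damping.
rewrite ge0_integralZr//.
- rewrite integral_powR01 ?invr_ge0 ?ltW//; congr (_%:E * _)%E.
  have k1 : k%:R - 1 != 0 :> R by rewrite subr_eq0 gt_eqF// ltr1n.
  by field; rewrite k1 gt_eqF.
- apply/measurable_EFinP/measurable_funTS; exact: measurable_powR.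
- by move=> s _; rewrite lee_fin powR_ge0.
- by move=> x y; rewrite lee_fin.
Qed.

(** On the square (1,2)^2, s times this number bounds from below the excess of the exponential of
    [lim_kernelE] over the product of dampings. *)
Definition kernel_gap : R := c * expR (- (2 * c * 2 ^+ k)).

Lemma kernel_gap_gt0 : 0 < kernel_gap. Proof. by rewrite mulr_gt0// expR_gt0. Qed.
#[local] Hint Resolve kernel_gap_gt0 : core.

Definition box (u v : R) : R := \1_I12 u * \1_I12 v.

Lemma box_ge0 u v : 0 <= box u v. Proof. by rewrite mulr_ge0. Qed.
#[local] Hint Resolve box_ge0 : core.

(** With m = min(u,v), max(u,v)^k = u^k + v^k - m^k. The right side is therefore the product of
    dampings times e^(c s m^k), and 1 + t <= e^t exhibits the gain. *)
Lemma damping_split (s u v : R) : 0 < s < 1 -> 0 < u -> 0 < v ->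
  damping s u * damping1 v + s * (kernel_gap * box u v) <=
  expR (- (s * (c * Num.max u v ^+ k) + (1 - s) * (c * v ^+ k))).
Proof.
move=> /andP[s0 s1] u0 v0; rewrite /damping /damping1 !gtr0_norm// -expRD.
set e := expR (_ + _).
pose m := Num.min u v.
have m0 : 0 < m by rewrite lt_min u0.
have mM : m ^+ k + Num.max u v ^+ k = u ^+ k + v ^+ k.
  rewrite /m; case: (leP u v) => _ //; by rewrite addrC.
have -> : expR (- (s * (c * Num.max u v ^+ k) + (1 - s) * (c * v ^+ k))) =
    e * expR (c * s * m ^+ k).
  rewrite /e -expRD; congr expR.
  have -> : m ^+ k = u ^+ k + v ^+ k - Num.max u v ^+ k by rewrite -mM addrK.
  by ring.
have e0 : 0 < e by exact: expR_gt0.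
apply: (@le_trans _ _ (e * (1 + c * s * m ^+ k))); last first.
  by apply: ler_wpM2l; [exact: ltW|exact: expR_ge1Dx].
rewrite mulrDr mulr1 lerD2l /box !indicE.
have pos : 0 <= e * (c * s * m ^+ k) by rewrite !mulr_ge0 ?exprn_ge0// ltW.
have [uI|] := boolP (u \in I12); last by rewrite mul0r !mulr0.
have [vI|] := boolP (v \in I12); last by rewrite !mulr0.
move: uI vI; rewrite !inE/= !in_itv/= => /andP[u1 u2] /andP[v1 v2].
rewrite !mulr1 /kernel_gap.
have m1 : 1 <= m ^+ k by rewrite exprn_ege1// le_min !ltW.
have eb : expR (- (2 * c * 2 ^+ k)) <= e.
  rewrite /e ler_expR.
  have hu : u ^+ k <= 2 ^+ k by rewrite lerXn2r ?nnegrE// ltW.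
  have hv : v ^+ k <= 2 ^+ k by rewrite lerXn2r ?nnegrE// ltW.
  have hu0 : 0 <= u ^+ k by rewrite exprn_ge0// ltW.
  have h1 : c * s * u ^+ k <= c * 2 ^+ k.
    rewrite -mulrA ler_pM2l//; apply: le_trans hu; by rewrite ger_pMl ?ltW ?exprn_gt0.
  have h2 : c * v ^+ k <= c * 2 ^+ k by rewrite ler_pM2l.
  by lra.
have g0 : 0 <= expR (- (2 * c * 2 ^+ k)) by exact: expR_ge0.
have cs0 : 0 <= c * s by rewrite mulr_ge0 ?ltW.
rewrite (_ : s * (c * _) = expR (- (2 * c * 2 ^+ k)) * (c * s)); last by ring.
apply: ler_pM => //; by rewrite ler_peMr.
Qed.

Lemma integral_id01 : (\int[mu]_(s in I01) s%:E = (2^-1)%:E)%E.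
Proof.
pose F (s : R) := 2^-1 * s ^+ 2.
have dF (s : R) : is_derive s (1 : R) F s.
  rewrite (_ : F = 2^-1 *: (id : R -> R) ^+ 2); last first.
    by apply/funext => t; rewrite /F !fctE.
  by apply: is_derive_eq; rewrite /GRing.scale/= mulr1; field.
have cF : continuous F.
  by move=> s; apply: differentiable_continuous; apply/derivable1_diffP; have [] := dF s.
transitivity ((F 1 - F 0)%:E); last by rewrite /F expr0n expr1n/= mulr0 mulr1 subr0.
apply: (@ge0_FTC_oo _ id F 0 1); first exact: ltr01.
- by move=> s _; exact: cvg_id.
- by move=> s /andP[/ltW].
- by apply: cvg_at_right_filter; exact: cF.
- by apply: cvg_at_left_filter; exact: cF.
Qed.

Lemma lim_kernel_lower u v : 0 < u -> 0 < v ->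
  (mean_damping u * (damping1 v)%:E + (kernel_gap / 2 * box u v)%:E <= (lim_kernel k u v)%:E)%E.
Proof.
move=> u0 v0; rewrite (lim_kernelE k_ge2)//.
have mEu : measurable_fun (I01 : set RL) (fun s : RL => (damping s u)%:E).
  by apply: measurable_funTS; exact: (measurable2_section2 measurable_damping u).
have -> : (kernel_gap / 2 * box u v)%:E = (\int[mu]_(s in I01) (s * (kernel_gap * box u v))%:E)%E.
  under eq_integral do rewrite EFinM.
  rewrite ge0_integralZr//.
  - by rewrite integral_id01 -EFinM; congr (_%:E); ring.
  - by move=> s; rewrite /= in_itv/= => /andP[/ltW].
  - by rewrite lee_fin mulr_ge0// ltW.
rewrite /mean_damping -ge0_integralZr//; last 2 first.
- by move=> s _; rewrite lee_fin.
- by rewrite lee_fin expR_ge0.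
have p0 : 0 <= kernel_gap * box u v by rewrite mulr_ge0// ltW.
rewrite -ge0_integralD//; last 4 first.
- by move=> s _; rewrite mule_ge0// lee_fin// expR_ge0.
- by apply: emeasurable_funM.
- by move=> s; rewrite /= in_itv/= => /andP[/ltW s0 _]; rewrite lee_fin mulr_ge0.
- by apply/measurable_EFinP/measurable_funTS/measurable_funM.
apply: ge0_le_integral => //.
- move=> s; rewrite /= in_itv/= => /andP[/ltW s0 _].
  apply: adde_ge0; last by rewrite lee_fin mulr_ge0.
  by apply: mule_ge0; rewrite lee_fin// expR_ge0.
- apply: emeasurable_funD; first exact: emeasurable_funM.
  by apply/measurable_EFinP/measurable_funTS/measurable_funM.
- apply/measurable_EFinP/measurable_funTS.
  apply: (measurableT_comp (@measurable_expR R)).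
  apply: (measurableT_comp (@oppr_measurable R setT)).
  apply: measurable_funD; apply: measurable_funM => //.
  by apply: measurable_funB.
- move=> s; rewrite /= in_itv/= => s01.
  by rewrite -EFinM -EFinD lee_fin damping_split.
Qed.

Lemma integral_box : (\int[mu]_(v in Rpos) \int[mu]_(u in Rpos) (kernel_gap / 2 * box u v)%:E =
  (kernel_gap / 2)%:E)%E.
Proof.
have g0 : 0 <= kernel_gap / 2 by rewrite mulr_ge0// ltW.
have m12 : measurable (I12 : set RL) by exact: measurable_itv.
have mi : measurable_fun setT (fun v : RL => (\1_I12 v : R)%:E).
  by apply/measurable_EFinP; exact: measurable_indic.
have one : (\int[mu]_(v in Rpos) (\1_I12 v : R)%:E = 1)%E.
  rewrite integral_indic// setIidl; last first.
    move=> v /=; rewrite !in_itv/= andbT => /andP[v1 _]; exact: lt_trans v1.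
  have := @lebesgue_measure_itv R `]1%R, 2%R[; rewrite /= lte_fin ltr1n/= => h.
  by apply: eq_trans h _; rewrite -EFinB; congr (_%:E); ring.
transitivity (\int[mu]_(v in Rpos) ((kernel_gap / 2)%:E * (\1_I12 v : R)%:E))%E.
  apply: eq_integral => v _.
  transitivity (\int[mu]_(u in Rpos) ((kernel_gap / 2 * \1_I12 v)%:E * (\1_I12 u : R)%:E))%E.
    by apply: eq_integral => u _; rewrite -EFinM; congr (_%:E); rewrite /box; ring.
  rewrite ge0_integralZl//; last 2 first.
  - exact: measurable_funTS.
  - by rewrite lee_fin mulr_ge0.
  by rewrite one mule1 EFinM.
rewrite ge0_integralZl//; last exact: measurable_funTS.
by rewrite one mule1.
Qed.

(** Integrate [lim_kernel_lower]. The product part separates: one variable gives L, and the other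
    gives L times the integral k/(k-1) of s^(-1/k), with L = [lim_single]. The square gives the
    positive excess. *)
Lemma lim_integral_lower : exists2 e : R, 0 < e &
  (lim_single R k * lim_single R k * (k%:R / (k%:R - 1))%:E + e%:E <=
   lim_integral R k)%E.
Proof.
exists (kernel_gap / 2); first by rewrite divr_gt0.
have g0 : 0 <= kernel_gap / 2 by rewrite mulr_ge0// ltW.
have mb : measurable2 (fun u v : R => (kernel_gap / 2 * box u v)%:E).
  have mi : measurable_fun setT (\1_I12 : RL -> R) by exact: measurable_indic.
  apply/measurable_EFinP; apply: measurable_funM; first exact: measurable_cst.
  apply: measurable_funM; apply: (@measurableT_comp _ _ _ _ _ _ (\1_I12 : RL -> R) _) => //.
have mbu v := measurable2_section1 mb v.
have E20 v : (0 <= (damping1 v)%:E)%E by rewrite lee_fin expR_ge0.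
pose J v : \bar R := (\int[mu]_(u in Rpos) (mean_damping u * (damping1 v)%:E + (kernel_gap / 2 * box u v)%:E))%E.
have bb0 u v : (0 <= (kernel_gap / 2 * box u v)%:E)%E by rewrite lee_fin mulr_ge0.
have JE v : J v = ((k%:R / (k%:R - 1))%:E * lim_single R k * (damping1 v)%:E +
    \int[mu]_(u in Rpos) (kernel_gap / 2 * box u v)%:E)%E.
  rewrite /J ge0_integralD//; last 3 first.
  - by move=> u _; exact: mule_ge0.
  - by apply: emeasurable_funM => //; exact: measurable_funTS.
  - by apply: measurable_funTS; exact: mbu.
  congr (_ + _)%E; rewrite -integral_mean_damping ge0_integralZr//.
  exact: measurable_funTS.
have -> : (lim_single R k * lim_single R k * (k%:R / (k%:R - 1))%:E + (kernel_gap / 2)%:E =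
    \int[mu]_(v in Rpos) J v)%E.
  have kk : (0 <= (k%:R / (k%:R - 1))%:E :> \bar R)%E.
    by rewrite lee_fin divr_ge0 ?subr_ge0 ?ler1n.
  under eq_integral do rewrite JE.
  rewrite ge0_integralD//; last 4 first.
  - by move=> v _; rewrite !mule_ge0.
  - by apply: emeasurable_funM => //; exact: measurable_funTS.
  - by move=> v _; exact: integral_ge0.
  - by apply: measurable_funTS; exact: (measurable_inner1 mb).
  rewrite integral_box ge0_integralZl//; last 2 first.
  - exact: measurable_funTS.
  - exact: mule_ge0.
  rewrite integral_damping1; congr (_ + _)%E.
  by rewrite [LHS]muleC muleA.
rewrite /lim_integral.
have mlk : measurable2 (fun x y : R => (lim_kernel k x y)%:E).
  by apply/measurable_EFinP; exact: measurable_lim_kernel.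
have lk0 (x y : R) : (0 <= (lim_kernel k x y)%:E)%E by rewrite lee_fin lim_kernel_ge0.
have mJ : measurable2 (fun u v : R => mean_damping u * (damping1 v)%:E + (kernel_gap / 2 * box u v)%:E)%E.
  apply: emeasurable_funD => //; apply: emeasurable_funM.
    by apply: (@measurableT_comp _ _ _ _ _ _ mean_damping _) => //; exact: measurable_fst.
  apply: (@measurableT_comp _ _ _ _ _ _ (fun v : RL => (damping1 v)%:E) _) => //.
have J0 (u v : R) : (0 <= mean_damping u * (damping1 v)%:E + (kernel_gap / 2 * box u v)%:E)%E.
  by rewrite adde_ge0// mule_ge0.
apply: ge0_le_integral => //.
- by move=> v _; exact: integral_ge0.
- by apply: measurable_funTS; exact: (measurable_inner1 mJ).
- by apply: measurable_funTS; exact: (measurable_inner1 mlk).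
- move=> v; rewrite /= in_itv/= andbT => v0.
  apply: ge0_le_integral => //.
  + by apply: measurable_funTS; exact: (measurable2_section1 mJ).
  + by apply: measurable_funTS; exact: (measurable2_section1 mlk).
  + by move=> u; rewrite /= in_itv/= andbT => u0; exact: lim_kernel_lower.
Qed.

End StrictBound.

(** * Moments of a number of occurring events *)

Section CountingMoments.
Context (R : realType) (d : measure_display) (Omega : measurableType d)
  (P : probability Omega R) (A : nat -> set Omega).
Hypothesis mA : forall j, measurable (A j).

Definition counting_events (n : nat) (w : Omega) : R := \sum_(1 <= j < n.+1) \1_(A j) w.

Local Notation X := counting_events.
Local Notation p1 j := (fine (P (A j))).
Local Notation p2 i j := (fine (P (A i `&` A j))).

Lemma counting_eventsS n w : X n.+1 w = X n w + \1_(A n.+1) w.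
Proof. by rewrite /X big_nat_recr. Qed.

(** X(X-1) counts ordered pairs of distinct events that occur. The induction adds an indicator b,
    and b^2 = b. *)
Lemma counting_events_fact n w : X n w * (X n w - 1) =
  \sum_(1 <= j < n.+1) \sum_(1 <= i < j) 2 * \1_(A i `&` A j) w.
Proof.
elim: n => [|n IH]; first by rewrite /X !big_geq// mul0r.
rewrite big_nat_recr//= -IH counting_eventsS.
rewrite (_ : \sum_(1 <= i < n.+1) _ = 2 * (X n w * \1_(A n.+1) w)); last first.
  rewrite -mulr_sumr /X mulr_suml; congr (_ * _).
  by apply: eq_bigr => i _; rewrite indicI.
have bb (x b : R) : b * b = b -> (x + b) * (x + b - 1) = x * (x - 1) + 2 * (x * b).
  move=> b2; rewrite (_ : _ * (_ - 1) = x * (x - 1) + 2 * (x * b) + (b * b - b)); last by ring.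
  by rewrite b2 subrr addr0.
by apply: bb; rewrite indicE -natrM mulnb andbb.
Qed.

Lemma measurable_counting_events n : measurable_fun setT (X n).
Proof. by apply: measurable_sum => i; exact: measurable_indic. Qed.

Lemma counting_events_ge0 n w : 0 <= X n w.
Proof. by apply: sumr_ge0 => i _; rewrite indicE. Qed.

Lemma counting_events_le n w : X n w <= n%:R.
Proof.
rewrite -[leRHS](_ : \sum_(1 <= j < n.+1) 1 = _); last first.
  by rewrite sumr_const_nat subSS subn0.
by apply: ler_sum => i _; rewrite indicE lern1 leq_b1.
Qed.

Lemma integral_sum_indic (I : Type) (s : seq I) (B : I -> set Omega) (c : R) :
  0 <= c -> (forall i, measurable (B i)) ->
  (\int[P]_w (\sum_(i <- s) c * \1_(B i) w)%:E =
   (\sum_(i <- s) c * fine (P (B i)))%:E)%E.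
Proof.
move=> c0 mB.
under eq_integral do rewrite -sumEFin.
rewrite ge0_integral_sum//; last 2 first.
- by move=> i; apply/measurable_EFinP/measurable_funM => //; exact: measurable_indic.
- by move=> i w _; rewrite lee_fin mulr_ge0// indicE.
rewrite -sumEFin; apply: eq_bigr => i _.
under eq_integral do rewrite EFinM.
rewrite ge0_integralZl//; last by apply/measurable_EFinP; exact: measurable_indic.
by rewrite integral_indic// setIT EFinM fineK// fin_num_measure.
Qed.

Lemma expectation_counting n : ('E_P[X n] = (\sum_(1 <= j < n.+1) p1 j)%:E)%E.
Proof.
rewrite unlock; transitivity (\int[P]_w (\sum_(1 <= j < n.+1) 1 * \1_(A j) w)%:E)%E.
  by apply: eq_integral => w _; congr (_%:E); apply: eq_bigr => i _; rewrite mul1r.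
rewrite integral_sum_indic//; congr (_%:E).
by apply: eq_bigr => i _; rewrite mul1r.
Qed.

Lemma expectation_counting_fact n :
  ('E_P[fun w => (X n w * (X n w - 1))%R] =
   (2 * \sum_(1 <= j < n.+1) \sum_(1 <= i < j) p2 i j)%:E)%E.
Proof.
rewrite unlock.
transitivity (\int[P]_w (\sum_(1 <= j < n.+1)
    (\sum_(1 <= i < j) 2 * \1_(A i `&` A j) w)%:E))%E.
  by apply: eq_integral => w _; rewrite counting_events_fact sumEFin.
rewrite ge0_integral_sum//; last 2 first.
- move=> j; apply/measurable_EFinP/measurable_sum => i.
  by apply: measurable_funM => //; apply: measurable_indic; exact: measurableI.
- by move=> j w _; rewrite lee_fin sumr_ge0// => i _; rewrite mulr_ge0// indicE.
rewrite mulr_sumr -sumEFin; apply: eq_bigr => j _.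
by rewrite integral_sum_indic ?mulr_sumr// => i; exact: measurableI.
Qed.

Lemma counting_integrable n : P.-integrable setT (EFin \o X n).
Proof.
apply: measurable_bounded_integrable => //.
- by apply: (le_lt_trans (probability_le1 P measurableT)); rewrite ltry.
- exact: measurable_counting_events.
exists n%:R; split=> // x nx w _ /=.
by rewrite ger0_norm ?counting_events_ge0// (le_trans (counting_events_le n w))// ltW.
Qed.

Lemma counting_sq_integrable n : P.-integrable setT (EFin \o (X n \* X n)).
Proof.
apply: measurable_bounded_integrable => //.
- by apply: (le_lt_trans (probability_le1 P measurableT)); rewrite ltry.
- by apply: measurable_funM; exact: measurable_counting_events.
exists (n%:R * n%:R); split=> // x nx w _ /=.
rewrite ger0_norm ?mulr_ge0 ?counting_events_ge0//.
by apply: le_trans (ltW nx); apply: ler_pM; rewrite ?counting_events_ge0 ?counting_events_le.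
Qed.

(** From X^2 = X(X-1) + X; integrability comes from 0 <= X <= n. *)
Lemma expectation_counting_sq n :
  ('E_P[fun w => (X n w ^+ 2)%R] =
   (2 * \sum_(1 <= j < n.+1) \sum_(1 <= i < j) p2 i j +
    \sum_(1 <= j < n.+1) p1 j)%:E)%E.
Proof.
rewrite EFinD -expectation_counting_fact -expectation_counting unlock.
rewrite -integralD//; last 2 first.
- rewrite (_ : (fun _ => _) = ((EFin \o (X n \* X n)%R) \- (EFin \o X n))%E); last first.
    by apply/funext => w; rewrite /= -EFinB; congr (_%:E); ring.
  by apply: integrableB => //; [exact: counting_sq_integrable|exact: counting_integrable].
- exact: counting_integrable.
by apply: eq_integral => w _; rewrite -EFinD; congr (_%:E); ring.
Qed.

Lemma variance_counting n :
  ('V_P[X n] = (2 * \sum_(1 <= j < n.+1) \sum_(1 <= i < j) p2 i j +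
    \sum_(1 <= j < n.+1) p1 j - (\sum_(1 <= j < n.+1) p1 j) ^+ 2)%:E)%E.
Proof.
rewrite /variance covarianceE; first last.
- by apply/Lfun1_integrable; exact: counting_sq_integrable.
- by apply/Lfun1_integrable; exact: counting_integrable.
- by apply/Lfun1_integrable; exact: counting_integrable.
rewrite -[(X n * X n)%R]/(fun w => X n w ^+ 2) expectation_counting_sq.
by rewrite expectation_counting -EFinM -EFinB expr2.
Qed.

End CountingMoments.

(** * The double integral as a sum over the first record of a pair *)

Section PairSum.
Context (R : realType).
Local Notation mu := (@lebesgue_measure R).
Local Notation RL := (measurableTypeR R).
Local Notation Rpos := (`]0%R, +oo[%classic : set R).
Variables S Q : R -> R.
Hypothesis mS : measurable_fun setT S.
Hypothesis mQ : measurable_fun setT Q.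
Hypothesis S0 : forall x, 0 <= S x.
Hypothesis Q0 : forall x, 0 <= Q x.

Let pair_kernel n i x y : R :=
  S (Num.max x y) ^+ i.-1 * Q (y - x) * S y ^+ (n.+2 - i).-1 * expR (- x) * expR (- y).

Let pair_kernel_ge0 n i x y : (0 <= (pair_kernel n i x y)%:E)%E.
Proof. by rewrite lee_fin !mulr_ge0 ?expR_ge0// exprn_ge0. Qed.

Let measurable_pair_kernel n i : measurable2 (fun x y => (pair_kernel n i x y)%:E).
Proof.
have m1 : measurable_fun [set: RL * RL] (fun p => p.1 : R) by exact: measurable_fst.
have m2 : measurable_fun [set: RL * RL] (fun p => p.2 : R) by exact: measurable_snd.
have me (f : RL * RL -> R) : measurable_fun setT f ->
    measurable_fun setT (fun p => expR (- f p)).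
  by move=> mf; apply: measurableT_comp => //; exact: measurableT_comp.
apply/measurable_EFinP.
apply: measurable_funM; last exact: me.
apply: measurable_funM; last exact: me.
apply: measurable_funM; last by apply: measurable_funX; exact: (measurableT_comp mS).
apply: measurable_funM; last by apply: (measurableT_comp mQ); exact: measurable_funB.
by apply: measurable_funX; apply: (measurableT_comp mS); exact: measurable_maxr.
Qed.

Lemma joint_integral_sum n : (joint_integral S Q n = \sum_(1 <= i < n.+2)
  \int[mu]_(y in Rpos) \int[mu]_(x in Rpos) (pair_kernel n i x y)%:E)%E.
Proof.
rewrite -ge0_integral_sum//; last 2 first.
- move=> i; apply: measurable_funTS.
  exact: (measurable_inner1 (measurable_pair_kernel n i) (pair_kernel_ge0 n i)).
- by move=> i y _; exact: integral_ge0.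
apply: eq_integral => y _; rewrite -ge0_integral_sum//; last first.
  by move=> i; apply: measurable_funTS; exact: (measurable2_section1 (measurable_pair_kernel n i) y).
apply: eq_integral => x _; rewrite sumEFin; congr (_%:E).
rewrite /joint_kernel big_add1 big_mkord mulr_sumr !mulr_suml.
apply: eq_bigr => m _; have mn : (m <= n)%N by rewrite -ltnS.
rewrite /pair_kernel subSS (subSn mn) /=; ring.
Qed.

End PairSum.

(** Since (n+1)/(n+2) tends to 1, shifting the index of g does not change a power-law equivalent. *)
Lemma cvg_powR_shift (R : realType) (g : nat -> R) (b l : R) :
  g n.+1 / n.+1%:R `^ b @[n --> \oo] --> l -> g n / n.+1%:R `^ b @[n --> \oo] --> l.
Proof.
move=> gl.
have r1 : n.+1%:R / n.+2%:R @[n --> \oo] --> (1 : R).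
  rewrite (_ : (fun n => _) = fun n => 1 - n.+2%:R^-1); last first.
    apply/funext => n; rewrite (_ : n.+1%:R = n.+2%:R - 1); last by rewrite -(natr1 n.+1) addrK.
    by rewrite mulrBl divff ?mul1r// pnatr_eq0.
  rewrite -[X in _ --> X]subr0; apply: cvgB; first exact: cvg_cst.
  by have := @cvg_harmonic R; rewrite -cvg_shiftS.
have r2 : n.+1%:R `^ b / n.+2%:R `^ b @[n --> \oo] --> (1 : R).
  rewrite (_ : (fun n => _) = fun n => (n.+1%:R / n.+2%:R) `^ b); last first.
    apply/funext => n; rewrite powRM ?invr_ge0// -powRN -[n.+2%:R^-1]powR_inv1//.
    by rewrite -powRrM mulN1r.
  rewrite -[X in _ --> X](_ : (1 : R) `^ b = 1); last by rewrite powR1.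
  apply: (@continuous_cvg _ _ _ _ _ _ (@powR R ^~ b) 1); last exact: r1.
  exact: continuous_powR_gt0.
rewrite -cvg_shiftS -[l]mulr1.
rewrite (_ : (fun n => _) = fun n => g n.+1 / n.+1%:R `^ b * (n.+1%:R `^ b / n.+2%:R `^ b)).
  exact: cvgM.
apply/funext => n; rewrite mulrA; congr (_ / _).
by rewrite divfK// powR_eq0 pnatr_eq0.
Qed.

Lemma cvg_powR_shiftn (R : realType) (m : nat) (g : nat -> R) (b l : R) :
  g (n + m)%N / n.+1%:R `^ b @[n --> \oo] --> l -> g n / n.+1%:R `^ b @[n --> \oo] --> l.
Proof.
elim: m g => [|m IH] g h; first by under eq_fun do rewrite -[X in g X]addn0.
apply: cvg_powR_shift; apply: (IH (fun n => g n.+1)).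
by under eq_fun do rewrite -addnS.
Qed.

(** * Asymptotics of the first moment and of the number of pairs of records *)

Section RecordAsymptotics.
Context (R : realType) (d : measure_display) (Omega : measurableType d)
  (P : probability Omega R) (T : nat -> nat -> {RV P >-> R}).
Hypothesis indepT : mutually_independent P
  [set ij : nat * nat | (1 <= ij.1)%N /\ (1 <= ij.2)%N]
  (fun ij => T ij.1 ij.2 : Omega -> R).
Hypothesis expT : forall i j, (1 <= i)%N -> (1 <= j)%N ->
  forall A : set R, measurable A -> distribution P (T i j) A = exponential_prob 1 A.
Variable k : nat.
Hypothesis k_ge2 : (2 <= k)%N.

Definition record_event (j : nat) : set Omega := [set w | is_record k T 1 j w].

Local Notation A := record_event.

Lemma num_recordsE n : num_records k T 1 n = counting_events R A n.
Proof.
apply/funext => w; apply: eq_bigr => j _; rewrite indicE; congr ((nat_of_bool _)%:R).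
by apply/idP/idP; rewrite inE.
Qed.

Lemma measurable_record_event j : measurable (A j).
Proof.
rewrite (_ : A j = \bigcap_(l in [set` index_iota 1 j])
    [set w | T 1%N j w < sumX (fun ij : nat * nat => T ij.1 ij.2) (column 1 k l) w]).
  apply: fin_bigcap_measurable => [|l _]; first exact: finite_seq.
  by apply: measurable_set_lt => //; exact: sumX_measurable.
by apply/seteqP; split => w /= /is_recordE.
Qed.

Local Notation S := (S_ T k).
Local Notation Q := (Q_ T k).

Lemma prob_record_event j : P (A j.+1) = single_integral S j.
Proof. exact: (prob_record indepT expT). Qed.

Lemma sum_prob_record_pairs n : (\sum_(1 <= i < n.+2) P (A i `&` A n.+2) =
  joint_integral S Q n)%E.
Proof.
rewrite joint_integral_sum; last 4 first.
- exact: measurable_tail_prob.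
- exact: measurable_tail_prob.
- exact: tail_prob_ge0.
- exact: tail_prob_ge0.
rewrite big_nat_cond [in RHS]big_nat_cond; apply: eq_bigr => i /andP[/andP[i1 ij] _].
exact: (prob_record2 indepT expT k_ge2 i1 ij).
Qed.

Lemma powR_sc n : n.+1%:R * sc R k n ^+ 2 = n.+1%:R `^ (2 - 2 / k%:R - 1).
Proof.
rewrite -powR_mulrn ?powR_ge0// -powRrM -[X in X * _](@powRr1 R)//.
rewrite -powRD; last by rewrite pnatr_eq0/= implybT.
by congr (_ `^ _); ring.
Qed.

Let Sb x : 0 <= x ->
  expR (- x) * (x ^+ k / k`!%:R) <= 1 - S x <= x ^+ k / k`!%:R.
Proof.
by move=> x0; have := tail_prob_bounds indepT expT k (a := 1) isT x0; rewrite subSS subn0.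
Qed.

Lemma expected_records_cvg :
  (\sum_(1 <= j < n.+1) fine (P (A j))) / n%:R `^ (1 - k%:R^-1) @[n --> \oo] -->
  fine (lim_single R k) / (1 - k%:R^-1) /\ lim_single R k \is a fin_num.
Proof.
have [h fin] := @single_integral_cvg R k k_ge2 S (measurable_tail_prob _ _)
  (tail_prob_ge0 _ _) (tail_prob_le1 _ _) Sb.
split=> //; apply: sum_powR_asymp; first by rewrite subr_gt0 invf_lt1 ?ltr1n ?ltr0n// ltnW.
(* The integral of index n+1 is the probability for node n+2, one beyond the index n+1 of the
   summation lemma. *)
apply: (@cvg_powR_shiftn _ 1 (fun n => fine (P (A n.+1)))).
rewrite (_ : (fun n => _) = fun n => fine (single_integral S n.+1) / sc R k n)//.
apply/funext => n; rewrite addn1 prob_record_event; congr (_ / (_ `^ _)); ring.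
Qed.

Lemma expected_record_pairs_cvg :
  (\sum_(1 <= j < n.+1) \sum_(1 <= i < j) fine (P (A i `&` A j))) /
    n%:R `^ (2 - 2 / k%:R) @[n --> \oo] -->
  fine (lim_integral R k) / (2 - 2 / k%:R) /\ lim_integral R k \is a fin_num.
Proof.
have Qb x : 0 <= x -> 1 - Q x <= x ^+ k.-1 / (k.-1)`!%:R.
  move=> x0; have /andP[_] := tail_prob_bounds indepT expT k (a := 2) isT x0.
  by rewrite subSS subn1.
have [h fin] := @joint_integral_cvg R k k_ge2 S Q (measurable_tail_prob _ _)
  (measurable_tail_prob _ _) (tail_prob_ge0 _ _) (tail_prob_le1 _ _)
  (@tail_prob_nonincreasing _ _ _ _ _ _) Sb
  (tail_prob_ge0 _ _) (tail_prob_le1 _ _)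
  (fun x => @tail_prob_lt0 _ _ _ _ _ indepT expT 2 k x isT) Qb.
split=> //; apply: sum_powR_asymp.
  by rewrite -{1}(mulr1 2) -mulrBr mulr_gt0// subr_gt0 invf_lt1 ?ltr1n ?ltr0n// ltnW.
(* Here the integral of index n+1 belongs to j = n+3, hence a shift by 2. *)
apply: (@cvg_powR_shiftn _ 2 (fun n => \sum_(1 <= i < n.+1) fine (P (A i `&` A n.+1)))).
rewrite (_ : (fun n => _) = fun n => fine (joint_integral S Q n.+1) / (n.+1%:R * sc R k n ^+ 2))//.
apply/funext => n; rewrite powR_sc addn2 -sum_prob_record_pairs; congr (_ / _).
rewrite -sum_fine// => i _; apply: fin_num_measure.
by apply: measurableI; exact: measurable_record_event.
Qed.

End RecordAsymptotics.

(** * Identification of the constants gamma and eta *)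

Section LimitConstants.
Context (R : realType).
Local Notation mu := (@lebesgue_measure R).
Local Notation RL := (measurableTypeR R).
Local Notation Rpos := (`]0%R, +oo[%classic : set R).

Lemma gammae1 : gammae (1 : R) = 1%E.
Proof.
transitivity (\int[mu]_(x in `[0%R, +oo[) (exponential_pdf 1 x)%:E)%E; last first.
  rewrite -(@integral_exponential_pdf R 1 ltr01) [LHS]integral_mkcond.
  apply: eq_integral => x _; rewrite patchE; case: ifPn => //.
  by rewrite notin_setE /exponential_pdf patchE => h; rewrite ifF// memNset.
rewrite -integral_itv_obnd_cbnd; last first.
  by apply/measurable_funTS/measurable_EFinP; exact: measurable_exponential_pdf.
apply: eq_integral => x; rewrite inE/= in_itv/= andbT => x0.
by rewrite exponential_pdfE ?ltW// subrr powRr0 !mul1r mulN1r.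
Qed.

(** The power substitution with p = 1 and k = 2 turns the Gaussian integral into half this Gamma
    integral. *)
Lemma gammae_half : gammae (2^-1 : R) = (Num.sqrt pi)%:E.
Proof.
have := @gamma_integral R 1 2 isT isT 1 ltr01.
rewrite powR1 !mul1r -/(gammae _) => h.
have : (\int[mu]_(v in Rpos) (v ^+ 1.-1 * expR (- (1 * v ^+ 2)))%:E = (Num.sqrt pi / 2)%:E)%E.
  rewrite -integral0y_gauss -integral_itv_obnd_cbnd; last first.
    apply/measurable_funTS/measurable_EFinP; exact: (@measurable_gauss_fun R).
  by apply: eq_integral => v _; rewrite expr0 !mul1r.
rewrite h; case: (gammae _) => [r||] //=.
- rewrite -EFinM => -[e]; congr (_%:E).
  by rewrite -[LHS](mulfK (_ : 2 != 0)) //; lra.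
- by rewrite mulry gtr0_sg// mul1e.
- by rewrite mulrNy gtr0_sg// mul1e.
Qed.

Lemma fineM_EFin (r : R) (x : \bar R) : fine (r%:E * x) = r * fine x.
Proof.
case: x => [//||] /=; rewrite mulr0; case: (ltgtP r 0) => [r0|r0|->]; rewrite ?mul0e//.
- by rewrite lt0_muley ?lte_fin.
- by rewrite gt0_muley ?lte_fin.
- by rewrite lt0_muleNy ?lte_fin.
- by rewrite gt0_muleNy ?lte_fin.
Qed.

Variable k : nat.
Hypothesis k_ge2 : (2 <= k)%N.

Let k0 : k%:R != 0 :> R. Proof. by rewrite pnatr_eq0 -lt0n (leq_trans _ k_ge2). Qed.
Let k1 : k%:R - 1 != 0 :> R. Proof. by rewrite subr_eq0 gt_eqF// ltr1n. Qed.
Let kp : 0 < 1 - (k%:R)^-1 :> R.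
Proof. by rewrite subr_gt0 invf_lt1 ?ltr1n ?ltr0n// ltnW. Qed.

Lemma powR_rate (x : R) : rate R k `^ (- x) = k`!%:R `^ x.
Proof. by rewrite /rate -powR_inv1// -powRrM mulrNN mul1r. Qed.

Lemma eta1E : eta1 R k = fine (lim_single R k) / (1 - k%:R^-1).
Proof.
rewrite lim_singleE// fineM_EFin powR_rate /eta1 /Gamma /Rintegral -/(gammae _).
by field; rewrite k0 k1.
Qed.

Lemma lim_integral_fine (m : R) : moment R k = m%:E ->
  fine (lim_integral R k) = k`!%:R `^ (2 / k%:R) / k%:R * Gamma (2 / k%:R) * (1 + m).
Proof.
move=> mE; rewrite lim_integralE// mE -EFinD muleC fineM_EFin fineM_EFin powR_rate.
by rewrite mulrC.
Qed.

Lemma gamma_E : gamma_ R k = 2 * (fine (lim_integral R k) / (2 - 2 / k%:R)).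
Proof.
rewrite /gamma_ /lambda_; case: ifPn => k2.
  have k3 : k%:R - 2 != 0 :> R by rewrite subr_eq0 gt_eqF// ltr_nat.
  rewrite (lim_integral_fine (moment_gt2 _ k2)).
  have e : 2 - 2 / k%:R = 2 * (k%:R - 1) / k%:R :> R by field; rewrite k0.
  by rewrite e; field; rewrite k0 k1 k3.
have kE : k = 2%N by apply/eqP; rewrite eqn_leq k_ge2 andbT leqNgt.
have mE : moment R k = (pi ^+ 2 / 4)%:E by rewrite kE moment_2.
rewrite (lim_integral_fine mE) kE divff// powRr1//.
have -> : Gamma (1 : R) = 1 by rewrite /Gamma /Rintegral -/(gammae _) gammae1.
have -> : 2`! = 2%N by [].
by field.
Qed.

(** With t = k/(k-1), L = [lim_single] and W = [lim_integral], eta^2 = L^2 t^2 and gamma = W t, so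
    the claim is L^2 t < W, which is [lim_integral_lower]. *)
Lemma eta1_lt_gamma : lim_single R k \is a fin_num -> lim_integral R k \is a fin_num ->
  eta1 R k ^+ 2 < gamma_ R k.
Proof.
move=> f1 f2; have [e e0 h0] := @lim_integral_lower R k k_ge2.
rewrite gamma_E eta1E; set L := fine (lim_single R k); set W := fine (lim_integral R k).
have h : L * L * (k%:R / (k%:R - 1)) + e <= W.
  by rewrite -lee_fin EFinD !EFinM /L /W !fineK.
have t0 : 0 < k%:R / (k%:R - 1) :> R.
  by rewrite divr_gt0 ?subr_gt0 ?ltr1n ?ltr0n// ltnW.
rewrite (_ : (L / _) ^+ 2 = L * L * (k%:R / (k%:R - 1)) * (k%:R / (k%:R - 1))); last first.
  by field; rewrite k0 k1.
rewrite (_ : 2 * _ = W * (k%:R / (k%:R - 1))); last first.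
  have ek : 2 - 2 / k%:R = 2 * (k%:R - 1) / k%:R :> R by field; rewrite k0.
  by rewrite ek; field; rewrite k0 k1.
by rewrite ltr_pM2r//; apply: lt_le_trans h; rewrite ltrDl.
Qed.

(** With Gamma(1) = 1 and Gamma(1/2)^2 = pi, gamma is 2 + pi^2/2 and eta^2 is 2 pi. *)
Lemma gamma_sub_eta1_2 : k = 2%N -> gamma_ R k - eta1 R k ^+ 2 = pi ^+ 2 / 2 + 2 - 2 * pi.
Proof.
move=> k2; rewrite /gamma_ /lambda_ /eta1 k2 ltnn divff// powRr1//.
rewrite /Gamma /Rintegral -/(gammae _) -/(gammae 2^-1) gammae1 gammae_half /=.
have sq : ((2 : R) `^ 2^-1) ^+ 2 = 2.
  by rewrite -powR_mulrn ?powR_ge0// -powRrM mulVf// powRr1.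
have -> : 2`! = 2%N by [].
rewrite exprMn sqr_sqrtr ?pi_ge0// expr_div_n sq.
by field.
Qed.

End LimitConstants.

(** * From limits of normalised moments to asymptotic equivalences *)

Lemma asymp_equiv_mull (R : realType) (f N : nat -> R) (l : R) : l != 0 ->
  f n / N n @[n --> \oo] --> l -> asymp_equiv f (fun n => l * N n).
Proof.
move=> l0 h; rewrite /asymp_equiv -(divff l0).
rewrite (_ : (fun n => _) = fun n => f n / N n * l^-1); last first.
  by apply/funext => n; rewrite invfM mulrA mulrAC.
by apply: cvgM h _; exact: cvg_cst.
Qed.

(** Nonvanishing of N is required from index 1 only, because the normalisation n^a with a != 0 is 0
    at n = 0. *)
Lemma asymp_equiv_ratio (R : realType) (f g N : nat -> R) (l : R) : l != 0 ->
  (forall n, N n.+1 != 0) ->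
  f n / N n @[n --> \oo] --> l -> g n / N n @[n --> \oo] --> l -> asymp_equiv f g.
Proof.
move=> l0 N0 hf hg; rewrite /asymp_equiv -(divff l0) -cvg_shiftS.
rewrite (_ : (fun n => _) = fun n => (f n.+1 / N n.+1) / (g n.+1 / N n.+1)); last first.
  by apply/funext => n; rewrite invfM invrK mulrACA mulVf ?mulr1// N0.
apply: cvgM; first by move: hf; rewrite -cvg_shiftS.
by apply: cvgV => //; move: hg; rewrite -cvg_shiftS.
Qed.

Unset Implicit Arguments.

Theorem theorem2 (R : realType) (d : measure_display)
    (Omega : measurableType d) (P : probability Omega R)
    (T : nat -> nat -> {RV P >-> R})
    (indepT : mutually_independent P
       [set ij : nat * nat | (1 <= ij.1)%N /\ (1 <= ij.2)%N]
       (fun ij => T ij.1 ij.2))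
    (expT : forall i j, (1 <= i)%N -> (1 <= j)%N ->
       forall A : set R, measurable A ->
         distribution P (T i j) A = exponential_prob 1 A)
    (k : nat) (k_ge2 : (2 <= k)%N) :
  let X n : Omega -> R := num_records k T 1 n in
  let E_fact n : R := fine 'E_P[fun w => X n w * (X n w - 1)] in
  let E_sq n : R := fine 'E_P[fun w => X n w ^+ 2] in
  let Var n : R := fine 'V_P[X n] in
  [/\ asymp_equiv E_fact E_sq,
      asymp_equiv E_sq (fun n => gamma_ R k * n%:R `^ (2 - 2 / k%:R)),
      asymp_equiv Var
        (fun n => (gamma_ R k - eta1 R k ^+ 2) * n%:R `^ (2 - 2 / k%:R)) &
      k = 2%N ->
      asymp_equiv Var (fun n => (pi ^+ 2 / 2 + 2 - 2 * pi) * n%:R)].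
Proof.
move=> X E_fact E_sq Var.
pose A := record_event T k.
have mA j : measurable (A j) by exact: measurable_record_event.
pose m1 n : R := \sum_(1 <= j < n.+1) fine (P (A j)).
pose m2 n : R := \sum_(1 <= j < n.+1) \sum_(1 <= i < j) fine (P (A i `&` A j)).
pose a : R := 2 - 2 / k%:R.
have XE n : X n = counting_events R A n by exact: num_recordsE.
have factE n : E_fact n = 2 * m2 n by rewrite /E_fact XE expectation_counting_fact.
have sqE n : E_sq n = 2 * m2 n + m1 n by rewrite /E_sq XE expectation_counting_sq.
have varE n : Var n = 2 * m2 n + m1 n - m1 n ^+ 2 by rewrite /Var XE variance_counting.
have [c1 f1] := expected_records_cvg indepT expT k_ge2.
have [c2 f2] := expected_record_pairs_cvg indepT expT k_ge2.
have ge := eta1_lt_gamma k_ge2 f1 f2.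
have g0 : gamma_ R k != 0 by rewrite gt_eqF// (le_lt_trans _ ge)// sqr_ge0.
have ge0 : gamma_ R k - eta1 R k ^+ 2 != 0 by rewrite subr_eq0 gt_eqF.
rewrite -eta1E// -/m1 in c1.
have cfact : E_fact n / n%:R `^ a @[n --> \oo] --> gamma_ R k.
  under eq_fun do rewrite factE -mulrA.
  by rewrite (gamma_E _ k_ge2); apply: cvgM => //; exact: cvg_cst.
(* The second-moment scale is the square of the first-moment scale: thus E[X] is negligible against
   it, while E[X]^2 contributes eta^2. *)
have a2 n : n%:R `^ a = n%:R `^ (1 - k%:R^-1) * n%:R `^ (1 - k%:R^-1) :> R.
  by rewrite -expr2 -powR_mulrn ?powR_ge0// -powRrM; congr (_ `^ _); rewrite /a; ring.
have c1a : m1 n / n%:R `^ a @[n --> \oo] --> (0 : R).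
  under eq_fun do rewrite a2 invfM mulrA.
  rewrite -(mulr0 (eta1 R k)); apply: cvgM => //.
  have a0 : 0 < 1 - (k%:R : R)^-1 by rewrite subr_gt0 invf_lt1 ?ltr1n ?ltr0n// ltnW.
  apply/gtr0_cvgV0; last exact: cvg_natn_powR.
  by exists 1%N => // n /= n0; rewrite powR_gt0 ?ltr0n.
have csq : E_sq n / n%:R `^ a @[n --> \oo] --> gamma_ R k.
  under eq_fun do rewrite sqE mulrDl -factE.
  by rewrite -(addr0 (gamma_ R k)); apply: cvgD.
have cvar : Var n / n%:R `^ a @[n --> \oo] --> gamma_ R k - eta1 R k ^+ 2.
  under eq_fun do rewrite varE -sqE mulrBl a2 expr2 invfM mulrACA -[X in _ - X]expr2.
  apply: cvgB; last by apply: cvgM.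
  by under eq_fun do rewrite -invfM -a2.
split.
- apply: (asymp_equiv_ratio g0 _ cfact csq) => n.
  by rewrite powR_eq0 pnatr_eq0.
- exact: asymp_equiv_mull.
- exact: asymp_equiv_mull.
- move=> k2; rewrite -(gamma_sub_eta1_2 R k2); apply: asymp_equiv_mull => //.
  have a1 : a = 1 by rewrite /a k2 divff//; ring.
  move: cvar; rewrite a1.
  by under eq_fun do rewrite powRr1//.
Qed.
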